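(* Let $B\to M$ be a vector bundle endowed with a Lie algebroid $\mu_B$, let $(\pi,E)$ be a Jacobi structure on the Lie algebroid $\mu_B$, let $A=B\oplus\mathbb R\to M$, and let $\mu\in\mathcal F_A^{1,2}$ be $\mu_B$ viewed in $\mathcal F_A\supset\mathcal F_B$. With $\epsilon\in\Gamma(A)$, $\phi\in\Gamma(A^* )$ the canonical section and projection associated with the summand $\mathbb R$, set $$\nu:=\{\pi,\mu\}+\phi\pi+\epsilon\{\mu,E\}-E\,\mathrm{id}_B\in\mathcal F_A^{2,1}.$$ Then: 1. The pair $(\mu+\phi,\nu-E)$ is a Jacobi bialgebroid structure on $A$. 2. The Poissonization $(\mu^0_\phi,\nu^1_{-E})$ of this Jacobi bialgebroid is the Lie bialgebroid $(\mu^0_\phi,\{P_{\pi,E},\mu^0_\phi\})$ on $p^*A\to M\times\mathbb R$ associated to the Poisson structure $P_{\pi,E}=e^{-t}(\pi+\epsilon E)$ (the Poissonization of the Jacobi structure $(\pi,E)$).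
   Context: **Big bracket.** For a vector bundle $A\to M$ of rank $d$ over an $n$-manifold, $\mathcal F_A=\bigoplus_{k,l\in\mathbb N}\mathcal F_A^{k,l}$ denotes the bigraded algebra of functions on the graded manifold $T^*\Pi A$. Locally it is generated, over the smooth functions of coordinates $x_1,\dots,x_n$ of $M$ (bi-degree $(0,0)$), by $p^1,\dots,p^n$ (bi-degree $(1,1)$), $\xi_1,\dots,\xi_d$ (bi-degree $(0,1)$, a local frame of $A^*$) and $\theta^1,\dots,\theta^d$ (bi-degree $(1,0)$, the dual local frame of $A$), with polynomial dependence in the $p^i$. It is graded commutative for the total degree: $F_1F_2=(-1)^{(k_1+l_1)(k_2+l_2)}F_2F_1$ for $F_i\in\mathcal F_A^{k_i,l_i}$. The big bracket $\{\cdot,\cdot\}$ is the canonical graded Poisson bracket, of bi-degree $(-1,-1)$, satisfying $\{F_1,F_2\}=-(-1)^{(k_1+l_1)(k_2+l_2)}\{F_2,F_1\}$, $\{F_1,F_2F_3\}=\{F_1,F_2\}F_3+(-1)^{(k_1+l_1)(k_2+l_2)}F_2\{F_1,F_3\}$, $\{F_1,\{F_2,F_3\}\}=\{\{F_1,F_2\},F_3\}+(-1)^{(k_1+l_1)(k_2+l_2)}\{F_2,\{F_1,F_3\}\}$, with $\{p^i,x_i\}=\{\theta^j,\xi_j\}=1$ and all other brackets of coordinates vanishing. One identifies $\mathcal F_A^{0,0}=C^\infty(M)$, $\mathcal F_A^{k,0}=\Gamma(\wedge^kA)$, $\mathcal F_A^{0,k}=\Gamma(\wedge^kA^* )$ (as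 graded algebras, the product being the wedge product); for $\xi\in\Gamma(A^* ),\theta\in\Gamma(A)$ one has $\{\xi,\theta\}=\{\theta,\xi\}=\xi(\theta)$. $\mathrm{id}_A:=\sum_j\xi_j\theta^j\in\mathcal F_A^{1,1}$, and similarly $\mathrm{id}_B\in\mathcal F_B$. There is a canonical isomorphism $\mathcal F_A\simeq\mathcal F_{A^*}$ of graded Poisson algebras exchanging $\mathcal F_A^{k,l}$ and $\mathcal F_{A^*}^{l,k}$; it is used to regard structures on $A^*$ as elements of $\mathcal F_A$, and under it $\mathrm{id}_{A^*}=-\mathrm{id}_A$. **Jacobi bialgebroids.** $\Gamma(\bigwedge A)=\bigoplus_k\Gamma(\wedge^kA)$. A pre-Jacobi algebroid on $A$ is $\mu+\phi$ with $\mu\in\mathcal F_A^{1,2}$, $\phi\in\Gamma(A^* )$; its bracket on $\Gamma(\bigwedge A)$ is $[P,Q]_{\mu,\phi}:=\{\{P,\mu+\mathrm{id}_A\phi\},Q\}-P\{\phi,Q\}+\{P,\phi\}Q$; it is a Jacobi algebroid if $\{\mu+\phi,\mu+\phi\}=0$. A pre-Jacobi algebroid on $A^*$ is $\nu+X$ with $\nu\in\mathcal F_A^{2,1}$, $X\in\Gamma(A)$; its differential on $\Gamma(\bigwedge A)$ is $\mathsf d_{\nu,X}(P):=\{\nu,P\}+XP$. The pair $(\mu+\phi,\nu+X)$ is a Jacobi bialgebroid if $\mu+\phi$ is a Jacobi algebroid, $\mathsf d_{\nu,X}^2=0$, and $\mathsf d_{\nu,X}[a,b]_{\mu,\phi}=[\mathsf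 d_{\nu,X}a,b]_{\mu,\phi}+(-1)^{k-1}[a,\mathsf d_{\nu,X}b]_{\mu,\phi}$ for all $k$, $a\in\Gamma(\wedge^kA)$, $b\in\Gamma(\bigwedge A)$. **Jacobi structures.** A Lie algebroid on $B$ is $\mu_B\in\mathcal F_B^{1,2}$ with $\{\mu_B,\mu_B\}=0$; its bracket on $\Gamma(\bigwedge B)$ is $[P,Q]_{\mu_B}=\{\{P,\mu_B\},Q\}$. A Jacobi structure on $\mu_B$ is a pair $(\pi,E)$, $\pi\in\Gamma(\wedge^2B)$, $E\in\Gamma(B)$, with $[\pi,\pi]_{\mu_B}=-2E\pi$ and $[E,\pi]_{\mu_B}=0$. **The bundle $A=B\oplus\mathbb R$.** $\epsilon\in\Gamma(A)$ is $m\mapsto(0_m,1)$ and $\phi\in\Gamma(A^* )$ is $\phi(b+f\epsilon)=f$ for $b\in\Gamma(B)$, $f\in C^\infty(M)$. There is a natural bracket-preserving inclusion $\mathcal F_B\subset\mathcal F_A$, and $\phi,\epsilon$ have zero big bracket with $\mathcal F_B$, while $\{\phi,\epsilon\}=1$. **Poissonization.** Let $p:M\times\mathbb R\to M$ be the projection, $p^*A\to M\times\mathbb R$ the pull-back, $t$ the projection $M\times\mathbb R\to\mathbb R$. There is a natural inclusion $\mathcal F_A\subset\mathcal F_{p^*A}$, and $\partial^t\in\mathcal F_{p^*A}^{1,1}$ is the unique function with $\{\partial^t,F\}=0$ for all $F\in\mathcal F_A$ and $\{\partial^t,t\}=1$. Set $\mu^0_\phi:=\mu+\phi\,\partial^t$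 and, for a pre-Jacobi algebroid $\nu+X$ on $A^*$, $\nu_X^1:=e^{-t}(\nu+X(\partial^t+\mathrm{id}_{A^*}))$. The Poissonization of a Jacobi bialgebroid $(\mu+\phi,\nu+X)$ is the pair $(\mu^0_\phi,\nu^1_X)$. A Lie bialgebroid on $C$ is a pair $(\alpha,\beta)\in\mathcal F_C^{1,2}\times\mathcal F_C^{2,1}$ with $\{\alpha+\beta,\alpha+\beta\}=0$. For a Poisson structure $P$ on a Lie algebroid $\alpha$ on $C$ (i.e. $P\in\Gamma(\wedge^2C)$, $\{\{P,\alpha\},P\}=0$), the Lie bialgebroid associated to $P$ is $(\alpha,\{P,\alpha\})$. *)

(* Defs.v *)
From HB Require Import structures.
From mathcomp Require Import all_boot all_order all_algebra ring.

Set Implicit Arguments.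
Unset Strict Implicit.
Unset Printing Implicit Defensive.
Import Order.TTheory GRing.Theory Num.Theory.
Local Open Scope ring_scope.

(* The exterior algebra over C on m generators e_0, .., e_(m-1): u is the sum of
   the u S *: e_S, where e_S is the product of the e_a, a \in S, in increasing
   order; e_T * e_U = (-1)^(einv T U) e_(T :|: U) for disjoint T and U. *)
Definition exterior (C : comNzRingType) (m : nat) := {ffun {set 'I_m} -> C}.

HB.instance Definition _ C m := GRing.Zmodule.on (exterior C m).

Section ExteriorRing.
Variables (C : comNzRingType) (m : nat).
Implicit Types (u v w : exterior C m) (S T U : {set 'I_m}).

Definition einv T U : nat :=
  #|[set ij : 'I_m * 'I_m | [&& ij.1 \in T, ij.2 \in U & (ij.2 < ij.1)%N]]|.

Definition emul u v : exterior C m :=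
  [ffun S : {set 'I_m} => \sum_(T : {set 'I_m} | T \subset S)
     (-1) ^+ einv T (S :\: T) * u T * v (S :\: T)].

Definition escal (c : C) : exterior C m := [ffun S => if S == set0 then c else 0].

Lemma einv0l U : einv set0 U = 0%N.
Proof. by apply/eqP; rewrite cards_eq0; apply/eqP/setP => ij; rewrite !inE. Qed.

Lemma einv0r T : einv T set0 = 0%N.
Proof.
by apply/eqP; rewrite cards_eq0; apply/eqP/setP => ij; rewrite !inE andbF.
Qed.

Lemma einvUl T T' U : [disjoint T & T'] ->
  einv (T :|: T') U = (einv T U + einv T' U)%N.
Proof.
move=> dTT; rewrite /einv -cardsUI [X in (_ + X)%N](_ : _ = 0%N) ?addn0.
  by apply: eq_card => ij; rewrite !inE andb_orl.
apply/eqP; rewrite cards_eq0; apply/eqP/setP => ij; rewrite !inE.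
apply/negP => /andP[/and3P[iT _ _] /and3P[iT' _ _]].
by have := disjointFr dTT iT; rewrite iT'.
Qed.

Lemma einvUr T U U' : [disjoint U & U'] ->
  einv T (U :|: U') = (einv T U + einv T U')%N.
Proof.
move=> dUU; rewrite /einv -cardsUI [X in (_ + X)%N](_ : _ = 0%N) ?addn0.
  by apply: eq_card => ij; rewrite !inE andb_orl andb_orr.
apply/eqP; rewrite cards_eq0; apply/eqP/setP => ij; rewrite !inE.
apply/negP => /andP[/and3P[_ iU _] /and3P[_ iU' _]].
by have := disjointFr dUU iU; rewrite iU'.
Qed.

Fact emulA : associative emul.
Proof.
move=> u v w; apply/ffunP => S; rewrite !ffunE.
under eq_bigr => T TS do rewrite ffunE mulr_sumr.
under [RHS]eq_bigr => T TS do rewrite ffunE mulr_sumr mulr_suml.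
rewrite [RHS](exchange_big_dep (fun T' => T' \subset S)) /=; last first.
  by move=> T T' TS T'T; apply: subset_trans T'T TS.
apply: eq_bigr => T TS.
rewrite [RHS](reindex_onto (fun U => T :|: U) (fun W => W :\: T)) /=; last first.
  move=> W /andP[_ TW]; apply/setP => x; rewrite !inE.
  by case: (boolP (x \in T)) => [/(subsetP TW)->|].
apply: eq_big => [U|U UST].
  rewrite subUset TS subsetUl setDUl setDv set0U /= ?andbT subsetD.
  by congr andb; apply/idP/eqP => [/setDidPl|/setDidPl].
have dTU : [disjoint T & U].
  by move: UST; rewrite subsetD disjoint_sym => /andP[].
have dTSU : [disjoint T & S :\: (T :|: U)].
  by rewrite disjoint_sym disjoints_subset; apply/subsetP=> x; rewrite !inE negb_or => /andP[/andP[]].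
have eST : S :\: T = U :|: (S :\: (T :|: U)).
  apply/setP => x; rewrite !inE negb_or.
  have := subsetP UST x; rewrite !inE.
  by case: (x \in U) => [/(_ isT) /andP[-> ->]|_]; case: (x \in T).
have dUS : [disjoint U & S :\: (T :|: U)].
  by rewrite disjoint_sym disjoints_subset; apply/subsetP=> x; rewrite !inE negb_or => /andP[/andP[]].
have -> : (T :|: U) :\: T = U.
  by rewrite setDUl setDv set0U; apply/setDidPl; rewrite disjoint_sym.
rewrite setDDl [in einv T _]eST.
by rewrite einvUr // einvUl // !exprD; ring.
Qed.

Fact emul1l : left_id (escal 1) emul.
Proof.
move=> u; apply/ffunP => S; rewrite ffunE (bigD1 set0) ?sub0set //= big1.
  by rewrite ffunE eqxx einv0l setD0 expr0 !mul1r addr0.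
by move=> T /andP[_ /negPf T0]; rewrite ffunE T0 mulr0 mul0r.
Qed.

Fact emul1r : right_id (escal 1) emul.
Proof.
move=> u; apply/ffunP => S; rewrite ffunE (bigD1 S) //= big1.
  by rewrite setDv ffunE eqxx einv0r expr0 mul1r mulr1 addr0.
move=> T /andP[TS nTS]; rewrite [escal _ _]ffunE setD_eq0 ifN ?mulr0 //.
by apply: contra nTS => ST; rewrite eqEsubset TS.
Qed.

Fact emulDl : left_distributive emul +%R.
Proof.
move=> u v w; apply/ffunP => S; rewrite !ffunE -big_split /=.
by apply: eq_bigr => T _; rewrite ffunE mulrDr mulrDl.
Qed.

Fact emulDr : right_distributive emul +%R.
Proof.
move=> u v w; apply/ffunP => S; rewrite !ffunE -big_split /=.
by apply: eq_bigr => T _; rewrite ffunE mulrDr.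
Qed.

Fact escal1_neq0 : escal 1 != 0.
Proof.
by apply/eqP => /ffunP/(_ set0); rewrite !ffunE eqxx; apply/eqP; exact: oner_neq0.
Qed.

HB.instance Definition _ := GRing.Zmodule_isNzRing.Build (exterior C m)
  emulA emul1l emul1r emulDl emulDr escal1_neq0.
End ExteriorRing.

Section ExteriorOps.
Variables (C : comNzRingType) (m : nat).

Definition egen (a : 'I_m) : exterior C m := [ffun S => (S == [set a])%:R].

(* Left and right derivatives along e_a: they send e_a * e_S, respectively
   e_S * e_a, to e_S when a \notin S, and kill the e_S with a \notin S. *)
Definition ederl (a : 'I_m) (u : exterior C m) : exterior C m :=
  [ffun S : {set 'I_m} =>
     if a \in S then 0 else (-1) ^+ einv [set a] S * u (a |: S)].

Definition ederr (a : 'I_m) (u : exterior C m) : exterior C m :=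
  [ffun S : {set 'I_m} =>
     if a \in S then 0 else (-1) ^+ einv S [set a] * u (a |: S)].

(* Morphism induced by a strictly increasing map [h] on generators. *)
Definition eincl (m' : nat) (h : 'I_m -> 'I_m') (u : exterior C m) :
  exterior C m' :=
  [ffun S : {set 'I_m'} =>
     if S \subset [set h a | a in [set: 'I_m]] then u (h @^-1: S) else 0].

Definition emap (C' : comNzRingType) (f : C -> C') (u : exterior C m) :
  exterior C' m := [ffun S => f (u S)].

End ExteriorOps.

From mathcomp Require Import all_classical all_reals all_analysis.
From mathcomp Require Import -(notations) mpoly.
Import numFieldNormedType.Exports.
Local Open Scope classical_set_scope.

Section Smooth.
Variables (R : realType) (n : nat).
Implicit Types (V : set 'rV[R]_n) (f : 'rV[R]_n -> R).

Definition partial (k : 'I_n) f : 'rV[R]_n -> R :=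
  fun x => 'D_(delta_mx ord0 k) f x.

(* Meaningful for open V: all iterated partial derivatives up to order r exist
   and are continuous on V. *)
Fixpoint Ck (r : nat) V f : Prop :=
  (forall x, V x -> {for x, continuous f}) /\
  (if r is r'.+1 then
     forall k, (forall x, V x -> derivable f x (delta_mx ord0 k)) /\
               Ck r' V (partial k f)
   else True).

Definition smooth_on V f := forall r, Ck r V f.

Lemma Ck_eq r V f g : open V -> (forall x, V x -> f x = g x) ->
  Ck r V f -> Ck r V g.
Proof.
move=> oV fg0 Cf0.
have nfg (h h' : 'rV[R]_n -> R) x : (forall x, V x -> h x = h' x) -> V x -> {near x, h =1 h'}.
  move=> hh' Vx; have : nbhs x V by apply: open_nbhs_nbhs.
  by apply: filterS => y /hh'.
have cont (h h' : 'rV[R]_n -> R) : (forall x, V x -> h x = h' x) ->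
    (forall x, V x -> {for x, continuous h}) ->
    forall x, V x -> {for x, continuous h'}.
  move=> hh' ch x Vx; rewrite /prop_for /continuous_at -hh' //.
  apply: cvg_trans (ch x Vx); apply: (@near_eq_cvg _ _ (nbhs x)).
  exact: nfg hh' Vx.
elim: r f g fg0 Cf0 => [|r IH] f g fg /= [cf df]; split=> //;
  try exact: cont fg cf.
move=> k; have [dk Ckk] := df k; split=> [x Vx|].
  by apply: near_eq_derivable (dk x Vx); exact: nfg.
by apply: IH Ckk => x Vx; apply: near_eq_derive; exact: nfg.
Qed.

Lemma Ck_cst r V (c : R) : Ck r V (fun=> c).
Proof.
elim: r c => [|r IH] c /=; (split; first by move=> x _; exact: cst_continuous).
  by [].
move=> k; split=> [x _|]; first exact: derivable_cst.
rewrite (_ : partial k _ = fun=> 0); first exact: IH.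
by apply/funext => x; exact: derive_cst.
Qed.

End Smooth.

Section SmoothProj.
Variables (R : realType) (n : nat).
Implicit Types (f : 'rV[R]_n -> R).

Lemma lsubmx_delta_l (k : 'I_n) :
  lsubmx (delta_mx ord0 (lshift 1 k) : 'rV[R]_(n + 1)) = delta_mx ord0 k.
Proof. by apply/rowP => j; rewrite !mxE !eqxx /= eq_lshift. Qed.

Lemma lsubmx_delta_r (k : 'I_1) :
  lsubmx (delta_mx ord0 (rshift n k) : 'rV[R]_(n + 1)) = 0.
Proof. by apply/rowP => j; rewrite !mxE eqxx /= eq_lrshift. Qed.

Lemma quot_lsubmx f (x v : 'rV[R]_(n + 1)) :
  (fun h : R => h^-1 *: (((f \o lsubmx) \o shift x) (h *: v) - (f \o lsubmx) x))
  = (fun h : R => h^-1 *: ((f \o shift (lsubmx x)) (h *: lsubmx v) - f (lsubmx x))).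
Proof.
by apply/funext => h /=; congr (_ *: (f _ - _)); apply/rowP => j; rewrite !mxE.
Qed.

Lemma derivable_lsubmx f (x v : 'rV[R]_(n + 1)) :
  derivable f (lsubmx x) (lsubmx v) -> derivable (f \o lsubmx) x v.
Proof. by rewrite /derivable quot_lsubmx. Qed.

Lemma derive_lsubmx f (x v : 'rV[R]_(n + 1)) :
  'D_v (f \o lsubmx) x = 'D_(lsubmx v) f (lsubmx x).
Proof. by rewrite /derive quot_lsubmx. Qed.

Lemma Ck_lsubmx r (V : set 'rV[R]_n) f :
  Ck r V f -> Ck r (lsubmx @^-1` V) (f \o (lsubmx : 'rV[R]_(n + 1) -> _)).
Proof.
elim: r f => [|r IH] f /= [cf df].
  by split=> // x Vx; apply: continuous_comp; [exact: continuous_lsubmx|exact: cf].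
split=> [x Vx|k].
  by apply: continuous_comp; [exact: continuous_lsubmx|exact: cf].
case: (split_ordP k) => [k' ->|k' ->].
  have [dk Ckk] := df k'; split=> [x Vx|].
    by apply: derivable_lsubmx; rewrite lsubmx_delta_l; exact: dk.
  rewrite (_ : partial _ _ = partial k' f \o lsubmx); first exact: IH.
  by apply/funext => x; rewrite /partial derive_lsubmx lsubmx_delta_l.
split=> [x Vx|].
  by apply: derivable_lsubmx; rewrite lsubmx_delta_r; exact: derivable0.
rewrite (_ : partial _ _ = fun=> 0); first exact: Ck_cst.
by apply/funext => x; rewrite /partial derive_lsubmx lsubmx_delta_r derive0.
Qed.

Lemma derive_entry (k j : 'I_n) (x : 'rV[R]_n) :
  is_derive x (delta_mx ord0 k) (fun y : 'rV[R]_n => y ord0 j) (j == k)%:R.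
Proof.
have E : (fun h : R => h^-1 *: (((fun y : 'rV[R]_n => y ord0 j) \o shift x)
    (h *: delta_mx ord0 k) - x ord0 j)) @ 0^' --> ((j == k)%:R : R).
  apply: (@cvg_trans _ ((fun=> (j == k)%:R : R) @ 0^')); last exact: cvg_cst.
  apply: near_eq_cvg; near=> h; rewrite /= !mxE eqxx /= addrK scalerA mulVf ?scale1r //.
  by near: h; exact: nbhs_dnbhs_neq.
apply: DeriveDef; last exact/cvg_lim.
by apply/cvg_ex; eexists; exact: E.
Unshelve. all: by end_near. Qed.

Lemma Ck_entry r (V : set 'rV[R]_n) j : Ck r V (fun x => x ord0 j).
Proof.
have c x : {for x, continuous (fun y : 'rV[R]_n => y ord0 j)}.
  exact: coord_continuous.
case: r => [|r] /=; split => // k; split => [x _|].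
  by have [] := derive_entry k j x.
rewrite (_ : partial _ _ = fun=> (j == k)%:R); first exact: Ck_cst.
by apply/funext => x; have [] := derive_entry k j x.
Qed.

End SmoothProj.

(* A smooth rank d vector bundle over a smooth n-manifold (Hausdorff, second
   countable), given by its fibres and by an atlas of charts of the base over
   each of which the bundle has a smooth frame; any atlas can be refined to such
   a one. The values of vb_chart and vb_frame off vb_dom, and those of vb_inv off
   the image of the chart, are irrelevant. *)
Record vbundle (R : realType) (n d : nat) := VBundle {
  vb_base : topologicalType ;
  vb_fib : vb_base -> vectType R ;
  vb_idx : Type ;
  vb_dom : vb_idx -> set vb_base ;
  vb_chart : vb_idx -> vb_base -> 'rV[R]_n ;
  vb_inv : vb_idx -> 'rV[R]_n -> vb_base ;
  vb_frame : vb_idx -> forall m : vb_base, d.-tuple (vb_fib m) ;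
  vb_hausdorff : hausdorff_space vb_base ;
  vb_countable : @second_countable vb_base ;
  vb_cover : forall m, exists i, vb_dom i m ;
  vb_open : forall i, open (vb_dom i) ;
  vb_open_im : forall i, open (vb_chart i @` vb_dom i) ;
  vb_chartK : forall i m, vb_dom i m -> vb_inv i (vb_chart i m) = m ;
  vb_chart_cont : forall i m, vb_dom i m -> {for m, continuous (vb_chart i)} ;
  vb_inv_cont : forall i x, (vb_chart i @` vb_dom i) x ->
    {for x, continuous (vb_inv i)} ;
  vb_chart_smooth : forall i j k,
    smooth_on (vb_chart i @` (vb_dom i `&` vb_dom j))
      (fun x => vb_chart j (vb_inv i x) ord0 k) ;
  vb_frame_basis : forall i m, vb_dom i m -> basis_of fullv (vb_frame i m) ;
  vb_frame_smooth : forall i j a b,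
    smooth_on (vb_chart i @` (vb_dom i `&` vb_dom j))
      (fun x => coord (vb_frame i (vb_inv i x)) a
                  (tnth (vb_frame j (vb_inv i x)) b)) }.

Section BundleTheory.
Variables (R : realType) (n d : nat) (A : vbundle R n d).

Lemma vb_overlap_open (i j : vb_idx A) :
  open (vb_chart i @` (vb_dom i `&` vb_dom j)).
Proof.
rewrite openE => _ [m [im jm] <-]; rewrite /interior.
have ix : (vb_chart i @` vb_dom i) (vb_chart i m) by exists m.
have U1 : nbhs (vb_chart i m) (vb_chart i @` vb_dom i).
  by apply: open_nbhs_nbhs; split => //; exact: vb_open_im.
have U2 : nbhs (vb_chart i m) (vb_inv i @^-1` vb_dom j).
  apply: (vb_inv_cont ix); rewrite vb_chartK //.
  by apply: open_nbhs_nbhs; split => //; exact: vb_open.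
apply: filterS2 U1 U2 => _ [p ip <-]; rewrite /preimage /= vb_chartK // => jp.
by exists p.
Qed.
End BundleTheory.

(* The Whitney sum of B with the trivial line bundle, with frames (e_a, 0) and,
   last, (0, 1). *)
Section AddLine.
Variables (R : realType) (n d : nat) (B : vbundle R n d).

Definition line_fib (m : vb_base B) : vectType R := (vb_fib m * R^o)%type.

Definition line_frame (i : vb_idx B) (m : vb_base B) : (d + 1).-tuple (line_fib m) :=
  [tuple of [seq ((v, 0) : line_fib m) | v <- vb_frame i m]
            ++ [tuple ((0, 1) : line_fib m)]].

Lemma tnth_line_l i m a :
  tnth (line_frame i m) (lshift 1 a) = (tnth (vb_frame i m) a, 0).
Proof. by rewrite tnth_lshift tnth_map. Qed.

Lemma tnth_line_r i m a : tnth (line_frame i m) (rshift d a) = (0, 1).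
Proof. by rewrite tnth_rshift (tnth_nth 0) (ord1 a). Qed.

Lemma line_decomp i m (v : vb_fib m) (c : R) : vb_dom i m ->
  ((v, c) : line_fib m) = \sum_(k < d + 1)
    (match fintype.split k with inl a => coord (vb_frame i m) a v | inr _ => c end)
      *: (line_frame i m)`_k.
Proof.
move=> im; rewrite big_split_ord big_ord1 /=.
have nthE (k : 'I_(d + 1)) : (line_frame i m)`_k = tnth (line_frame i m) k by rewrite (tnth_nth 0).
under eq_bigr => a _.
  rewrite (nthE (lshift 1 a)) tnth_line_l (unsplitK (inl _ a)) /=; over.
rewrite (nthE (rshift d ord0)) tnth_line_r (unsplitK (inr _ ord0)) /=.
rewrite {1}(coord_basis (vb_frame_basis im) (memvf v)).
have -> : \sum_(k < d) coord (vb_frame i m) k v *: ((tnth (vb_frame i m) k, 0) : line_fib m)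
        = (\sum_(k < d) coord (vb_frame i m) k v *: (vb_frame i m)`_k, 0).
  elim/big_rec2: _ => // k y1 y2 _ ->.
  by rewrite (tnth_nth 0); congr pair; rewrite /= scaler0 addr0.
by congr pair; rewrite /= ?scaler0 ?addr0 // add0r [RHS]mulr1.
Qed.

Lemma line_frame_basis i m : vb_dom i m -> basis_of fullv (line_frame i m).
Proof.
move=> im; have bB := vb_frame_basis im.
have dB : dim (vb_fib m) = d.
  by rewrite -dimvf; have /andP[/eqP <- /eqnP ->] := bB; rewrite size_tuple.
rewrite basisEdim size_tuple dimvf /dim /= dB leqnn andbT.
apply/subvP => -[v c] _; rewrite (line_decomp v c im); apply: rpred_sum => k _.
by apply: rpredZ; apply: memv_span; apply: mem_nth; rewrite size_tuple.
Qed.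

Lemma coord_line i m k (v : vb_fib m) (c : R) : vb_dom i m ->
  coord (line_frame i m) k ((v, c) : line_fib m) =
  match fintype.split k with inl a => coord (vb_frame i m) a v | inr _ => c end.
Proof.
move=> im; rewrite (line_decomp v c im) coord_sum_free //.
exact: basis_free (line_frame_basis im).
Qed.

Lemma line_frame_smooth (i j : vb_idx B) a b :
  smooth_on (vb_chart i @` (vb_dom i `&` vb_dom j))
    (fun x => coord (line_frame i (vb_inv i x)) a
                (tnth (line_frame j (vb_inv i x)) b)).
Proof.
move=> r; pose F x := match fintype.split a, fintype.split b with
  | inl a', inl b' => coord (vb_frame i (vb_inv i x)) a'
                        (tnth (vb_frame j (vb_inv i x)) b')
  | inr _, inr _ => 1
  | _, _ => 0
  end.
apply: (@Ck_eq _ _ _ _ F); first exact: vb_overlap_open.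
  move=> _ [m [im jm] <-]; rewrite /F vb_chartK //.
  case: (split_ordP b) => b' ->; rewrite ?tnth_line_l ?tnth_line_r coord_line //;
    rewrite ?(unsplitK (inl _ _)) ?(unsplitK (inr _ _)) /=;
    by case: (fintype.split a) => // ?; rewrite ?linear0.
rewrite /F; case: (fintype.split a) => a'; case: (fintype.split b) => b';
  try exact: Ck_cst.
exact: vb_frame_smooth.
Qed.

Definition add_line : vbundle R n (d + 1) := {|
  vb_fib := line_fib ;
  vb_dom := @vb_dom _ _ _ B ;
  vb_chart := @vb_chart _ _ _ B ;
  vb_inv := @vb_inv _ _ _ B ;
  vb_frame := line_frame ;
  vb_hausdorff := @vb_hausdorff _ _ _ B ;
  vb_countable := @vb_countable _ _ _ B ;
  vb_cover := @vb_cover _ _ _ B ;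
  vb_open := @vb_open _ _ _ B ;
  vb_open_im := @vb_open_im _ _ _ B ;
  vb_chartK := @vb_chartK _ _ _ B ;
  vb_chart_cont := @vb_chart_cont _ _ _ B ;
  vb_inv_cont := @vb_inv_cont _ _ _ B ;
  vb_chart_smooth := @vb_chart_smooth _ _ _ B ;
  vb_frame_basis := line_frame_basis ;
  vb_frame_smooth := line_frame_smooth |}.

End AddLine.

(* The pull-back of A to M * R; t is the last coordinate of the product charts. *)
Section Pullback.
Variables (R : realType) (n d : nat) (A : vbundle R n d).

Definition pull_base : topologicalType := (vb_base A * R)%type.
Definition pull_fib (y : pull_base) : vectType R := vb_fib y.1.
Definition pull_dom (i : vb_idx A) : set pull_base := [set y | vb_dom i y.1].
Definition pull_chart (i : vb_idx A) (y : pull_base) : 'rV[R]_(n + 1) :=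
  row_mx (vb_chart i y.1) y.2%:M.
Definition pull_inv (i : vb_idx A) (x : 'rV[R]_(n + 1)) : pull_base :=
  (vb_inv i (lsubmx x), x ord0 (rshift n ord0)).
Definition pull_frame (i : vb_idx A) (y : pull_base) : d.-tuple (pull_fib y) :=
  vb_frame i y.1.

Lemma pull_image (i : vb_idx A) (D : set (vb_base A)) :
  pull_chart i @` [set y | D y.1] = lsubmx @^-1` (vb_chart i @` D).
Proof.
apply/seteqP; split=> [_ [[m t] /= Dm <-]|x [m Dm mx]].
  by exists m => //=; rewrite /pull_chart row_mxKl.
exists (m, x ord0 (rshift n ord0)) => //=; rewrite /pull_chart /= mx.
rewrite -[RHS]hsubmxK; congr row_mx; apply/rowP => k.
by rewrite !mxE !ord1 eqxx mulr1n.
Qed.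

Lemma pull_hausdorff : hausdorff_space pull_base.
Proof.
move=> [m t] [m' t'] cl; congr pair.
  apply: (@vb_hausdorff _ _ _ A) => U V Um Vm'.
  have [||[p s] [/= Up Vp]] := cl (fst @^-1` U) (fst @^-1` V); last by exists p.
    exact: (@cvg_fst _ _ (nbhs m) (nbhs t)).
  exact: (@cvg_fst _ _ (nbhs m') (nbhs t')).
apply: (@Rhausdorff R) => U V Ut Vt'.
have [||[p s] [/= Us Vs]] := cl (snd @^-1` U) (snd @^-1` V); last by exists s.
  exact: (@cvg_snd _ _ (nbhs m) (nbhs t)).
exact: (@cvg_snd _ _ (nbhs m') (nbhs t')).
Qed.

Lemma pull_countable : @second_countable pull_base.
Proof.
have [Bs cB [oB bB]] := @vb_countable _ _ _ A.
pose I (q : rat * rat) : set R := `]ratr q.1, ratr q.2[.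
exists ((fun w : set (vb_base A) * (rat * rat) => w.1 `*` I w.2)
          @` (Bs `*` [set: rat * rat])).
  by apply: sub_countable (card_image_le _ _) _; apply: countableX => //; exact: countableP.
split=> [_ [[U q] [/= BU _] <-]|[m t] W].
  rewrite openE => -[p s] [/= Up Iq]; exists (U, I q) => //=; split=> /=;
    apply: open_nbhs_nbhs; split=> //; first [exact: oB | exact: interval_open].
move=> [[P Q] /= [Pm Qt] PQW].
have [U [BU Um] UP] := bB m P Pm.
move: Qt => /nbhs_ballP[e /= e0 eQ].
have te1 : t - e < t by rewrite ltrBlDr ltrDl.
have [q1] := rat_in_itvoo te1.
rewrite in_itv /= => /andP[eq1 q1t].
have te2 : t < t + e by rewrite ltrDl.
have [q2] := rat_in_itvoo te2.
rewrite in_itv /= => /andP[tq2 q2e].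
exists (U `*` I (q1, q2)).
  split; first by exists (U, (q1, q2)).
  by split => //=; rewrite /I /= in_itv /= q1t.
move=> [p s] [/= Up]; rewrite /I /= in_itv /= => /andP[qs sq].
apply: PQW; split => /=; first exact: UP.
by apply: eQ; rewrite /ball /= ltr_distlC (lt_trans eq1) // (lt_trans sq).
Qed.

Lemma pull_cover y : exists i, pull_dom i y.
Proof. by have [i im] := vb_cover y.1; exists i. Qed.

Lemma pull_open i : open (pull_dom i).
Proof.
apply: (@open_comp _ _ fst (vb_dom i)); last exact: vb_open.
by move=> y _; exact: cvg_fst.
Qed.

Lemma pull_open_im i : open (pull_chart i @` pull_dom i).
Proof.
rewrite pull_image; apply: open_comp; last exact: vb_open_im.
by move=> x _; exact: continuous_lsubmx.
Qed.

Lemma pull_chartK i y : pull_dom i y -> pull_inv i (pull_chart i y) = y.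
Proof.
case: y => m t im; rewrite /pull_inv /pull_chart row_mxKl vb_chartK //.
by rewrite row_mxEr mxE eqxx mulr1n.
Qed.

Lemma pull_chart_cont i y : pull_dom i y -> {for y, continuous (pull_chart i)}.
Proof.
case: y => m t im W [P Pc PW].
have cont k : {for ((m, t) : pull_base),
    continuous (fun y : pull_base => pull_chart i y ord0 k)}.
  case: (split_ordP k) => k' ->.
    rewrite (_ : (fun y => _) = (fun p => vb_chart i p ord0 k') \o fst).
      apply: continuous_comp; first exact: cvg_fst.
      apply: (@continuous_comp _ _ _ (vb_chart i) (fun x : 'rV[R]_n => x ord0 k')).
        exact: vb_chart_cont.
      exact: coord_continuous.
    by apply/funext => y /=; rewrite /pull_chart row_mxEl.
  rewrite (_ : (fun y => _) = snd); first exact: cvg_snd.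
  by apply/funext => y /=; rewrite /pull_chart row_mxEr mxE !ord1 /= ?eqxx ?mulr1n.
have : nbhs ((m, t) : pull_base)
    [set y | forall k, P ord0 k (pull_chart i y ord0 k)].
  apply: (@filter_forall _ _ (fun k y => P ord0 k (pull_chart i y ord0 k)) _
            (@nbhs_filter pull_base (m, t))) => k.
  by apply: cont; exact: Pc.
move=> N; apply: (@filterS _ _ (@nbhs_filter pull_base (m, t)) _ _ _ N) => y Py.
by apply: PW => a b; rewrite ord1; exact: Py.
Qed.

Lemma pull_inv_cont i x : (pull_chart i @` pull_dom i) x ->
  {for x, continuous (pull_inv i)}.
Proof.
rewrite pull_image => ix W [[P Q] [/= Px Qx] PQW].
have N1 : nbhs x (fun y : 'rV[R]_(n + 1) => P (vb_inv i (lsubmx y))).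
  have : {for x, continuous (vb_inv i \o (lsubmx : 'rV[R]_(n + 1) -> _))}.
    by apply: continuous_comp; [exact: continuous_lsubmx|exact: vb_inv_cont].
  by apply.
have N2 : nbhs x (fun y : 'rV[R]_(n + 1) => Q (y ord0 (rshift n ord0))).
  by have : {for x, continuous (fun y : 'rV[R]_(n + 1) => y ord0 (rshift n ord0))};
    [exact: coord_continuous|apply].
apply: (@filterS2 _ _ (@nbhs_filter _ x) _ _ _ _ N1 N2) => y Py Qy.
exact: PQW.
Qed.

Lemma pull_chart_smooth i j k :
  smooth_on (pull_chart i @` (pull_dom i `&` pull_dom j))
    (fun x => pull_chart j (pull_inv i x) ord0 k).
Proof.
move=> r; have -> : pull_dom i `&` pull_dom j =
  [set y : pull_base | (vb_dom i `&` vb_dom j) y.1] by [].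
rewrite pull_image; case: (split_ordP k) => k' ->.
  rewrite (_ : (fun x => _) =
    (fun x => vb_chart j (vb_inv i x) ord0 k') \o (lsubmx : 'rV[R]_(n + 1) -> _)).
    by apply: Ck_lsubmx; exact: vb_chart_smooth.
  by apply/funext => x /=; rewrite /pull_chart row_mxEl.
have -> : (fun x => pull_chart j (pull_inv i x) ord0 (rshift n k')) =
    (fun x : 'rV[R]_(n + 1) => x ord0 (rshift n ord0)); last exact: Ck_entry.
by apply/funext => x /=; rewrite /pull_chart row_mxEr mxE !ord1 /= ?eqxx ?mulr1n.
Qed.

Lemma pull_frame_smooth i j a b :
  smooth_on (pull_chart i @` (pull_dom i `&` pull_dom j))
    (fun x => coord (pull_frame i (pull_inv i x)) a
                (tnth (pull_frame j (pull_inv i x)) b)).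
Proof.
move=> r; have -> : pull_dom i `&` pull_dom j =
  [set y : pull_base | (vb_dom i `&` vb_dom j) y.1] by [].
rewrite pull_image.
exact: (Ck_lsubmx (@vb_frame_smooth _ _ _ A i j a b r)).
Qed.

Definition pullback : vbundle R (n + 1) d := {|
  vb_fib := pull_fib ;
  vb_dom := pull_dom ;
  vb_chart := pull_chart ;
  vb_inv := pull_inv ;
  vb_frame := pull_frame ;
  vb_hausdorff := pull_hausdorff ;
  vb_countable := pull_countable ;
  vb_cover := pull_cover ;
  vb_open := pull_open ;
  vb_open_im := pull_open_im ;
  vb_chartK := pull_chartK ;
  vb_chart_cont := pull_chart_cont ;
  vb_inv_cont := pull_inv_cont ;
  vb_chart_smooth := pull_chart_smooth ;
  vb_frame_basis := fun i y => @vb_frame_basis _ _ _ A i y.1 ;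
  vb_frame_smooth := pull_frame_smooth |}.

End Pullback.

(* The functions on T^*Pi(A) in a chart: polynomials in the even p^1, .., p^n over
   the exterior algebra on xi_1, .., xi_d, theta^1, .., theta^d (in this order)
   over the ring of functions of x. *)
Definition superfun (R : realType) (n d : nat) :=
  mpoly n (exterior (('rV[R]_n -> R) : comNzRingType) (d + d)).

Section Local.
Variables (R : realType) (n d : nat).
Local Notation sf := (superfun R n d).
Implicit Types (F G : sf).

Definition sf_fun (f : 'rV[R]_n -> R) : sf := mpolyC n (escal (d + d) f).
Definition sf_p (k : 'I_n) : sf := mpolyX _ (mnm1 k).
Definition sf_xi (a : 'I_d) : sf := mpolyC n (egen _ (lshift d a)).
Definition sf_theta (a : 'I_d) : sf := mpolyC n (egen _ (rshift d a)).

Definition sf_coef (w : multinom n) (S : {set 'I_(d + d)}) F : 'rV[R]_n -> R :=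
  (mcoeff w F : exterior _ _) S.

Definition sf_dx (k : 'I_n) F : sf := map_mpoly (emap (partial k)) F.
Definition sf_dp (k : 'I_n) F : sf := mderiv k F.
Definition sf_dl (c : 'I_(d + d)) F : sf := map_mpoly (ederl c) F.
Definition sf_dr (c : 'I_(d + d)) F : sf := map_mpoly (ederr c) F.

(* {p^k, x_k} = {theta^a, xi_a} = 1; the right derivatives of F absorb the sign
   of the odd part. *)
Definition sf_bracket F G : sf :=
  \sum_(k < n) (sf_dp k F * sf_dx k G - sf_dx k F * sf_dp k G) +
  \sum_(a < d) (sf_dr (rshift d a) F * sf_dl (lshift d a) G +
                sf_dr (lshift d a) F * sf_dl (rshift d a) G).

(* In a chart only the values on the image V of the chart matter. *)
Definition sf_eq_on (V : set 'rV[R]_n) F G :=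
  forall w S x, V x -> sf_coef w S F x = sf_coef w S G x.

Definition sf_smooth_on (V : set 'rV[R]_n) F :=
  forall w S, smooth_on V (sf_coef w S F).

Definition sf_bihom_on (V : set 'rV[R]_n) (k l : nat) F :=
  forall w (S : {set 'I_(d + d)}) x, V x -> sf_coef w S F x != 0 ->
    (mdeg w + #|[pred a : 'I_d | rshift d a \in S]|)%N = k /\
    (mdeg w + #|[pred a : 'I_d | lshift d a \in S]|)%N = l.

End Local.

Section Global.
Variables (R : realType) (n d : nat) (A : vbundle R n d).
Implicit Types (i j : vb_idx A).
Local Notation sf := (superfun R n d).

Definition vb_image i : set 'rV[R]_n := vb_chart i @` vb_dom i.
Definition vb_overlap i j : set 'rV[R]_n :=
  vb_chart i @` (vb_dom i `&` vb_dom j).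
Definition vb_change i j (x : 'rV[R]_n) := vb_chart j (vb_inv i x).
Definition vb_cocycle i j (a b : 'I_d) (m : vb_base A) : R :=
  coord (vb_frame i m) a (tnth (vb_frame j m) b).

(* The coordinates (y, q, eta, tau) of chart j in terms of the coordinates
   (x, p, xi, theta) of chart i. With H b a the b-th coordinate, in the frame of
   chart i, of the a-th frame vector of chart j,
     tau^a = sum_b (H b a) theta^b,   eta_a = sum_b (H^-1 a b) xi_b,
     q^k = sum_l (dx_l / dy_k) p^l + sum_(a, b) (d(H b a) / dy_k) eta_a theta^b,
   which is the lift to T^*Pi(A) of the change of coordinates of Pi(A): it is
   determined by {q^k, y_l} = (k == l), {q^k, eta_a} = 0, {tau^a, eta_b} =
   (a == b). *)
Definition sub_xi i j (a : 'I_d) : sf :=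
  \sum_(b < d) sf_fun d (fun x => vb_cocycle j i a b (vb_inv i x)) * sf_xi R n b.
Definition sub_theta i j (a : 'I_d) : sf :=
  \sum_(b < d) sf_fun d (fun x => vb_cocycle i j b a (vb_inv i x)) * sf_theta R n b.
Definition sub_p i j (k : 'I_n) : sf :=
  \sum_(l < n) sf_fun d (partial k (fun y => vb_change j i y ord0 l) \o vb_change i j)
     * sf_p R d l +
  \sum_(a < d) \sum_(b < d)
     sf_fun d (partial k (fun y => vb_cocycle i j b a (vb_inv j y)) \o vb_change i j)
     * (sub_xi i j a * sf_theta R n b).

Definition sub_odd i j (c : 'I_(d + d)) : sf :=
  match fintype.split c with inl a => sub_xi i j a | inr a => sub_theta i j a end.

(* Substitution of these expressions in a function F of (y, q, eta, tau). *)
Definition sf_change i j (F : sf) : sf :=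
  mmap (fun u : exterior _ (d + d) =>
          \sum_(S : {set 'I_(d + d)})
             sf_fun d (u S \o vb_change i j) * \prod_(c <- enum S) sub_odd i j c)
       (sub_p i j) F.

(* A function on T^*Pi(A) is represented by its expressions in the charts; the
   ring operations are chartwise, cf_eq is the equality, and in_F k l singles out
   the smooth families that are homogeneous of bidegree (k, l) and match on the
   overlaps, that is, the elements of F_A^(k, l). *)
Definition cofun := vb_idx A -> sf.
Implicit Types (F G P Q : cofun).

Definition cf_eq F G := forall i, sf_eq_on (vb_image i) (F i) (G i).

Definition cf_eq2 (F G : cofun * cofun) := cf_eq F.1 G.1 /\ cf_eq F.2 G.2.

Definition in_F (k l : nat) F :=
  (forall i, sf_smooth_on (vb_image i) (F i)) /\
  (forall i, sf_bihom_on (vb_image i) k l (F i)) /\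
  (forall i j, sf_eq_on (vb_overlap i j) (F i) (sf_change i j (F j))).

Definition bb F G : cofun := fun i => sf_bracket (F i) (G i).

(* The identifications of C^oo(M), Gamma(A) and Gamma(A^* ) with F_A^(0, 0),
   F_A^(1, 0) and F_A^(0, 1). *)
Definition cf_fun (f : vb_base A -> R) : cofun :=
  fun i => sf_fun d (f \o vb_inv i).
Definition cf_section (s : forall m, vb_fib m) : cofun :=
  fun i => \sum_(a < d)
    sf_fun d (fun x => coord (vb_frame i (vb_inv i x)) a (s (vb_inv i x)))
    * sf_theta R n a.
Definition cf_cosection (s : forall m : vb_base A, vb_fib m -> R) : cofun :=
  fun i => \sum_(a < d)
    sf_fun d (fun x => s (vb_inv i x) (tnth (vb_frame i (vb_inv i x)) a))
    * sf_xi R n a.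

Definition cf_id : cofun := fun i => \sum_(a < d) sf_xi R n a * sf_theta R n a.
(* id of A^*, seen in F_A: the isomorphism of F_(A^* ) with F_A exchanges the xi's
   and the theta's, so that this is - cf_id. *)
Definition cf_id_dual : cofun :=
  fun i => \sum_(a < d) sf_theta R n a * sf_xi R n a.

(* The sections of the whole exterior algebra bundle: finite sums of
   homogeneous ones. *)
Definition in_wedge P := exists (N : nat) (Q : nat -> cofun),
  (forall k, in_F k 0 (Q k)) /\ cf_eq P (\sum_(k < N) Q k).

Definition pre_jacobi_algebroid (mu phi : cofun) := in_F 1 2 mu /\ in_F 0 1 phi.

Definition jbracket (mu phi : cofun) P Q : cofun :=
  bb (bb P (mu + cf_id * phi)) Q - P * bb phi Q + bb P phi * Q.

Definition jacobi_algebroid (mu phi : cofun) :=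
  pre_jacobi_algebroid mu phi /\ cf_eq (bb (mu + phi) (mu + phi)) 0.

Definition pre_jacobi_algebroid_dual (nu X : cofun) := in_F 2 1 nu /\ in_F 1 0 X.

Definition jdiff (nu X : cofun) P : cofun := bb nu P + X * P.

(* The sign is (-1)^(k - 1), for k possibly 0. *)
Definition jacobi_bialgebroid (mu phi nu X : cofun) :=
  [/\ jacobi_algebroid mu phi,
      pre_jacobi_algebroid_dual nu X,
      forall P, in_wedge P -> cf_eq (jdiff nu X (jdiff nu X P)) 0 &
      forall k a b, in_F k 0 a -> in_wedge b ->
        cf_eq (jdiff nu X (jbracket mu phi a b))
              (jbracket mu phi (jdiff nu X a) b
               + (-1) ^+ k.+1 * jbracket mu phi a (jdiff nu X b))].

Definition lie_algebroid (mu : cofun) := in_F 1 2 mu /\ cf_eq (bb mu mu) 0.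

Definition lie_bracket (mu : cofun) P Q : cofun := bb (bb P mu) Q.

Definition jacobi_structure (mu pi E : cofun) :=
  [/\ in_F 2 0 pi, in_F 1 0 E,
      cf_eq (lie_bracket mu pi pi) (- (E * pi *+ 2)) &
      cf_eq (lie_bracket mu E pi) 0].

Definition lie_bialgebroid (ab : cofun * cofun) :=
  [/\ in_F 1 2 ab.1, in_F 2 1 ab.2 &
      cf_eq (bb (ab.1 + ab.2) (ab.1 + ab.2)) 0].

Definition poisson_structure (alpha P : cofun) :=
  in_F 2 0 P /\ cf_eq (lie_bracket alpha P P) 0.

Definition lie_bialgebroid_of (alpha P : cofun) : cofun * cofun :=
  (alpha, bb P alpha).

End Global.

Arguments cf_id {R n d} A.
Arguments cf_id_dual {R n d} A.

Section LineIncl.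
Variables (R : realType) (n d : nat) (B : vbundle R n d).
Local Notation A := (add_line B).

(* F_B in F_(B + R): the generators of the adapted frame of B are among those of
   the adapted frame of B + R. *)
Definition line_gen (c : 'I_(d + d)) : 'I_((d + 1) + (d + 1)) :=
  match fintype.split c with
  | inl a => lshift (d + 1) (lshift 1 a)
  | inr a => rshift (d + 1) (lshift 1 a)
  end.

Definition line_incl (F : cofun B) : cofun A :=
  fun i => map_mpoly (eincl line_gen) (F i).

Definition line_eps : cofun A :=
  cf_section (A := A) (fun m : vb_base B => ((0, 1) : line_fib m)).
Definition line_phi : cofun A :=
  cf_cosection (A := A) (fun (m : vb_base B) (v : line_fib m) => v.2).

End LineIncl.

Arguments line_eps {R n d} B.
Arguments line_phi {R n d} B.

Section Poissonization.
Variables (R : realType) (n d : nat) (A : vbundle R n d).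

Definition pull_incl (F : cofun A) : cofun (pullback A) :=
  fun i => mmap
    (fun u : exterior _ (d + d) =>
       mpolyC (n + 1) (emap (fun f : 'rV[R]_n -> R => f \o lsubmx) u)
         : superfun R (n + 1) d)
    (fun k => sf_p R d (lshift 1 k)) (F i).

(* The momentum dual to t in the product charts: it commutes with F_A, and its
   bracket with t is 1. *)
Definition partial_t : cofun (pullback A) := fun i => sf_p R d (rshift n ord0).

Definition exp_opp_t : cofun (pullback A) :=
  cf_fun (A := pullback A) (fun y : vb_base A * R => expR (- y.2)).

Definition poisson0 (mu phi : cofun A) : cofun (pullback A) :=
  pull_incl mu + pull_incl phi * partial_t.

Definition poisson1 (nu X : cofun A) : cofun (pullback A) :=
  exp_opp_t * (pull_incl nu + pull_incl X * (partial_t + pull_incl (cf_id_dual A))).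

Definition poissonization (mu phi nu X : cofun A) :
    cofun (pullback A) * cofun (pullback A) :=
  (poisson0 mu phi, poisson1 nu X).

End Poissonization.

Arguments partial_t {R n d} A.
Arguments exp_opp_t {R n d} A.

Definition poissonization_jacobi (R : realType) (n d : nat) (B : vbundle R n d)
    (pi E : cofun B) : cofun (pullback (add_line B)) :=
  exp_opp_t (add_line B)
    * pull_incl (line_incl pi + line_eps B * line_incl E).

(* Main.v *)
From HB Require Import structures.
Require Import Defs.
From Stdlib Require Ncring Ncring_tac.
From mathcomp Require Import all_boot all_order all_algebra ring lra.
From mathcomp Require Import -(notations) mpoly.

(** The theorem is deduced from a computation on p^*A, where the function exp(-t)
    is available. There it comes down to one consequence of the Jacobi identity
    ([br_poisson_diff]): if al is odd with {al, al} = 0 and P is even with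
    {{P, al}, P} = 0, then be = {P, al} satisfies {al, be} = 0 and {be, be} = 0.

    Let s = exp(-t), let pt be the momentum of t, and let mu0 = mu + phi pt and
    Lambda = pi + eps E. The two equations of a Jacobi structure amount to
    {{Lambda, mu}, Lambda} = -2 E Lambda ([biv_mu_biv]). As {pt, s} = - s, the
    factor s turns this into the Poisson equation for s Lambda with respect to mu0
    ([poisson_eq]), and {s Lambda, mu0} is the function
    beta = s (nu - E (pt - id_A)) of the second part ([poissonization_eq]).

    The first part is the trace on A of {beta, beta} = 0 and {beta, mu0} = 0. If c
    is a section of the k-th exterior power of A and r = s^(k - 1), then {beta, r c}
    is r s times the differential of c, and {{r a, mu0}, r' b} is r r' times the
    bracket of a and b ([beta_act], [bracket_act]): the terms of the differential
    and of the bracket which depend on the degrees come from the identity of A,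
    through the Euler formula {id_A, c} = - k c, and are produced upstairs by the
    derivatives of the powers of s. Hence the square of the differential
    and the defect of compatibility are, up to an invertible factor, expressions
    that vanish by the Jacobi identity ([jd_jd], [jd_jbr]).

    These computations take place in an abstract algebra ([bigraded_poisson]). To
    apply them in a chart with image V, the coefficients, which matter on V only,
    are replaced by the ring of the functions that are smooth on V and zero elsewhere.
    The partial derivatives are commuting derivations of this ring, by the theorem
    of Schwarz, and over every ring with commuting derivations the formula
    of the big bracket in coordinates defines a graded Poisson bracket: the Leibniz
    rule reduces the Jacobi identity to generators ([gbr_jacobi]). The inclusions
    of F_B in F_A and of F_A in F_(p^*A) send generators to generators and preserve
    their brackets, hence all brackets ([gincl_br]); the second one is injective, so
    that the identities found on p^*A hold on A.

    It remains to see that the chartwise formulas for nu, mu0 and beta glue. A change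
    of chart is a substitution of the generators, and it preserves the bracket
    of two functions, the second of which involves no xi and no momenta, since it
    does so on the generators of these ([chg_br], [in_F_bb]). The brackets in nu are
    of this kind, up to antisymmetry. *)

Set Implicit Arguments.
Unset Strict Implicit.
Unset Printing Implicit Defensive.
Import Order.TTheory GRing.Theory Num.Theory.
Local Open Scope ring_scope.

(** * Ordered products of anticommuting elements *)
Section SortedEnum.
Variable m : nat.
Implicit Types (a b : 'I_m) (S T U : {set 'I_m}).

Lemma ltI_trans k : transitive (relpre (val : 'I_k -> nat) ltn).
Proof. by move=> y x z; exact: ltn_trans. Qed.

Lemma ltI_irr k : irreflexive (relpre (val : 'I_k -> nat) ltn).
Proof. by move=> x; exact: ltnn. Qed.

Lemma enum_sorted S : sorted (relpre (val : 'I_m -> nat) ltn) (enum S).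
Proof.
rewrite /enum_mem; apply: sorted_filter; first exact: ltI_trans.
by rewrite -enumT -sorted_map val_enum_ord iota_ltn_sorted.
Qed.

Lemma enum_setU1_min b U : (forall c, c \in U -> (b < c)%N) ->
  enum (b |: U) = b :: enum U.
Proof.
move=> bU; apply: (@irr_sorted_eq _ (relpre val ltn)); try exact: enum_sorted.
- exact: ltI_trans.
- exact: ltI_irr.
- rewrite /= path_sortedE; last exact: ltI_trans.
  rewrite enum_sorted andbT; apply/allP => c; rewrite mem_enum; exact: bU.
by move=> c; rewrite inE !mem_enum !inE.
Qed.

Lemma enum_imset_mono k (h : 'I_m -> 'I_k) S :
  (forall i j : 'I_m, (i < j)%N -> (h i < h j)%N) ->
  enum [set h a | a in S] = [seq h a | a <- enum S].
Proof.
move=> hm; apply: (@irr_sorted_eq _ (relpre val ltn)).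
- exact: ltI_trans.
- exact: ltI_irr.
- by rewrite /enum_mem; apply: sorted_filter; [exact: ltI_trans|rewrite -enumT -sorted_map val_enum_ord iota_ltn_sorted].
- by rewrite sorted_map; apply: sub_sorted (enum_sorted S) => x y; exact: hm.
move=> c; rewrite mem_enum; apply/imsetP/mapP => -[x xS ->];
  by exists x; rewrite ?mem_enum // -mem_enum.
Qed.

(** Adding the elements in decreasing order keeps every new element in front of
    the others, where it multiplies without a sign. *)
Lemma set_min_ind (P : {set 'I_m} -> Prop) : P set0 ->
  (forall b U, (forall c, c \in U -> (b < c)%N) -> P U -> P (b |: U)) ->
  forall S, P S.
Proof.
move=> P0 PU S; have [N] := ubnP #|S|; elim: N S => // N IH S SN.
have [->//|/set0Pn[x xS]] := eqVneq S set0.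
have [b bS bmin] := arg_minnP (fun i : 'I_m => val i) xS.
have {}bS : b \in S by [].
rewrite -(setD1K bS); apply: PU.
  move=> c; rewrite !inE => /andP[cb /bmin]; rewrite /= leq_eqVlt => /orP[/eqP/val_inj E|//].
  by rewrite E eqxx in cb.
by apply: IH; rewrite [#|S|](cardsD1 b) bS in SN.
Qed.

Lemma einv1l a U : einv [set a] U = #|[set j in U | (j < a)%N]|.
Proof.
have pI : injective (fun j : 'I_m => (a, j)) by move=> x y [].
rewrite /einv -(card_imset [set j in U | (j < a)%N] pI).
apply: eq_card => -[i j]; rewrite !inE /=; apply/and3P/imsetP => [[/eqP-> jU ja]|].
  by exists j; rewrite // !inE jU.
by case=> k; rewrite !inE => /andP[kU ka] [-> ->].
Qed.

Lemma einv1r a U : einv U [set a] = #|[set j in U | (a < j)%N]|.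
Proof.
have pI : injective (fun j : 'I_m => (j, a)) by move=> x y [].
rewrite /einv -(card_imset [set j in U | (a < j)%N] pI).
apply: eq_card => -[i j]; rewrite !inE /=; apply/and3P/imsetP => [[iU /eqP-> ja]|].
  by exists i; rewrite // !inE iU.
by case=> k; rewrite !inE => /andP[kU ka] [-> ->].
Qed.

Lemma einv11 a b : einv [set a] [set b] = (b < a)%N.
Proof.
rewrite einv1l; case: ltnP => ba.
  rewrite (_ : [set _ in _ | _] = [set b]) ?cards1 //.
  by apply/setP => j; rewrite !inE; case: eqP => [->|].
apply/eqP; rewrite cards_eq0; apply/eqP/setP => j; rewrite !inE.
by case: eqP => [->|//]; rewrite ltnNge ba.
Qed.

Lemma einv1l_min b U : (forall c, c \in U -> (b < c)%N) -> einv [set b] U = 0%N.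
Proof.
move=> bU; rewrite einv1l; apply/eqP; rewrite cards_eq0; apply/eqP/setP => j.
by rewrite !inE; apply/negP => /andP[/bU jb bj]; rewrite ltnNge ltnW in jb.
Qed.

Lemma einv_swap1 a U : a \notin U -> (einv U [set a] + einv [set a] U)%N = #|U|.
Proof.
move=> aU; rewrite einv1l einv1r -cardsUI [X in (_ + X)%N](_ : _ = 0%N) ?addn0.
  apply: eq_card => j; rewrite !inE -andb_orr andbC; case: ltngtP => //= /val_inj E.
  by rewrite -E (negPf aU).
apply/eqP; rewrite cards_eq0; apply/eqP/setP => j; rewrite !inE.
by case: ltngtP; rewrite ?andbF.
Qed.

End SortedEnum.

Section OrderedProducts.
Variables (K : nzRingType) (m : nat) (e : 'I_m -> K).
Implicit Types (a b : 'I_m) (S T U : {set 'I_m}).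

Definition eprod S : K := \prod_(c <- enum S) e c.

Lemma eprod0 : eprod set0 = 1.
Proof. by rewrite /eprod enum_set0 big_nil. Qed.

Lemma eprodU1_min b U : (forall c, c \in U -> (b < c)%N) ->
  eprod (b |: U) = e b * eprod U.
Proof. by move=> bU; rewrite /eprod enum_setU1_min // big_cons. Qed.

Lemma eprod1 a : eprod [set a] = e a.
Proof. by rewrite /eprod enum_set1 big_seq1. Qed.

Hypothesis e_anti : forall a b, e a * e b = - (e b * e a).
Hypothesis e_sq : forall a, e a * e a = 0.

(** Moving e a to its place past the smaller elements costs the sign counted by
    [einv]; this is where anticommutation and the vanishing of squares are used. *)
Lemma e_eprod a U : e a * eprod U =
  if a \in U then 0 else (-1) ^+ einv [set a] U * eprod (a |: U).
Proof.
elim/set_min_ind: U => [|b U bU IH].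
  by rewrite inE einv0r expr0 mul1r eprod0 setU0 eprod1 mulr1.
have bNU : b \notin U by apply/negP => /bU; rewrite ltnn.
rewrite eprodU1_min // mulrA !inE; have [->|ab] /= := eqVneq a b.
  by rewrite e_sq mul0r.
have d1 : [disjoint [set b] & U] by rewrite disjoints1.
have [lt_ab|lt_ba] : (a < b)%N \/ (b < a)%N.
  by case: (ltngtP a b) => [||/val_inj E]; [left|right|rewrite E eqxx in ab].
  have aU c : c \in b |: U -> (a < c)%N.
    by rewrite !inE => /orP[/eqP->//|/bU]; exact: ltn_trans.
  have aNU : a \notin U by apply/negP => /bU; rewrite ltnNge ltnW.
  by rewrite (negPf aNU) einv1l_min // mul1r (eprodU1_min aU) (eprodU1_min bU) mulrA.
rewrite e_anti mulNr -mulrA IH; case: ifP => aU; first by rewrite mulr0 oppr0.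
rewrite einvUr // einv11 lt_ba exprS mulN1r mulNr; congr (- _).
rewrite setUCA (@eprodU1_min b).
  by rewrite [LHS]mulrA [RHS]mulrA; congr (_ * _); exact: commr_sign.
by move=> c; rewrite !inE => /orP[/eqP->//|]; exact: bU.
Qed.

Lemma eprodM T U : eprod T * eprod U =
  if [disjoint T & U] then (-1) ^+ einv T U * eprod (T :|: U) else 0.
Proof.
elim/set_min_ind: T => [|b T bT IH].
  by rewrite -setI_eq0 set0I eqxx eprod0 set0U einv0l.
have bNT : b \notin T by apply/negP => /bT; rewrite ltnn.
have -> : [disjoint b |: T & U] = (b \notin U) && [disjoint T & U].
  by rewrite -!setI_eq0 setIUl setU_eq0 setI_eq0 disjoints1.
rewrite eprodU1_min // -mulrA IH.
case: (boolP [disjoint T & U]) => dTU; last by rewrite mulr0 andbF.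
rewrite andbT mulrA (commr_sign (e b)) -mulrA e_eprod !inE (negPf bNT) /=.
case: (boolP (b \in U)) => bU; first by rewrite mulr0.
rewrite mulrA -exprD setUA; congr ((-1) ^+ _ * _).
rewrite einvUr // (einv1l_min bT) // add0n einvUl ?disjoints1 // addnC //.
Qed.

Lemma eprod_comm (x : K) T : (forall a, GRing.comm x (e a)) -> GRing.comm x (eprod T).
Proof. by move=> xe; apply: commr_prod. Qed.

End OrderedProducts.

(** * The exterior algebra and its universal property *)
Section ExteriorBasis.
Variables (C : comNzRingType) (m : nat).
Implicit Types (a b : 'I_m) (S T U : {set 'I_m}) (u v : exterior C m).
Local Notation egen := (@egen C m).

Lemma escal_mulE c u S : (escal m c * u) S = c * u S.
Proof.
rewrite ffunE (bigD1 set0) ?sub0set //= big1 => [|T /andP[_ /negPf T0]].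
  by rewrite addr0 ffunE eqxx einv0l setD0 expr0 mul1r.
by rewrite ffunE T0 mulr0 mul0r.
Qed.

Lemma mul_escalE c u S : (u * escal m c) S = u S * c.
Proof.
rewrite ffunE (bigD1 S) //= big1 => [|T /andP[TS nTS]].
  by rewrite setDv addr0 ffunE eqxx einv0r expr0 mul1r.
rewrite [escal _ _ _]ffunE setD_eq0 ifN ?mulr0 //.
by apply: contra nTS => ST; rewrite eqEsubset TS.
Qed.

Lemma escal_comm c u : GRing.comm (escal m c) u.
Proof. by apply/ffunP => S; rewrite escal_mulE mul_escalE mulrC. Qed.

Fact escal_is_zmod_morphism : zmod_morphism (escal m : C -> exterior C m).
Proof. by move=> c c'; apply/ffunP => S; rewrite !ffunE; case: ifP; rewrite ?subr0. Qed.
Fact escal_is_monoid_morphism : monoid_morphism (escal m : C -> exterior C m).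
Proof.
split=> [//|c c']; apply/ffunP => S; rewrite escal_mulE !ffunE.
by case: ifP; rewrite ?mulr0.
Qed.
HB.instance Definition _ := GRing.isZmodMorphism.Build C (exterior C m) (@escal C m)
  escal_is_zmod_morphism.
HB.instance Definition _ := GRing.isMonoidMorphism.Build C (exterior C m) (@escal C m)
  escal_is_monoid_morphism.

Lemma egen_mulE a u S : (egen a * u) S =
  if a \in S then (-1) ^+ einv [set a] (S :\ a) * u (S :\ a) else 0.
Proof.
rewrite ffunE; case: ifP => aS.
  rewrite (bigD1 [set a]) ?sub1set //= big1 ?addr0 => [|T /andP[_ /negPf Ta]].
    by rewrite ffunE eqxx mulr1.
  by rewrite ffunE Ta mulr0 mul0r.
apply: big1 => T TS; rewrite ffunE; case: eqP => [E|_]; last by rewrite mulr0 mul0r.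
by rewrite E sub1set aS in TS.
Qed.

Lemma egen_sq a : egen a * egen a = 0.
Proof.
apply/ffunP => S; rewrite egen_mulE ffunE [RHS]ffunE; case: ifP => // aS.
case: eqP => [/setP/(_ a)|_]; last by rewrite mulr0.
by rewrite !inE eqxx.
Qed.

Lemma setD1_eq1 a b S : a != b -> a \in S -> (S :\ a == [set b]) = (S == [set a; b]).
Proof.
move=> ab aS; apply/eqP/eqP => [<-|->]; first by rewrite setD1K.
by apply/setP => c; rewrite !inE; case: eqP => [->|]; rewrite ?(negPf ab).
Qed.

Lemma egen_anti a b : egen a * egen b = - (egen b * egen a).
Proof.
have [->|ab] := eqVneq a b; first by rewrite egen_sq oppr0.
apply/ffunP => S; rewrite [RHS]ffunE !egen_mulE !ffunE.
case aS: (a \in S); case bS: (b \in S); last by rewrite oppr0.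
- rewrite !setD1_eq1 //; last by rewrite eq_sym.
  rewrite [[set b; a]]setUC; case: eqP => [->|]; last by rewrite !mulr0 oppr0.
  have -> : [set a; b] :\ a = [set b].
    by apply/setP => c; rewrite !inE; case: eqP => [->|]; rewrite ?(negPf ab).
  have -> : [set a; b] :\ b = [set a].
    by apply/setP => c; rewrite !inE; case: (c =P b) => [->|]; rewrite ?orbF // eq_sym (negPf ab).
  rewrite !einv11 !mulr1; case: ltngtP => [_|_|/val_inj E]; rewrite ?expr0 ?expr1 ?opprK //.
  by rewrite E eqxx in ab.
- rewrite setD1_eq1 //; case: eqP => [E|_]; last by rewrite mulr0 oppr0.
  by move: bS; rewrite E !inE eqxx orbT.
rewrite setD1_eq1 //; last by rewrite eq_sym.
case: eqP => [E|_]; last by rewrite mulr0 oppr0.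
by move: aS; rewrite E !inE eqxx orbT.
Qed.

Lemma eprod_egenE S T : eprod egen S T = (T == S)%:R.
Proof.
elim/set_min_ind: S T => [|b U bU IH] T.
  by rewrite eprod0 ffunE; case: (_ == _).
have bNU : b \notin U by apply/negP => /bU; rewrite ltnn.
rewrite eprodU1_min // egen_mulE IH; case: ifP => bT; last first.
  by case: eqP => // E; rewrite E !inE eqxx in bT.
have -> : (T :\ b == U) = (T == b |: U).
  by apply/eqP/eqP => [<-|->]; [rewrite setD1K|rewrite setU1K].
case: eqP => [->|_]; last by rewrite mulr0.
by rewrite setU1K // einv1l_min // mul1r.
Qed.

Lemma ext_expand u : u = \sum_S escal m (u S) * eprod egen S.
Proof.
apply/ffunP => T; rewrite sum_ffunE (bigD1 T) //= big1 ?addr0.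
  by rewrite escal_mulE eprod_egenE eqxx mulr1.
by move=> S /negPf ST; rewrite escal_mulE eprod_egenE eq_sym ST mulr0.
Qed.

End ExteriorBasis.

Section Universal.
Variables (C : comNzRingType) (m : nat) (K : nzRingType).
Variables (f : {rmorphism C -> K}) (e : 'I_m -> K).
Hypothesis fe_comm : forall c a, GRing.comm (f c) (e a).
Hypothesis e_anti : forall a b, e a * e b = - (e b * e a).
Hypothesis e_sq : forall a, e a * e a = 0.
Implicit Types (u v : exterior C m).

Definition esub u : K := \sum_(S : {set 'I_m}) f (u S) * eprod e S.

Lemma esubB : {morph esub : u v / u - v}.
Proof.
move=> u v; rewrite /esub -sumrB; apply: eq_bigr => S _.
by rewrite !ffunE rmorphB mulrBl.
Qed.

Lemma esubD : {morph esub : u v / u + v}.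
Proof.
move=> u v; rewrite /esub -big_split; apply: eq_bigr => S _.
by rewrite !ffunE rmorphD mulrDl.
Qed.

Lemma esub_sum (I : Type) (r : seq I) (P : pred I) (F : I -> exterior C m) :
  esub (\sum_(i <- r | P i) F i) = \sum_(i <- r | P i) esub (F i).
Proof.
elim/big_rec2: _ => [|i y x _ <-]; last exact: esubD.
by rewrite /esub big1 // => S _; rewrite ffunE rmorph0 mul0r.
Qed.

Lemma esub_mono c S : esub (escal m c * eprod (@egen C m) S) = f c * eprod e S.
Proof.
rewrite /esub (bigD1 S) //= big1 ?addr0 => [|T /negPf TS].
  by rewrite escal_mulE eprod_egenE eqxx mulr1.
by rewrite escal_mulE eprod_egenE TS mulr0 rmorph0 mul0r.
Qed.

Lemma esub_escal c : esub (escal m c) = f c.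
Proof. by rewrite -[escal m c]mulr1 -(eprod0 (@egen C m)) esub_mono eprod0 mulr1. Qed.

Lemma esub_egen a : esub (egen C a) = e a.
Proof.
rewrite -[egen C a]mul1r -(rmorph1 (@escal C m)) -(eprod1 (@egen C m)) esub_mono.
by rewrite rmorph1 mul1r eprod1.
Qed.

Lemma esub1 : esub 1 = 1.
Proof. by rewrite esub_escal rmorph1. Qed.

(** A family of anticommuting elements of square zero extends to a ring morphism
    on the exterior algebra: both sides are biadditive, so that it is enough to
    compare them on products of basis monomials, where [eprodM] applies in
    source and target. *)
Lemma esubM : {morph esub : u v / u * v}.
Proof.
move=> u v; rewrite [u in LHS]ext_expand [v in LHS]ext_expand mulr_suml esub_sum.
rewrite [esub u]/esub mulr_suml; apply: eq_bigr => S _.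
rewrite mulr_sumr esub_sum [esub v]/esub mulr_sumr; apply: eq_bigr => T _.
rewrite -mulrA [eprod _ S * _]mulrA -[eprod _ S * _](escal_comm _ _) -[X in esub (_ * X)]mulrA.
rewrite [X in esub X]mulrA -rmorphM eprodM; [|exact: egen_anti|exact: egen_sq].
have -> : f (u S) * eprod e S * (f (v T) * eprod e T)
    = f (u S * v T) * (eprod e S * eprod e T).
  rewrite rmorphM -!mulrA; congr (_ * _); rewrite !mulrA; congr (_ * _).
  by apply/esym/eprod_comm => a; exact: fe_comm.
rewrite eprodM //; case: ifP => _; last by rewrite !mulr0 /esub big1 // => ? _; rewrite ffunE rmorph0 mul0r.
rewrite -[X in X * eprod (@egen C m) _](rmorph_sign (@escal C m)) mulrA -rmorphM esub_mono.
by rewrite mulrA rmorphM rmorph_sign.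
Qed.

End Universal.

Section ExteriorDerivatives.
Variables (C : comNzRingType) (m : nat).
Implicit Types (a b : 'I_m) (S T U : {set 'I_m}) (u v : exterior C m).
Local Notation egen := (@egen C m).

Lemma ederlD a u v : ederl a (u + v) = ederl a u + ederl a v.
Proof. by apply/ffunP => S; rewrite !ffunE; case: ifP; rewrite ?addr0 // mulrDr. Qed.

Lemma ederrD a u v : ederr a (u + v) = ederr a u + ederr a v.
Proof. by apply/ffunP => S; rewrite !ffunE; case: ifP; rewrite ?addr0 // mulrDr. Qed.

Lemma ederl_escal a c u : ederl a (escal m c * u) = escal m c * ederl a u.
Proof.
apply/ffunP => S; rewrite ffunE !escal_mulE [ederl _ _ _]ffunE.
by case: ifP; rewrite ?mulr0 // mulrCA.
Qed.

Lemma ederl_scal a (c : C) : ederl a (escal m c) = 0.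
Proof.
apply/ffunP => S; rewrite !ffunE; case: ifP => // aS.
by rewrite ifN ?mulr0 //; apply/set0Pn; exists a; rewrite !inE eqxx.
Qed.

Lemma ederl_egen_mul a b v :
  ederl a (egen b * v) = (if a == b then v else 0) - egen b * ederl a v.
Proof.
apply/ffunP => S; rewrite ffunE egen_mulE [RHS]ffunE [X in _ = _ + X]ffunE egen_mulE.
rewrite [ederl a v _]ffunE !inE.
have [<-{b}|ab] := eqVneq a b.
  case: (boolP (a \in S)) => aS /=.
    by rewrite setD1K // mulrA -expr2 sqrr_sign mul1r subrr.
  by rewrite oppr0 addr0 setU1K // mulrA -expr2 sqrr_sign mul1r.
rewrite [(0 : exterior C m) S]ffunE add0r /=.
case: (boolP (a \in S)) => aS; first by case: ifP; rewrite ?mulr0 oppr0.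
case: (boolP (b \in S)) => bS; last by rewrite mulr0 oppr0.
have -> : (a |: S) :\ b = a |: (S :\ b).
  by apply/setP => c; rewrite !inE; case: (c =P a) => [->|]; rewrite ?ab //.
rewrite 2!mulrA -mulNr -exprD -exprD; congr (_ * _).
have E1 : einv [set a] S = ((b < a) + einv [set a] (S :\ b))%N.
  by rewrite -[S in LHS](setD1K bS) einvUr ?einv11 // disjoints1 !inE eqxx.
have E2 : einv [set b] (a |: S :\ b) = ((a < b) + einv [set b] (S :\ b))%N.
  by rewrite einvUr ?einv11 // disjoints1 !inE (negPf aS) andbF.
rewrite E1 E2 addnACA exprD [in RHS]addnC -[RHS]mulN1r; congr (_ * _).
by case: ltngtP => [||/val_inj E]; rewrite ?expr1 //; rewrite E eqxx in ab.
Qed.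

Lemma ederrE a u S : ederr a u S = (-1) ^+ #|S| * ederl a u S.
Proof.
rewrite !ffunE; case: ifP => aS; first by rewrite mulr0.
rewrite mulrA -(einv_swap1 (negbT aS)) exprD; congr (_ * _).
by rewrite -mulrA -expr2 sqrr_sign mulr1.
Qed.

End ExteriorDerivatives.

(** Normalization of expressions over an arbitrary ring: once parities have turned
    the signs into explicit ones, the identities between brackets hold in the
    free noncommutative ring. *)
Section NcRing.
Variable K : nzRingType.
#[global] Instance nc_ops : @Ncring.Ring_ops K 0 1 +%R *%R (fun x y => x - y) -%R eq := {}.
#[global] Instance nc_ring : @Ncring.Ring K 0 1 +%R *%R (fun x y => x - y) -%R eq nc_ops.
Proof.
constructor; try by [].
- exact: RelationClasses.eq_equivalence.
- by move=> ? ? -> ? ? ->.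
- by move=> ? ? -> ? ? ->.
- by move=> ? ? -> ? ? ->.
- by move=> ? ? ->.
- exact: add0r.
- exact: addrC.
- exact: addrA.
- exact: mul1r.
- exact: mulr1.
- exact: mulrA.
- exact: mulrDl.
- by move=> x y z; exact: mulrDr.
exact: subrr.
Qed.
End NcRing.

Ltac ncring := Ncring_tac.non_commutative_ring.

(** * Super Poisson algebras *)
Definition sg (V : zmodType) (b : bool) (x : V) : V := if b then - x else x.

(** The parity is a predicate and not a function, since only homogeneous elements
    have one. *)
Record super_poisson (K : nzRingType) (par : bool -> K -> Prop) (br : K -> K -> K) : Prop :=
  SuperPoisson {
  sp_parD : forall a x y, par a x -> par a y -> par a (x + y) ;
  sp_parN : forall a x, par a x -> par a (- x) ;
  sp_parM : forall a b x y, par a x -> par b y -> par (a (+) b) (x * y) ;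
  sp_parB : forall a b x y, par a x -> par b y -> par (a (+) b) (br x y) ;
  sp_comm : forall a b x y, par a x -> par b y -> x * y = sg (a && b) (y * x) ;
  sp_addr : forall x y z, br x (y + z) = br x y + br x z ;
  sp_addl : forall x y z, br (x + y) z = br x z + br y z ;
  sp_anti : forall a b x y, par a x -> par b y -> br x y = - sg (a && b) (br y x) ;
  sp_leib : forall a b x y z, par a x -> par b y ->
    br x (y * z) = br x y * z + sg (a && b) (y * br x z) }.

Section SuperPoissonTheory.
Variables (K : nzRingType) (par : bool -> K -> Prop) (br : K -> K -> K).
Hypothesis SP : super_poisson par br.
Implicit Types (x y z u v w : K) (a b c : bool).

Lemma sp_0r x : br x 0 = 0.
Proof. by apply: (addrI (br x 0)); rewrite -(sp_addr SP) !addr0. Qed.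

Lemma sp_0l x : br 0 x = 0.
Proof. by apply: (addrI (br 0 x)); rewrite -(sp_addl SP) !addr0. Qed.

Lemma sp_oppr x y : br x (- y) = - br x y.
Proof. by apply: (addrI (br x y)); rewrite -(sp_addr SP) !subrr sp_0r. Qed.

Lemma sp_oppl x y : br (- x) y = - br x y.
Proof. by apply: (addrI (br x y)); rewrite -(sp_addl SP) !subrr sp_0l. Qed.

Lemma sp_leibl a b c x y z : par a x -> par b y -> par c z ->
  br (x * y) z = x * br y z + sg (b && c) (br x z * y).
Proof.
move=> px py pz; have pxy := sp_parM SP px py.
rewrite (sp_anti SP pxy pz) (sp_leib SP _ pz px) (sp_anti SP px pz) (sp_anti SP py pz).
by case: a px pxy => px pxy; case: b py pxy => py pxy; case: c pz => pz; rewrite /sg /=; ncring.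
Qed.

Definition jacobi_id a b x y z :=
  br x (br y z) = br (br x y) z + sg (a && b) (br y (br x z)).

(** The iterated brackets with x and y obey the same graded Leibniz rule, hence
    Jacobi identities propagate from generators to products; with [jacobi_add]
    and the symmetries below this reduces them to generators. *)
Lemma jacobi_mul a b c x y z1 z2 : par a x -> par b y -> par c z1 ->
  jacobi_id a b x y z1 -> jacobi_id a b x y z2 -> jacobi_id a b x y (z1 * z2).
Proof.
move=> px py pz J1 J2; rewrite /jacobi_id.
have pyz := sp_parB SP py pz; have pxz := sp_parB SP px pz.
have pxy := sp_parB SP px py.
rewrite (sp_leib SP _ py pz) (sp_leib SP _ px pz) (sp_leib SP _ pxy pz) !(sp_addr SP).
move: J1 J2; rewrite /jacobi_id.
case: a px pxy pxz => px pxy pxz; case: b py pxy pyz => py pxy pyz;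
case: c pz pxz pyz => pz pxz pyz; rewrite /sg /= ?sp_oppr;
rewrite ?(sp_leib SP _ px pyz) ?(sp_leib SP _ px pz) ?(sp_leib SP _ py pz) ?(sp_leib SP _ py pxz) /sg /=;
move=> -> ->; ncring.
Qed.

Lemma jacobi_add a b x y z1 z2 :
  jacobi_id a b x y z1 -> jacobi_id a b x y z2 -> jacobi_id a b x y (z1 + z2).
Proof.
move=> J1 J2; rewrite /jacobi_id !(sp_addr SP) J1 J2.
by case: (a && b); rewrite /sg; ncring.
Qed.

Lemma jacobi_swapl a b x y z : par a x -> par b y -> 
  jacobi_id a b x y z -> jacobi_id b a y x z.
Proof.
move=> px py; rewrite /jacobi_id => ->; rewrite (sp_anti SP py px).
by case: a {px}; case: b {py}; rewrite /sg /= ?sp_oppl ?sp_oppr; ncring.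
Qed.

Lemma jacobi_swapr a b c x y z : par a x -> par b y -> par c z ->
  jacobi_id a b x y z -> jacobi_id a c x z y.
Proof.
move=> px py pz; rewrite /jacobi_id => J.
have pxy := sp_parB SP px py; have pxz := sp_parB SP px pz.
rewrite (sp_anti SP pz py) (sp_anti SP pxz py).
rewrite (sp_anti SP pz pxy).
by case: a px pxy pxz J => px pxy pxz; case: b py pxy => py pxy; case: c pz pxz => pz pxz;
  rewrite /sg /= ?sp_oppr ?sp_oppl ?opprK => ->; ncring.
Qed.

End SuperPoissonTheory.

Lemma mcoeff_map0 (A B : nzRingType) n (f : A -> B) (p : mpoly n A) w : f 0 = 0 ->
  mcoeff w (map_mpoly f p) = f (mcoeff w p).
Proof.
move=> f0; rewrite /map_mpoly /mmap raddf_sum /=.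
have E v : mcoeff w (mpolyC n (f (mcoeff v p)) * mmap1 (fun i => mpolyX B (mnm1 i)) v)
  = f (mcoeff v p) * (v == w)%:R.
  by rewrite mmap1_id mcoeffCM mcoeffX.
rewrite (eq_bigr _ (fun v _ => E v)).
have [wp|wNp] := boolP (w \in msupp p).
  rewrite (bigD1_seq w) ?msupp_uniq //= eqxx mulr1 big1 ?addr0 // => v /negPf->.
  by rewrite mulr0.
rewrite big_seq big1 => [|v vp]; first by rewrite (memN_msupp_eq0 wNp) f0.
by case: eqP => [E'|]; rewrite ?mulr0 //; rewrite -E' vp in wNp.
Qed.

(** * Superfunctions over a commutative ring: bidegree and parity *)
Section SuperFunctions.
Variables (C : comNzRingType) (n d : nat).
Local Notation ext := (exterior C (d + d)).
Local Notation SF := (mpoly n ext).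
Implicit Types (F G H : SF) (a : 'I_d) (c : 'I_(d + d)) (S T : {set 'I_(d + d)}) (w : multinom n).

Definition gf (f : C) : SF := mpolyC n (escal (d + d) f).
Definition go c : SF := mpolyC n (egen C c).
Definition gx (k : 'I_n) : SF := mpolyX _ (mnm1 k).

Lemma gfB f g : gf (f - g) = gf f - gf g.
Proof. by rewrite /gf rmorphB mpolyCB. Qed.
Lemma gfD f g : gf (f + g) = gf f + gf g.
Proof. by rewrite /gf rmorphD mpolyCD. Qed.
Lemma gfM f g : gf (f * g) = gf f * gf g.
Proof. by rewrite /gf rmorphM mpolyCM. Qed.
Lemma gf1 : gf 1 = 1.
Proof. by rewrite /gf rmorph1; exact: mpolyC1. Qed.
Lemma gf0 : gf 0 = 0.
Proof. by rewrite /gf rmorph0 mpolyC0. Qed.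
Lemma gfN f : gf (- f) = - gf f.
Proof. by rewrite -[- f]add0r gfB gf0 add0r. Qed.

Lemma go_anti b c : go b * go c = - (go c * go b).
Proof. by rewrite /go -!mpolyCM egen_anti mpolyCN. Qed.

Lemma go_sq c : go c * go c = 0.
Proof. by rewrite /go -mpolyCM egen_sq mpolyC0. Qed.

Lemma gx_comm k F : F * gx k = gx k * F.
Proof. exact: commr_mpolyX. Qed.

Lemma sf_expand F :
  F = \sum_(w <- msupp F) \sum_S gf (mcoeff w F S) * mpolyC n (eprod (@egen C (d + d)) S) * mpolyX _ w.
Proof.
rewrite [LHS]mpolyE; apply: eq_bigr => w _.
rewrite -mul_mpolyC [X in mpolyC n X]ext_expand raddf_sum /= mulr_suml.
by apply: eq_bigr => S _; rewrite mpolyCM.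
Qed.

Lemma gf_comm f F : gf f * F = F * gf f.
Proof.
rewrite [F]mpolyE mulr_sumr mulr_suml; apply: eq_bigr => w _.
rewrite -mul_mpolyC mulrA -[RHS]mulrA -commr_mpolyX mulrA -!mpolyCM.
by congr (mpolyC n _ * _); exact: escal_comm.
Qed.

Definition tdeg w S : nat := (mdeg w + #|[pred a : 'I_d | rshift d a \in S]|)%N.
Definition xdeg w S : nat := (mdeg w + #|[pred a : 'I_d | lshift d a \in S]|)%N.

Lemma card_shiftU1 (h : 'I_d -> 'I_(d + d)) a S : injective h -> h a \notin S ->
  #|[pred b | h b \in h a |: S]| = #|[pred b | h b \in S]|.+1.
Proof.
move=> hI aS; rewrite (cardD1 a) !inE eqxx add1n; congr (_.+1).
apply: eq_card => b; rewrite !inE (inj_eq hI).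
by case: eqP => [->|]; rewrite //= (negPf aS).
Qed.

Lemma card_shift_other (h h' : 'I_d -> 'I_(d + d)) a S : (forall b, h b != h' a) ->
  #|[pred b | h b \in h' a |: S]| = #|[pred b | h b \in S]|.
Proof. by move=> hh; apply: eq_card => b; rewrite !inE (negPf (hh b)). Qed.

(** A monomial is a product of generators, along which the bidegree is additive. *)
Lemma mono_ind (P : nat -> nat -> SF -> Prop) :
  (forall k l k' l' F G, P k l F -> P k' l' G -> P (k + k')%N (l + l')%N (F * G)) ->
  (forall f, P 0%N 0%N (gf f)) ->
  (forall a, P 0%N 1%N (go (lshift d a))) -> (forall a, P 1%N 0%N (go (rshift d a))) ->
  (forall k, P 1%N 1%N (gx k)) ->
  forall f w S, P (tdeg w S) (xdeg w S)
    (gf f * mpolyC n (eprod (@egen C (d + d)) S) * mpolyX _ w).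
Proof.
move=> PM Pf Px Pt PX f w S.
have P1 : P 0%N 0%N 1 by rewrite -gf1.
have PS : P #|[pred a | rshift d a \in S]| #|[pred a | lshift d a \in S]|
    (mpolyC n (eprod (@egen C (d + d)) S)).
  elim/set_min_ind: S => [|b U bU IH].
    have c0 (h : 'I_d -> 'I_(d + d)) : #|[pred a | h a \in set0]| = 0%N.
      by apply: eq_card0 => a; rewrite !inE.
    by rewrite !c0 eprod0 [mpolyC _ _]mpolyC1.
  have bNU : b \notin U by apply/negP => /bU; rewrite ltnn.
  rewrite eprodU1_min // mpolyCM.
  case: (split_ordP b) bNU => a -> aNU.
    rewrite card_shiftU1 //; last exact: lshift_inj.
    rewrite card_shift_other; last by move=> c; rewrite eq_rlshift.
    exact: (PM 0%N 1%N _ _ _ _ (Px a) IH).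
  rewrite card_shiftU1 //; last exact: rshift_inj.
  rewrite card_shift_other; last by move=> c; rewrite eq_lrshift.
  exact: (PM 1%N 0%N _ _ _ _ (Pt a) IH).
have Pexp k i : P k k (gx i ^+ k).
  by elim: k => [|k IH]; rewrite ?expr0 // exprS; exact: (PM 1%N 1%N _ _ _ _ (PX i) IH).
have PW : P (mdeg w) (mdeg w) (mpolyX _ w).
  rewrite mdegE mpolyXE_id; apply: (big_rec2 (fun s p => P s s p)) => // i x y _ Py; by apply: PM => //; exact: Pexp.
rewrite /tdeg /xdeg addnC [X in P _ X]addnC.
exact: (PM _ _ _ _ _ _ (PM 0%N 0%N _ _ _ _ (Pf f) PS) PW).
Qed.

Definition bihom (k l : nat) F := forall w S, mcoeff w F S != 0 ->
  tdeg w S = k /\ xdeg w S = l.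

Lemma bihom_ind (P : nat -> nat -> SF -> Prop) :
  (forall k l, P k l 0) ->
  (forall k l F G, P k l F -> P k l G -> P k l (F + G)) ->
  (forall k l k' l' F G, P k l F -> P k' l' G -> P (k + k')%N (l + l')%N (F * G)) ->
  (forall f, P 0%N 0%N (gf f)) ->
  (forall a, P 0%N 1%N (go (lshift d a))) -> (forall a, P 1%N 0%N (go (rshift d a))) ->
  (forall k, P 1%N 1%N (gx k)) ->
  forall k l F, bihom k l F -> P k l F.
Proof.
move=> P0 PD PM Pf Px Pt PX k l F FH; rewrite [F]sf_expand.
elim/big_rec: _ => // w G _ PG; apply: (PD) => //.
elim/big_rec: _ => // S {}G _ {}PG; apply: (PD) => //.
have [->|nz] := eqVneq (mcoeff w F S) 0; first by rewrite gf0 !mul0r.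
have [<- <-] := FH _ _ nz; exact: mono_ind.
Qed.

(** A monomial has the parity of its number of odd generators, because the momenta
    are even. *)
Definition spar (b : bool) F := forall w S, mcoeff w F S != 0 -> odd #|S| = b.

Lemma card_split S : (#|[pred a : 'I_d | rshift d a \in S]| +
   #|[pred a : 'I_d | lshift d a \in S]|)%N = #|S|.
Proof.
rewrite -(card_imset _ (@rshift_inj d d)) -(card_imset _ (@lshift_inj d d)) -cardUI.
rewrite [X in (_ + X)%N](_ : _ = 0%N) ?addn0.
  apply: eq_card => b; rewrite !inE; case: (split_ordP b) => a ->.
    rewrite orbC mem_imset /= ?inE; last exact: lshift_inj.
    by apply/orb_idr => /imsetP[c _ /eqP]; rewrite eq_lrshift.
  rewrite mem_imset /= ?inE; last exact: rshift_inj.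
  by apply/orb_idr => /imsetP[c _ /eqP]; rewrite eq_rlshift.
apply: eq_card0 => b; rewrite !inE; apply/negP => /andP[/imsetP[a _ ->]].
by move=> /imsetP[c _ /eqP]; rewrite eq_rlshift.
Qed.

Lemma odd_deg w S : odd (tdeg w S + xdeg w S) = odd #|S|.
Proof. by rewrite /tdeg /xdeg addnACA addnn oddD odd_double card_split. Qed.

Lemma bihom_spar k l F : bihom k l F -> spar (odd (k + l)) F.
Proof. by move=> FH w S /FH[<- <-]; rewrite odd_deg. Qed.

Lemma spar_ind (P : bool -> SF -> Prop) :
  (forall b, P b 0) ->
  (forall b F G, P b F -> P b G -> P b (F + G)) ->
  (forall b b' F G, P b F -> P b' G -> P (b (+) b') (F * G)) ->
  (forall f, P false (gf f)) -> (forall c, P true (go c)) -> (forall k, P false (gx k)) ->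
  forall b F, spar b F -> P b F.
Proof.
move=> P0 PD PM Pf Po PX b F FH; rewrite [F]sf_expand.
elim/big_rec: _ => // w G _ PG; apply: (PD) => //.
elim/big_rec: _ => // S {}G _ {}PG; apply: (PD) => //.
have [->|nz] := eqVneq (mcoeff w F S) 0; first by rewrite gf0 !mul0r.
rewrite -(FH _ _ nz) -(odd_deg w).
apply: (mono_ind (P := fun k l => P (odd (k + l)))) => // k l k' l' G1 G2 PG1 PG2.
by rewrite addnACA oddD; exact: PM.
Qed.

Lemma spar0 b : spar b 0.
Proof. by move=> w S; rewrite mcoeff0 ffunE eqxx. Qed.

Lemma sparD b F G : spar b F -> spar b G -> spar b (F + G).
Proof.
move=> pF pG w S; rewrite mcoeffD ffunE.
have [F0|nF _] := eqVneq (mcoeff w F S) 0; last exact: pF nF.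
by rewrite F0 add0r => /pG.
Qed.

Lemma sparN b F : spar b F -> spar b (- F).
Proof. by move=> pF w S; rewrite mcoeffN ffunE oppr_eq0 => /pF. Qed.

Lemma spar_sum b (I : Type) (r : seq I) (P : pred I) (X : I -> SF) :
  (forall i, spar b (X i)) -> spar b (\sum_(i <- r | P i) X i).
Proof. by move=> pX; elim/big_rec: _ => [|i F _ pF]; [exact: spar0|exact: sparD]. Qed.

Lemma coefM F G w S : mcoeff w (F * G) S =
  \sum_(k : bmultinom n (mdeg w).+1 * bmultinom n (mdeg w).+1 | w == (mnm_add k.1 k.2))
    \sum_(T : {set 'I_(d + d)} | T \subset S)
      (-1) ^+ einv T (S :\: T) * mcoeff k.1 F T * mcoeff k.2 G (S :\: T).
Proof. by rewrite mcoeffM sum_ffunE; apply: eq_bigr => k _; rewrite ffunE. Qed.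

Lemma coefM_neq0 F G w S : mcoeff w (F * G) S != 0 ->
  exists w1 w2 T, [/\ w = mnm_add w1 w2, T \subset S,
    mcoeff w1 F T != 0 & mcoeff w2 G (S :\: T) != 0].
Proof.
rewrite coefM => nz.
have [/existsP[k /existsP[T /and4P[/eqP wk TS n1 n2]]]|/existsPn no] :=
  boolP [exists k : bmultinom n (mdeg w).+1 * bmultinom n (mdeg w).+1,
   exists T : {set 'I_(d + d)}, [&& w == mnm_add k.1 k.2, T \subset S,
     mcoeff k.1 F T != 0 & mcoeff k.2 G (S :\: T) != 0]].
  by exists k.1, k.2, T.
case/eqP: nz; apply: big1 => k wk; apply: big1 => T TS.
have /existsPn/(_ T) := no k; rewrite wk TS /= negb_and !negbK.
by case/orP => /eqP->; rewrite ?mulr0 ?mul0r.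
Qed.

Lemma sparM b b' F G : spar b F -> spar b' G -> spar (b (+) b') (F * G).
Proof.
move=> pF pG w S /coefM_neq0[w1 [w2 [T [_ TS /pF <- /pG <-]]]].
by rewrite -oddD -(cardsID T S) (setIidPr TS).
Qed.

Lemma spar_gf f : spar false (gf f).
Proof.
move=> w S; rewrite mcoeffC; case: (w == _); last by rewrite mulr0n mulr0 ffunE eqxx.
rewrite mulr1n mulr1 ffunE; case: (S =P _) => [->|_]; last by rewrite eqxx.
by rewrite cards0.
Qed.

Lemma spar_go c : spar true (go c).
Proof.
move=> w S; rewrite mcoeffC; case: (w == _); last by rewrite mulr0n mulr0 ffunE eqxx.
rewrite mulr1n mulr1 ffunE; case: (S =P _) => [->|_]; last by rewrite eqxx.
by rewrite cards1.
Qed.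

Lemma spar_gx k : spar false (gx k).
Proof.
move=> w S; rewrite mcoeffX; case: (_ == w); last by rewrite mulr0n ffunE eqxx.
rewrite -(rmorph1 (@escal C (d + d))) ffunE.
case: (S =P _) => [->|_]; last by rewrite eqxx.
by rewrite cards0.
Qed.

Lemma super_comm b b' F G : spar b F -> spar b' G -> F * G = sg (b && b') (G * F).
Proof.
move=> pF pG; move: b F pF b' G pG; apply: (spar_ind (P := fun b F => forall b' G, spar b' G ->
  F * G = sg (b && b') (G * F))).
- by move=> b b' G _; rewrite mul0r mulr0 /sg oppr0; case: ifP.
- by move=> b F G HF HG b' H pH; rewrite mulrDl mulrDr (HF _ _ pH) (HG _ _ pH) /sg; case: ifP; rewrite ?opprD.
- move=> b b' F G HF HG b'' H pH; rewrite -mulrA (HG _ _ pH).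
  move: (HF _ _ pH); case: b {HF}; case: b' {HG}; case: b'' pH => pH; rewrite /sg /= => E;
    rewrite ?mulrN (mulrA F) E; ncring.
- by move=> f b' G _; rewrite gf_comm.
- move=> c; apply: (spar_ind (P := fun b' G => go c * G = sg b' (G * go c))).
  + by move=> b; rewrite mul0r mulr0 /sg oppr0; case: ifP.
  + by move=> b F G HF HG; rewrite mulrDl mulrDr HF HG /sg; case: ifP; rewrite ?opprD.
  + move=> b b' F G HF HG; rewrite mulrA HF.
    by case: b {HF}; case: b' HG; rewrite /sg /= ?mulNr => E; rewrite -!mulrA E ?mulrN ?opprK.
  + by move=> f; rewrite gf_comm.
  + by move=> c'; rewrite go_anti.
  by move=> k; rewrite gx_comm.
by move=> k b' G _; rewrite gx_comm.
Qed.

End SuperFunctions.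

Lemma sg_sum (V : zmodType) b (I : Type) (r : seq I) (P : pred I) (F : I -> V) :
  \sum_(i <- r | P i) sg b (F i) = sg b (\sum_(i <- r | P i) F i).
Proof. by case: b; rewrite /sg ?sumrN. Qed.

(** * The big bracket over a ring with commuting derivations *)
Section Derivatives.
Variables (C : comNzRingType) (n d : nat).
Local Notation ext := (exterior C (d + d)).
Local Notation SF := (mpoly n ext).
Implicit Types (F G H : SF) (a : 'I_d) (c : 'I_(d + d)) (S T : {set 'I_(d + d)}) (w : multinom n).

(** The coefficientwise extension is locked: its unfolding to sums over the
    supports of polynomials makes conversion tests between superfunctions
    intractable. *)
Fact lift_key : unit. Proof. exact: tt. Qed.
Definition slift : (ext -> ext) -> SF -> SF := locked_with lift_key (@map_mpoly n ext ext).
Lemma sliftE f F : slift f F = map_mpoly f F.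
Proof. by rewrite /slift unlock. Qed.
Definition sdl c F : SF := slift (ederl c) F.
Definition sdr c F : SF := slift (ederr c) F.
Definition sdx (D : C -> C) F : SF := slift (emap D) F.

Lemma ederl0 c : ederl c (0 : ext) = 0.
Proof. by have := ederl_scal c (0 : C); rewrite rmorph0. Qed.

Lemma ederr0 c : ederr c (0 : ext) = 0.
Proof. by apply/ffunP => S; rewrite ederrE ederl0 ffunE mulr0. Qed.

Lemma mcoeff_sdl w c F : mcoeff w (sdl c F) = ederl c (mcoeff w F).
Proof. by rewrite /sdl sliftE mcoeff_map0 ?ederl0. Qed.

Lemma mcoeff_sdr w c F : mcoeff w (sdr c F) = ederr c (mcoeff w F).
Proof. by rewrite /sdr sliftE mcoeff_map0 ?ederr0. Qed.

Lemma mcoeff_sdx (D : C -> C) w F S : D 0 = 0 -> mcoeff w (sdx D F) S = D (mcoeff w F S).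
Proof.
move=> D0; rewrite /sdx sliftE mcoeff_map0 ?ffunE //.
by apply/ffunP => T; rewrite !ffunE D0.
Qed.

Lemma sdlD c F G : sdl c (F + G) = sdl c F + sdl c G.
Proof. by apply/mpolyP => w; rewrite mcoeff_sdl [RHS]mcoeffD mcoeffD 2!mcoeff_sdl ederlD. Qed.

Lemma sdl0 c : sdl c 0 = 0.
Proof. by apply/mpolyP => w; rewrite mcoeff_sdl mcoeff0 ederl0. Qed.

Lemma sdrD c F G : sdr c (F + G) = sdr c F + sdr c G.
Proof. by apply/mpolyP => w; rewrite mcoeff_sdr [RHS]mcoeffD mcoeffD 2!mcoeff_sdr ederrD. Qed.

Lemma sdl_gf c f : sdl c (gf n d f) = 0.
Proof.
apply/mpolyP => w; rewrite mcoeff_sdl mcoeff0 mcoeffC.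
by case: (_ == _); rewrite ?mulr1 ?mulr0 ?ederl_scal ?ederl0.
Qed.

Lemma sdl_gfM c f G : sdl c (gf n d f * G) = gf n d f * sdl c G.
Proof. by apply/mpolyP => w; rewrite mcoeff_sdl !mcoeffCM ederl_escal mcoeff_sdl. Qed.

Lemma sdl_goM c b G : sdl c (@go C n d b * G) = (if c == b then G else 0) - @go C n d b * sdl c G.
Proof.
apply/mpolyP => w; rewrite mcoeff_sdl mcoeffCM ederl_egen_mul mcoeffB mcoeffCM mcoeff_sdl.
by case: ifP; rewrite ?mcoeff0.
Qed.

Lemma sdl_go c b : sdl c (@go C n d b) = if c == b then 1 else 0 :> SF.
Proof. by rewrite -[@go C n d b]mulr1 sdl_goM -(gf1 C n d) sdl_gf mulr0 subr0. Qed.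

Lemma mulX_map (f : ext -> ext) F k : (forall u v, f (u + v) = f u + f v) ->
  slift f (F * gx C d k) = slift f F * gx C d k.
Proof.
rewrite !sliftE; move=> fD; have f0 : f 0 = 0 by apply: (addrI (f 0)); rewrite -fD !addr0.
apply/mpolyP => w; rewrite mcoeff_map0 // !mcoeffM.
have fs (I : Type) (r : seq I) (P : pred I) (X : I -> ext) :
    f (\sum_(i <- r | P i) X i) = \sum_(i <- r | P i) f (X i).
  by elim/big_rec2: _ => // i x y _ <-.
rewrite fs; apply: eq_bigr => v _; rewrite mcoeff_map0 // mcoeffX.
by case: (_ == _); rewrite ?mulr1 ?mulr0.
Qed.

Lemma sdl_gxM c k G : sdl c (gx C d k * G) = gx C d k * sdl c G.
Proof. rewrite -!gx_comm [LHS](@mulX_map (ederl c)) // => u v; exact: ederlD. Qed.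

Lemma sdl_gx c k : sdl c (gx C d k) = 0.
Proof. by rewrite -[gx C d k]mulr1 sdl_gxM -(gf1 C n d) sdl_gf mulr0. Qed.

Lemma sdl_leib b c F G : spar b F -> sdl c (F * G) = sdl c F * G + sg b (F * sdl c G).
Proof.
move=> pF; move: b F pF G; apply: (spar_ind (P := fun b F => forall G,
  sdl c (F * G) = sdl c F * G + sg b (F * sdl c G))).
- by move=> b G; rewrite !mul0r sdl0 mul0r add0r /sg oppr0; case: ifP.
- move=> b F G HF HG H; rewrite mulrDl !sdlD HF HG.
  by case: b {HF HG}; rewrite /sg; ncring.
- move=> b b' F G HF HG H; rewrite -mulrA !HF HG.
  by case: b {HF}; case: b' {HG}; rewrite /sg /=; ncring.
- by move=> f G; rewrite sdl_gfM sdl_gf mul0r add0r.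
- move=> b G; rewrite sdl_goM sdl_go.
  by case: ifP => _; rewrite /sg /= ?mul1r ?mul0r.
by move=> k G; rewrite sdl_gxM sdl_gx mul0r add0r.
Qed.

Lemma spar_sdl b c F : spar b F -> spar (~~ b) (sdl c F).
Proof.
move=> pF w S; rewrite mcoeff_sdl ffunE; case: ifP => cS; first by rewrite eqxx.
have [u0|nz _] := eqVneq (mcoeff w F (c |: S)) 0; first by rewrite u0 mulr0 eqxx.
by rewrite -(pF _ _ nz) cardsU1 cS /= negbK.
Qed.

(** On an element of given parity the right derivative is the left one up to a
    global sign, so that only left derivatives need a theory. *)
Lemma sdrE b c F : spar b F -> sdr c F = sg (~~ b) (sdl c F).
Proof.
move=> pF; apply/mpolyP => w; apply/ffunP => S.
rewrite mcoeff_sdr ederrE -mcoeff_sdl /sg.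
have [u0|nz] := eqVneq (mcoeff w (sdl c F) S) 0.
  by rewrite u0 mulr0; case: ifP; rewrite ?mcoeffN ?ffunE u0 ?oppr0.
rewrite -signr_odd (spar_sdl pF nz); case: (~~ b); rewrite ?expr0 ?mul1r //.
by rewrite expr1 mulN1r mcoeffN ffunE.
Qed.

Lemma mul_map_leib (f : ext -> ext) F G : (forall u v, f (u + v) = f u + f v) ->
  (forall u v, f (u * v) = f u * v + u * f v) ->
  slift f (F * G) = slift f F * G + F * slift f G.
Proof.
rewrite !sliftE; move=> fD fM; have f0 : f 0 = 0 by apply: (addrI (f 0)); rewrite -fD !addr0.
apply/mpolyP => w; rewrite mcoeff_map0 // mcoeffD !mcoeffM.
have fs (I : Type) (r : seq I) (P : pred I) (X : I -> ext) :
    f (\sum_(i <- r | P i) X i) = \sum_(i <- r | P i) f (X i).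
  by elim/big_rec2: _ => // i x y _ <-.
rewrite fs -big_split; apply: eq_bigr => v _.
by rewrite /= !mcoeff_map0.
Qed.

Section Dx.
Variable D : C -> C.
Hypothesis DD : forall f g, D (f + g) = D f + D g.
Hypothesis DM : forall f g, D (f * g) = D f * g + f * D g.

Lemma der0 : D 0 = 0.
Proof. by apply: (addrI (D 0)); rewrite -DD !addr0. Qed.
Lemma derN f : D (- f) = - D f.
Proof. by apply: (addrI (D f)); rewrite -DD !subrr der0. Qed.
Lemma der1 : D 1 = 0.
Proof. by apply: (addrI (D 1)); rewrite -{3}[1](mulr1 1) DM mulr1 mul1r addr0. Qed.

Lemma emapD (u v : ext) : emap D (u + v) = emap D u + emap D v :> ext.
Proof. by apply/ffunP => S; rewrite !ffunE DD. Qed.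

Lemma der_sign k f : D ((-1) ^+ k * f) = (-1) ^+ k * D f.
Proof. by rewrite -signr_odd; case: odd; rewrite ?mul1r // !mulN1r derN. Qed.

Lemma emapM (u v : ext) : emap D (u * v) = emap D u * v + u * emap D v :> ext.
Proof.
apply/ffunP => S; rewrite !ffunE.
have Ds (I : Type) (r : seq I) (P : pred I) (X : I -> C) :
    D (\sum_(i <- r | P i) X i) = \sum_(i <- r | P i) D (X i).
  by elim/big_rec2: _ => [|i x y _ <-]; [exact: der0|exact: DD].
rewrite Ds -big_split; apply: eq_bigr => T _ /=.
by rewrite -mulrA der_sign DM !ffunE; ring.
Qed.

Lemma sdxD F G : sdx D (F + G) = sdx D F + sdx D G.
Proof.
apply/mpolyP => w; apply/ffunP => S.
by rewrite mcoeffD ffunE !(mcoeff_sdx _ _ _ der0) mcoeffD ffunE DD.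
Qed.

Lemma sdx_leib F G : sdx D (F * G) = sdx D F * G + F * sdx D G.
Proof. by apply: mul_map_leib; [exact: emapD|exact: emapM]. Qed.

Lemma sdx_gf f : sdx D (gf n d f) = gf n d (D f).
Proof.
apply/mpolyP => w; apply/ffunP => S; rewrite mcoeff_sdx ?der0 // !mcoeffC.
by case: (_ == _); rewrite ?mulr1 ?mulr0 !ffunE ?der0 //; case: ifP; rewrite ?der0.
Qed.

Lemma sdx_go c : sdx D (go C n c) = 0.
Proof.
apply/mpolyP => w; apply/ffunP => S; rewrite mcoeff_sdx ?der0 // mcoeffC mcoeff0 [RHS]ffunE.
case: (_ == _); rewrite ?mulr1 ?mulr0 !ffunE ?der0 //.
by case: eqP; rewrite ?der0 ?der1.
Qed.

Lemma sdx_gx k : sdx D (gx C d k) = 0.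
Proof.
rewrite -[gx C d k]mul1r [sdx _ _](mulX_map _ _ emapD) -/(sdx D 1).
by rewrite -(gf1 C n d) sdx_gf der1 gf0 mul0r.
Qed.

Lemma spar_sdx b F : spar b F -> spar b (sdx D F).
Proof.
move=> pF w S; rewrite mcoeff_sdx ?der0 //.
by have [->|/pF//] := eqVneq (mcoeff w F S) 0; rewrite der0 eqxx.
Qed.
End Dx.

Lemma spar_dp b k F : spar b F -> spar b (mderiv k F).
Proof.
move=> pF w S; rewrite mcoeff_deriv ffunMnE.
have [->|nz _] := eqVneq (mcoeff (mnm_add w (mnm1 k)) F S) 0; [by rewrite mul0rn eqxx|exact: pF nz].
Qed.

Lemma dp_gf k (f : C) : mderiv k (gf n d f) = 0.
Proof. exact: mderivC. Qed.

Lemma dp_go k c : mderiv k (go C n c : SF) = 0.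
Proof. exact: mderivC. Qed.

Lemma dp_gx k k' : mderiv k (gx C d k') = if k == k' then 1 else 0 :> SF.
Proof.
rewrite /gx mderivX mnm1E eq_sym; case: eqP => [->|_]; last by rewrite scale0r.
have -> : mnm_sub (mnm1 k') (mnm1 k') = mnm0 by apply/mnmP => i; rewrite mnmBE subnn mnm0E.
by rewrite scale1r mpolyX0.
Qed.

Variable D : 'I_n -> C -> C.

(** The formula of the canonical bracket in Darboux coordinates, the partial
    derivatives of the coefficients being replaced by abstract derivations. *)
Definition gbr : SF -> SF -> SF := locked_with lift_key (fun F G =>
  \sum_(k < n) (mderiv k F * sdx (D k) G - sdx (D k) F * mderiv k G) +
  \sum_(a < d) (sdr (rshift d a) F * sdl (lshift d a) G +
                sdr (lshift d a) F * sdl (rshift d a) G)).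

Lemma gbrE F G : gbr F G =
  \sum_(k < n) (mderiv k F * sdx (D k) G - sdx (D k) F * mderiv k G) +
  \sum_(a < d) (sdr (rshift d a) F * sdl (lshift d a) G +
                sdr (lshift d a) F * sdl (rshift d a) G).
Proof. by rewrite /gbr unlock. Qed.

Hypothesis DD : forall k f g, D k (f + g) = D k f + D k g.
Hypothesis DM : forall k f g, D k (f * g) = D k f * g + f * D k g.
Hypothesis DC : forall k l f, D k (D l f) = D l (D k f).

Lemma gbr_addr F G H : gbr F (G + H) = gbr F G + gbr F H.
Proof.
rewrite !gbrE addrACA -!big_split; congr (_ + _); apply: eq_bigr => k _ /=.
  by rewrite sdxD // mderivD; ncring.
by rewrite !sdlD; ncring.
Qed.

Lemma gbr_addl F G H : gbr (F + G) H = gbr F H + gbr G H.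
Proof.
rewrite !gbrE addrACA -!big_split; congr (_ + _); apply: eq_bigr => k _ /=.
  by rewrite sdxD // mderivD; ncring.
by rewrite !sdrD; ncring.
Qed.

Lemma gbr_leib b b' F G H : spar b F -> spar b' G ->
  gbr F (G * H) = gbr F G * H + sg (b && b') (G * gbr F H).
Proof.
move=> pF pG; rewrite !gbrE !mulrDl !mulrDr !mulr_suml !mulr_sumr.
have -> (x y : SF) : sg (b && b') (x + y) = sg (b && b') x + sg (b && b') y.
  by case: (b && b'); rewrite /sg ?opprD.
rewrite -!sg_sum addrACA -!big_split; congr (_ + _); apply: eq_bigr => k _ /=.
  rewrite sdx_leib // mderivM !mulrDr.
  rewrite !mulrA (super_comm (spar_dp (k := k) pF) pG) (super_comm (spar_sdx (DD k) pF) pG).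
  by case: (b && b'); rewrite /sg; ncring.
rewrite !(sdl_leib _ _ pG) !(sdrE _ pF) !mulrDr.
have c1 c := super_comm (spar_sdl (c := c) pF) pG.
move: (c1 (rshift d k)) (c1 (lshift d k)).
case: b {pF c1}; case: b' {pG}; rewrite /sg /= => e1 e2; rewrite ?mulNr ?mulrN !mulrA e1 e2; ncring.
Qed.

Lemma gbr_anti b b' F G : spar b F -> spar b' G ->
  gbr F G = - sg (b && b') (gbr G F).
Proof.
move=> pF pG; rewrite !gbrE.
have -> (x y : SF) : - sg (b && b') (x + y) = sg (~~ (b && b')) x + sg (~~ (b && b')) y.
  by case: (b && b'); rewrite /sg /= ?opprD ?opprK.
rewrite -!sg_sum; congr (_ + _); apply: eq_bigr => k _.
  rewrite (super_comm (spar_dp (k := k) pF) (spar_sdx (DD k) pG)).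
  rewrite (super_comm (spar_sdx (DD k) pF) (spar_dp (k := k) pG)).
  by case: (b && b'); rewrite /sg /=; ncring.
rewrite !(sdrE _ pF) !(sdrE _ pG).
have c1 c c' := super_comm (spar_sdl (c := c) pF) (spar_sdl (c := c') pG).
move: (c1 (rshift d k) (lshift d k)) (c1 (lshift d k) (rshift d k)).
case: b {pF c1}; case: b' {pG}; rewrite /sg /= => e1 e2; rewrite ?mulNr ?mulrN e1 e2; ncring.
Qed.

Lemma spar_gbr b b' F G : spar b F -> spar b' G -> spar (b (+) b') (gbr F G).
Proof.
move=> pF pG; rewrite gbrE; apply: sparD; apply: spar_sum => k.
  apply: sparD; first by apply: sparM; [exact: spar_dp|exact: spar_sdx].
  by apply: sparN; apply: sparM; [exact: spar_sdx|exact: spar_dp].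
have pr c : spar (~~ b) (sdr c F).
  by rewrite (sdrE _ pF) /sg; move: (spar_sdl (c := c) pF); case: (~~ b) => //; exact: sparN.
have -> : b (+) b' = ~~ b (+) ~~ b' by case: b {pF pr}; case: b' {pG}.
by apply: sparD; apply: sparM => //; exact: spar_sdl.
Qed.

Lemma gbr_super_poisson : super_poisson (@spar C n d) gbr.
Proof.
split.
- by move=> *; exact: sparD.
- by move=> *; exact: sparN.
- by move=> *; exact: sparM.
- by move=> *; exact: spar_gbr.
- by move=> *; exact: super_comm.
- exact: gbr_addr.
- exact: gbr_addl.
- by move=> *; exact: gbr_anti.
by move=> *; exact: gbr_leib.
Qed.

(** The generators of the algebra of superfunctions. A bracket is determined by its
    table [gtab] on them, whose entries are coefficients. *)
Inductive gen := Gf of C | Go of 'I_(d + d) | Gx of 'I_n.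
Definition gval g : SF := match g with Gf f => gf n d f | Go c => go C n c | Gx k => gx C d k end.
Definition gpar g := if g is Go _ then true else false.
Definition conj_ix c : 'I_(d + d) :=
  match fintype.split c with inl a => rshift d a | inr a => lshift d a end.
Definition gtab g1 g2 : C :=
  match g1, g2 with
  | Gx k, Gf f => D k f
  | Gf f, Gx k => - D k f
  | Go c, Go c' => (c' == conj_ix c)%:R
  | _, _ => 0
  end.

Lemma spar_gval g : spar (gpar g) (gval g).
Proof. by case: g => *; [exact: spar_gf|exact: spar_go|exact: spar_gx]. Qed.

Lemma gbr_gf f G : gbr (gf n d f) G = - \sum_k gf n d (D k f) * mderiv k G.
Proof.
rewrite !gbrE [X in _ + X]big1 ?addr0 => [|a _]; last first.
  by rewrite !(sdrE _ (@spar_gf C n d f)) !sdl_gf /sg /= oppr0 !mul0r addr0.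
rewrite -sumrN; apply: eq_bigr => k _.
by rewrite dp_gf mul0r add0r (sdx_gf (DD k)).
Qed.

Lemma gbr_gx k G : gbr (gx C d k) G = sdx (D k) G.
Proof.
rewrite !gbrE [X in _ + X]big1 ?addr0 => [|a _]; last first.
  by rewrite !(sdrE _ (@spar_gx C n d k)) !sdl_gx /sg /= oppr0 !mul0r addr0.
rewrite (bigD1 k) //= big1 ?addr0 => [|l lk].
  by rewrite dp_gx eqxx mul1r (sdx_gx (DD k) (DM k)) mul0r subr0.
by rewrite dp_gx (negPf lk) mul0r (sdx_gx (DD l) (DM l)) mul0r subr0.
Qed.

Lemma gbr_go c G : gbr (go C n c) G = sdl (conj_ix c) G.
Proof.
rewrite !gbrE big1 ?add0r => [|k _]; last first.
  by rewrite dp_go (sdx_go (DD k) (DM k)) !mul0r subrr.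
rewrite /conj_ix; case: (split_ordP c) => a ->; rewrite ?(unsplitK (inl _ a)) ?(unsplitK (inr _ a)).
  rewrite (bigD1 a) //= big1 ?addr0 => [|b ba];
    rewrite !(sdrE _ (@spar_go C n d _)) !sdl_go /sg /= !eq_rlshift !(inj_eq (@lshift_inj _ _)).
    by rewrite eqxx mul0r mul1r add0r.
  by rewrite (negPf ba) !mul0r addr0.
rewrite (bigD1 a) //= big1 ?addr0 => [|b ba];
  rewrite !(sdrE _ (@spar_go C n d _)) !sdl_go /sg /= !eq_lrshift !(inj_eq (@rshift_inj _ _)).
  by rewrite eqxx mul0r mul1r addr0.
by rewrite (negPf ba) !mul0r addr0.
Qed.

Lemma gbr_gval g1 g2 : gbr (gval g1) (gval g2) = gf n d (gtab g1 g2).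
Proof.
case: g1 => [f|c|k] /=; rewrite ?gbr_gf ?gbr_go ?gbr_gx; case: g2 => [g|c'|k'] /=.
- by rewrite gf0 big1 ?oppr0 // => k _; rewrite dp_gf mulr0.
- by rewrite gf0 big1 ?oppr0 // => k _; rewrite dp_go mulr0.
- rewrite (bigD1 k') //= big1 ?addr0 => [|k kk].
    by rewrite dp_gx eqxx mulr1 gfN.
  by rewrite dp_gx (negPf kk) mulr0.
- by rewrite sdl_gf gf0.
- by rewrite sdl_go eq_sym; case: eqP; rewrite ?gf1 ?gf0.
- by rewrite sdl_gx gf0.
- by rewrite (sdx_gf (DD k)).
- by rewrite (sdx_go (DD k) (DM k)) gf0.
by rewrite (sdx_gx (DD k) (DM k)) gf0.
Qed.

Lemma jacobi_gval g1 g2 g3 :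
  jacobi_id gbr (gpar g1) (gpar g2) (gval g1) (gval g2) (gval g3).
Proof.
have E g h1 h2 : gbr (gval g) (gbr (gval h1) (gval h2)) = gf n d (gtab g (Gf (gtab h1 h2))).
  by rewrite !gbr_gval -(gbr_gval g (Gf _)).
rewrite /jacobi_id !E.
have -> : gbr (gbr (gval g1) (gval g2)) (gval g3) = gf n d (gtab (Gf (gtab g1 g2)) g3).
  by rewrite !gbr_gval -(gbr_gval (Gf _)).
have D0 k := der0 (DD k); have D1 k := der1 (DM k); have DN k := derN (DD k).
have Db k (b : bool) : D k b%:R = 0 by case: b.
case: g1 => [f1|c1|k1]; case: g2 => [f2|c2|k2]; case: g3 => [f3|c3|k3];
  by rewrite /sg /= ?D0 ?Db ?DN ?D0 ?Db ?oppr0 ?opprK ?gf0 ?addr0 ?add0r ?gfN ?oppr0 ?addNr ?subrr ?addrN // DC ?addNr ?subrr.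
Qed.

(** By the Leibniz rule it is enough to have the identity on generators. There, all
    inner brackets are coefficients, so that the only nontrivial case is that of
    two momenta and a function, where it says that the derivations commute. *)
Theorem gbr_jacobi (b1 b2 b3 : bool) F G H : spar b1 F -> spar b2 G -> spar b3 H ->
  jacobi_id gbr b1 b2 F G H.
Proof.
have SP := gbr_super_poisson.
have ext_r (a' b' : bool) (x y : SF) : spar a' x -> spar b' y ->
    (forall g, jacobi_id gbr a' b' x y (gval g)) ->
    forall (c' : bool) z, spar c' z -> jacobi_id gbr a' b' x y z.
  move=> px py Jg c' z pz; suff [] : spar c' z /\ jacobi_id gbr a' b' x y z by [].
  move: c' z pz; apply: spar_ind.
  - move=> b1' ; split; first exact: spar0.
    by rewrite /jacobi_id !(sp_0r SP) /sg; case: ifP; rewrite ?oppr0 ?addr0.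
  - move=> b0 z1 z2 [p1 J1] [p2 J2]; split; first exact: sparD.
    exact: (jacobi_add SP J1 J2).
  - move=> s1 s2 z1 z2 [p1 J1] [p2 J2]; split; first exact: sparM.
    exact: (jacobi_mul SP px py p1 J1 J2).
  - by move=> f; split; [exact: spar_gf|exact: (Jg (Gf f))].
  - by move=> f; split; [exact: spar_go|exact: (Jg (Go f))].
  by move=> f; split; [exact: spar_gx|exact: (Jg (Gx f))].
move=> pF pG pH; apply: (ext_r _ _ _ _ pF pG _ _ _ pH) => g3.
apply: (jacobi_swapr SP pF (@spar_gval g3) pG).
apply: (ext_r _ _ _ _ pF (@spar_gval g3) _ _ _ pG) => g2.
apply: (jacobi_swapl SP (@spar_gval g3) pF).
apply: (jacobi_swapr SP (@spar_gval g3) (@spar_gval g2) pF).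
apply: (ext_r _ _ _ _ (@spar_gval g3) (@spar_gval g2) _ _ _ pF) => g1.
exact: jacobi_gval.
Qed.

End Derivatives.

(** * Bidegree of the bracket and the Euler identity *)
Section Bidegree.
Variables (C : comNzRingType) (n d : nat).
Local Notation ext := (exterior C (d + d)).
Local Notation SF := (mpoly n ext).
Implicit Types (F G H : SF) (a : 'I_d) (c : 'I_(d + d)) (S T : {set 'I_(d + d)}) (w : multinom n) (k l : int).

(** Integer bidegrees make the bidegree (-1, -1) of the bracket meaningful without
    truncation; a negative bidegree forces an element to vanish. *)
Definition zhom k l F := forall w S, mcoeff w F S != 0 ->
  (tdeg w S)%:Z = k /\ (xdeg w S)%:Z = l.

Lemma bihomE (k l : nat) F : bihom k l F <-> zhom k%:Z l%:Z F.
Proof.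
split=> H w S /H; first by case=> -> ->.
by case=> -[->] [->].
Qed.

Lemma zhom0 k l : zhom k l 0.
Proof. by move=> w S; rewrite mcoeff0 ffunE eqxx. Qed.

Lemma zhomD k l F G : zhom k l F -> zhom k l G -> zhom k l (F + G).
Proof.
move=> pF pG w S; rewrite mcoeffD ffunE.
have [F0|nF _] := eqVneq (mcoeff w F S) 0; last exact: pF nF.
by rewrite F0 add0r => /pG.
Qed.

Lemma zhomN k l F : zhom k l F -> zhom k l (- F).
Proof. by move=> pF w S; rewrite mcoeffN ffunE oppr_eq0 => /pF. Qed.

Lemma zhom_sum k l (I : Type) (r : seq I) (P : pred I) (X : I -> SF) :
  (forall i, zhom k l (X i)) -> zhom k l (\sum_(i <- r | P i) X i).
Proof. by move=> pX; elim/big_rec: _ => [|i F _ pF]; [exact: zhom0|exact: zhomD]. Qed.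

Lemma card_pred_split (h : 'I_d -> 'I_(d + d)) S T : T \subset S ->
  #|[pred a | h a \in S]| = (#|[pred a | h a \in T]| + #|[pred a | h a \in S :\: T]|)%N.
Proof.
move=> TS; rewrite -(cardID [pred a | h a \in T] [pred a | h a \in S]); congr addn.
  apply: eq_card => a; rewrite !inE; apply: andb_idl; exact: (subsetP TS).
by apply: eq_card => a; rewrite !inE.
Qed.

Lemma zhomM k l k' l' F G : zhom k l F -> zhom k' l' G -> zhom (k + k') (l + l') (F * G).
Proof.
move=> pF pG w S /coefM_neq0[w1 [w2 [T [-> TS /pF[<- <-] /pG[<- <-]]]]].
rewrite /tdeg /xdeg mdegD (card_pred_split (@rshift d d) TS) (card_pred_split (@lshift d d) TS).
by rewrite !PoszD; split; ring.
Qed.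

Lemma zhom_dp k l i F : zhom k l F -> zhom (k - 1) (l - 1) (mderiv i F).
Proof.
move=> pF w S; rewrite mcoeff_deriv ffunMnE.
have [->|/pF[<- <-] _] := eqVneq (mcoeff (mnm_add w (mnm1 i)) F S) 0; first by rewrite mul0rn eqxx.
by rewrite /tdeg /xdeg mdegD mdeg1 !PoszD; split; ring.
Qed.

Lemma zhom_dx k l (D : C -> C) F : D 0 = 0 -> zhom k l F -> zhom k l (sdx D F).
Proof.
move=> D0 pF w S; rewrite mcoeff_sdx //.
by have [->|/pF//] := eqVneq (mcoeff w F S) 0; rewrite D0 eqxx.
Qed.

Lemma zhom_sdl_xi k l a F : zhom k l F -> zhom k (l - 1) (sdl (lshift d a) F).
Proof.
move=> pF w S; rewrite mcoeff_sdl ffunE; case: ifP => cS; first by rewrite eqxx.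
have [->|/pF[<- <-] _] := eqVneq (mcoeff w F (lshift d a |: S)) 0; first by rewrite mulr0 eqxx.
rewrite /tdeg /xdeg card_shiftU1 ?cS //; last exact: lshift_inj.
rewrite card_shift_other; last by move=> b; rewrite eq_rlshift.
by split; rewrite // addnS -addn1 !PoszD; ring.
Qed.

Lemma zhom_sdl_theta k l a F : zhom k l F -> zhom (k - 1) l (sdl (rshift d a) F).
Proof.
move=> pF w S; rewrite mcoeff_sdl ffunE; case: ifP => cS; first by rewrite eqxx.
have [->|/pF[<- <-] _] := eqVneq (mcoeff w F (rshift d a |: S)) 0; first by rewrite mulr0 eqxx.
rewrite /tdeg /xdeg card_shiftU1 ?cS //; last exact: rshift_inj.
rewrite card_shift_other; last by move=> b; rewrite eq_lrshift.
by split; rewrite // addnS -addn1 !PoszD; ring.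
Qed.

Lemma zhom_sdr k l c F : zhom k l (sdl c F) -> zhom k l (sdr c F).
Proof.
move=> pF w S; rewrite mcoeff_sdr ederrE -mcoeff_sdl.
have [->|/pF//] := eqVneq (mcoeff w (sdl c F) S) 0; first by rewrite mulr0 eqxx.
Qed.

Lemma zhom_gbr (D : 'I_n -> C -> C) k l k' l' F G : (forall i, D i 0 = 0) -> zhom k l F -> zhom k' l' G ->
  zhom (k + k' - 1) (l + l' - 1) (gbr D F G).
Proof.
move=> D0 pF pG; rewrite gbrE; apply: zhomD; apply: zhom_sum => i; apply: zhomD.
- have -> : k + k' - 1 = k - 1 + k' by ring.
  have -> : l + l' - 1 = l - 1 + l' by ring.
  by apply: zhomM; [exact: zhom_dp|exact: zhom_dx].
- have -> : k + k' - 1 = k + (k' - 1) by ring.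
  have -> : l + l' - 1 = l + (l' - 1) by ring.
  by apply: zhomN; apply: zhomM; [exact: zhom_dx|exact: zhom_dp].
- have -> : k + k' - 1 = k - 1 + k' by ring.
  have -> : l + l' - 1 = l + (l' - 1) by ring.
  by apply: zhomM; [apply: zhom_sdr; exact: zhom_sdl_theta|exact: zhom_sdl_xi].
have -> : k + k' - 1 = k + (k' - 1) by ring.
have -> : l + l' - 1 = l - 1 + l' by ring.
by apply: zhomM; [apply: zhom_sdr; exact: zhom_sdl_xi|exact: zhom_sdl_theta].
Qed.

Lemma bihom_gbr (D : 'I_n -> C -> C) (k l k' l' k'' l'' : nat) F G : (forall i, D i 0 = 0) ->
  bihom k l F -> bihom k' l' G -> (k + k' = k''.+1)%N -> (l + l' = l''.+1)%N ->
  bihom k'' l'' (gbr D F G).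
Proof.
move=> D0 /bihomE pF /bihomE pG kE lE; apply/bihomE.
have -> : k''%:Z = k%:Z + k'%:Z - 1 by rewrite -PoszD kE -addn1 PoszD; ring.
have -> : l''%:Z = l%:Z + l'%:Z - 1 by rewrite -PoszD lE -addn1 PoszD; ring.
exact: zhom_gbr.
Qed.

Lemma bihomM (k l k' l' : nat) F G : bihom k l F -> bihom k' l' G -> bihom (k + k') (l + l') (F * G).
Proof. by move=> /bihomE pF /bihomE pG; apply/bihomE; rewrite !PoszD; exact: zhomM. Qed.

Lemma bihomD (k l : nat) F G : bihom k l F -> bihom k l G -> bihom k l (F + G).
Proof. by move=> /bihomE pF /bihomE pG; apply/bihomE; exact: zhomD. Qed.

Lemma bihomN (k l : nat) F : bihom k l F -> bihom k l (- F).
Proof. by move=> /bihomE pF; apply/bihomE; exact: zhomN. Qed.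

Lemma bihom0 (k l : nat) : bihom k l (0 : SF).
Proof. by apply/bihomE; exact: zhom0. Qed.

Lemma bihom_gf (f : C) : bihom 0%N 0%N (gf n d f : SF).
Proof.
move=> w S; rewrite mcoeffC; have [->|] := eqVneq w _; last by rewrite mulr0n mulr0 ffunE eqxx.
rewrite mulr1n mulr1 ffunE; case: (S =P _) => [->|_]; last by rewrite eqxx.
by rewrite /tdeg /xdeg mdeg0 !eq_card0 // => a; rewrite !inE.
Qed.

Lemma card_pred_set1 (h : 'I_d -> 'I_(d + d)) a : injective h ->
  #|[pred b | h b \in [set h a]]| = 1%N.
Proof. by move=> hI; rewrite -(card1 a); apply: eq_card => b; rewrite !inE (inj_eq hI). Qed.

Lemma card_pred_set1_other (h : 'I_d -> 'I_(d + d)) c : (forall b, h b != c) ->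
  #|[pred b | h b \in [set c]]| = 0%N.
Proof. by move=> hc; apply: eq_card0 => b; rewrite !inE (negPf (hc b)). Qed.

Lemma bihom_xi a : bihom 0%N 1%N (go C n (lshift d a) : SF).
Proof.
move=> w S; rewrite mcoeffC; have [->|] := eqVneq w _; last by rewrite mulr0n mulr0 ffunE eqxx.
rewrite mulr1n mulr1 ffunE; case: (S =P _) => [->|_]; last by rewrite eqxx.
rewrite /tdeg /xdeg mdeg0 card_pred_set1; last exact: lshift_inj.
by rewrite card_pred_set1_other // => b; rewrite eq_rlshift.
Qed.

Lemma bihom_theta a : bihom 1%N 0%N (go C n (rshift d a) : SF).
Proof.
move=> w S; rewrite mcoeffC; have [->|] := eqVneq w _; last by rewrite mulr0n mulr0 ffunE eqxx.
rewrite mulr1n mulr1 ffunE; case: (S =P _) => [->|_]; last by rewrite eqxx.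
rewrite /tdeg /xdeg mdeg0 card_pred_set1; last exact: rshift_inj.
by rewrite card_pred_set1_other // => b; rewrite eq_lrshift.
Qed.

Lemma bihom_gx i : bihom 1%N 1%N (gx C d i : SF).
Proof.
move=> w S; rewrite mcoeffX; have [<-|] := eqVneq _ w; last by rewrite mulr0n ffunE eqxx.
rewrite -(rmorph1 (@escal C (d + d))) ffunE.
case: (S =P _) => [->|_]; last by rewrite eqxx.
by rewrite /tdeg /xdeg mdeg1 !eq_card0 // => a; rewrite !inE.
Qed.

Section Euler.
Variable D : 'I_n -> C -> C.
Hypothesis DD : forall (k : 'I_n) f g, D k (f + g) = D k f + D k g.
Hypothesis DM : forall (k : 'I_n) f g, D k (f * g) = D k f * g + f * D k g.

Definition gid : SF := \sum_(a < d) go C n (lshift d a) * go C n (rshift d a).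

Lemma spar_gid : spar false gid.
Proof. by apply: spar_sum => a; rewrite -(addbb true); apply: sparM; exact: spar_go. Qed.

Lemma gbr_gid_gval g : gbr D gid (gval g) =
  match g with
  | Go c => match fintype.split c with inl _ => go C n c | inr _ => - go C n c end
  | _ => 0
  end.
Proof.
have SP := gbr_super_poisson d DD DM.
have -> : gbr D gid (gval g) = \sum_(a < d) gbr D (go C n (lshift d a) * go C n (rshift d a)) (gval g).
  rewrite /gid; elim/big_rec2: _ => [|a x y _ <-]; first exact: (sp_0l SP).
  exact: gbr_addl.
have E a : gbr D (go C n (lshift d a) * go C n (rshift d a)) (gval g) =
    go C n (lshift d a) * gf n d (gtab D (Go _ _ (rshift d a)) g)
    + sg (gpar g) (gf n d (gtab D (Go _ _ (lshift d a)) g) * go C n (rshift d a)).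
  rewrite (sp_leibl SP (@spar_go C n d _) (@spar_go C n d _) (@spar_gval C n d g)) -!(gbr_gval DD DM) /=.
  by [].
rewrite (eq_bigr _ (fun a _ => E a)); case: g {E} => [f|c|k] /=; rewrite /conj_ix.
- by apply: big1 => a _; rewrite !gf0 mulr0 mul0r /sg addr0.
- have cl a := unsplitK (inl _ a : 'I_d + 'I_d); have cr a := unsplitK (inr _ a : 'I_d + 'I_d).
  rewrite /= in cl cr.
  case: (split_ordP c) => a ->; rewrite ?cl ?cr (bigD1 a) //= big1 ?addr0 => [|b ba]; rewrite cl cr.
  + by rewrite eqxx eq_lrshift gf1 gf0 mulr1 mul0r /sg oppr0 addr0.
  + rewrite eq_lrshift (inj_eq (@lshift_inj _ _)) eq_sym (negPf ba) gf0 mulr0 mul0r /sg.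
    by rewrite oppr0 addr0.
  + by rewrite eqxx eq_rlshift gf1 gf0 mulr0 mul1r /sg add0r.
  rewrite eq_rlshift (inj_eq (@rshift_inj _ _)) eq_sym (negPf ba) gf0 mulr0 mul0r /sg.
  by rewrite oppr0 addr0.
by apply: big1 => a _; rewrite !gf0 mulr0 mul0r /sg addr0.
Qed.

(** The bracket with the identity is a derivation which multiplies xi by 1, theta by
    -1 and kills functions and momenta: it counts the difference of the two
    degrees. *)
Lemma gbr_gid (k l : nat) F : bihom k l F -> gbr D gid F = F *+ l - F *+ k.
Proof.
have SP := gbr_super_poisson d DD DM.
move=> FH; suff [] : spar (odd (k + l)) F /\ gbr D gid F = F *+ l - F *+ k by [].
move: k l F FH; apply: bihom_ind.
- move=> k l; split; first exact: spar0.
  by rewrite (sp_0r SP) !mul0rn subrr.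
- move=> k l F G [pF EF] [pG EG]; split; first exact: sparD.
  by rewrite (sp_addr SP) EF EG !mulrnDl opprD addrACA.
- move=> k l k' l' F G [pF EF] [pG EG]; split; first by rewrite addnACA oddD; exact: sparM.
  rewrite (sp_leib SP _ spar_gid pF) EF EG /sg /= !mulrnDr mulrBr mulrBl.
  by rewrite !mulrnAl !mulrnAr opprD addrACA.
- move=> f; split; first exact: spar_gf.
  by rewrite (gbr_gid_gval (Gf n d f)) !mulr0n subrr.
- move=> a; split; first exact: spar_go.
  rewrite (gbr_gid_gval (Go C n (lshift d a))) mulr1n mulr0n subr0.
  by rewrite (unsplitK (inl _ a : 'I_d + 'I_d)).
- move=> a; split; first exact: spar_go.
  rewrite (gbr_gid_gval (Go C n (rshift d a))) mulr1n mulr0n sub0r.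
  by rewrite (unsplitK (inr _ a : 'I_d + 'I_d)).
move=> i; split; first exact: spar_gx.
by rewrite (gbr_gid_gval (Gx C d i)) mulr1n subrr.
Qed.
End Euler.

Lemma odd_sq F : (forall x : C, x + x = 0 -> x = 0) -> spar true F -> F * F = 0.
Proof.
move=> tf pF; apply/mpolyP => w; apply/ffunP => S; rewrite mcoeff0 [RHS]ffunE; apply: tf.
by rewrite {1}(super_comm pF pF) /sg /= mcoeffN [X in X + _]ffunE addNr.
Qed.
End Bidegree.

Lemma even_comm (C : comNzRingType) (n d : nat) (F G : mpoly n (exterior C (d + d))) :
  spar false G -> F * G = G * F.
Proof.
move=> pG; rewrite [F]sf_expand mulr_suml mulr_sumr; apply: eq_bigr => w _.
rewrite mulr_suml mulr_sumr; apply: eq_bigr => S _.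
have pm := @mono_ind C n d (fun k l H => spar (odd (k + l)) H).
rewrite (super_comm (b := odd (tdeg w S + xdeg w S)) _ pG) ?andbF //.
apply: (pm) => [k l k' l' F1 F2 p1 p2|f|a|a|k].
- by rewrite addnACA oddD; exact: sparM.
- exact: spar_gf.
- exact: spar_go.
- exact: spar_go.
exact: spar_gx.
Qed.

(** * Substitutions *)
Section Substitution.
Variables (C : comNzRingType) (n d : nat) (C' : comNzRingType) (n' d' : nat).
Local Notation SF := (mpoly n (exterior C (d + d))).
Local Notation SF' := (mpoly n' (exterior C' (d' + d'))).
Implicit Types (F G : SF).
Variables (f : {rmorphism C -> C'}) (e : 'I_(d + d) -> SF') (p : 'I_n -> SF').

Definition gf_rm : {rmorphism C -> SF'} :=
  (@mpolyC n' _ \o (@escal C' (d' + d') \o f)).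
(** The ring morphism which replaces xi and theta by odd elements, the momenta by
    even ones, and the coefficients by their images; locked for the same reason
    as [slift]. *)
Definition ssub : SF -> SF' := locked_with lift_key (mmap (esub gf_rm e) p).
Lemma ssubE F : ssub F = mmap (esub gf_rm e) p F.
Proof. by rewrite /ssub unlock. Qed.

Hypothesis e_odd : forall c, spar true (e c).
Hypothesis e_sq : forall c, e c * e c = 0.
Hypothesis p_even : forall k, spar false (p k).
Arguments e_odd : clear implicits.
Arguments p_even : clear implicits.

Lemma gf_rmE x : gf_rm x = gf n' d' (f x).
Proof. by []. Qed.

Lemma ssub_esub_comm x c : GRing.comm (gf_rm x) (e c).
Proof. by rewrite /GRing.comm gf_rmE gf_comm. Qed.

Lemma ssub_e_anti a b : e a * e b = - (e b * e a).
Proof. by rewrite (super_comm (e_odd a) (e_odd b)). Qed.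

Fact esub_zmod : zmod_morphism (esub gf_rm e).
Proof. exact: esubB. Qed.

Fact esub_monoid : monoid_morphism (esub gf_rm e).
Proof.
split; first exact: esub1.
exact: (esubM ssub_esub_comm ssub_e_anti e_sq).
Qed.

Definition esub_rm : {rmorphism exterior C (d + d) -> SF'} :=
  HB.pack (esub gf_rm e)
    (GRing.isZmodMorphism.Build _ _ _ esub_zmod)
    (GRing.isMonoidMorphism.Build _ _ _ esub_monoid).

Lemma ssubD F G : ssub (F + G) = ssub F + ssub G.
Proof. by rewrite !ssubE; exact: (mmapD p esub_rm). Qed.

Lemma ssub0 : ssub 0 = 0.
Proof. by rewrite !ssubE; exact: (mmap0 p esub_rm). Qed.

Lemma ssubN F : ssub (- F) = - ssub F.
Proof. by rewrite !ssubE; exact: (mmapN p esub_rm). Qed.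

Lemma ssub_monoid : ssub 1 = 1 /\ forall F G, ssub (F * G) = ssub F * ssub G.
Proof.
suff [aM a1] : multiplicative (mmap esub_rm p).
  by split=> [|F G]; rewrite !ssubE; [exact: a1|exact: aM].
apply: commr_mmap_is_multiplicative.
- by move=> k x; exact: even_comm.
- move=> F m m'; rewrite /mmap1; apply: commr_prod => k _; apply: commrX; exact: even_comm.
Qed.

Lemma ssubM F G : ssub (F * G) = ssub F * ssub G.
Proof. by have [_] := ssub_monoid. Qed.

Lemma ssub_gf x : ssub (gf n d x) = gf n' d' (f x).
Proof. by rewrite ssubE (mmapC p esub_rm) /= esub_escal. Qed.

Lemma ssub_go c : ssub (go C n c) = e c.
Proof. by rewrite ssubE (mmapC p esub_rm) /= esub_egen. Qed.

Lemma ssub_gx k : ssub (gx C d k) = p k.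
Proof. by rewrite ssubE (mmapX p esub_rm) mmap1U. Qed.

Lemma spar_ssub b F : spar b F -> spar b (ssub F).
Proof.
move: b F; apply: spar_ind.
- by move=> b; rewrite ssub0; exact: spar0.
- by move=> b F G pF pG; rewrite ssubD; exact: sparD.
- by move=> b b' F G pF pG; rewrite ssubM; exact: sparM.
- by move=> x; rewrite ssub_gf; exact: spar_gf.
- by move=> c; rewrite ssub_go; exact: e_odd.
by move=> k; rewrite ssub_gx; exact: p_even.
Qed.

Lemma bihom_ssub k l F :
  (forall a, bihom 0%N 1%N (e (lshift d a))) -> (forall a, bihom 1%N 0%N (e (rshift d a))) ->
  (forall i, bihom 1%N 1%N (p i)) -> bihom k l F -> bihom k l (ssub F).
Proof.
move=> hx ht hp; move: k l F; apply: bihom_ind.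
- by move=> k l; rewrite ssub0; exact: bihom0.
- by move=> k l F G pF pG; rewrite ssubD; exact: bihomD.
- by move=> k l k' l' F G pF pG; rewrite ssubM; exact: bihomM.
- by move=> x; rewrite ssub_gf; exact: bihom_gf.
- by move=> c; rewrite ssub_go; exact: hx.
- by move=> c; rewrite ssub_go; exact: ht.
by move=> k; rewrite ssub_gx; exact: hp.
Qed.

Variables (D : 'I_n -> C -> C) (D' : 'I_n' -> C' -> C').
Hypothesis DD : forall k f g, D k (f + g) = D k f + D k g.
Hypothesis DM : forall k f g, D k (f * g) = D k f * g + f * D k g.
Hypothesis DD' : forall k f g, D' k (f + g) = D' k f + D' k g.
Hypothesis DM' : forall k f g, D' k (f * g) = D' k f * g + f * D' k g.
Let SP := gbr_super_poisson d DD DM.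
Let SP' := gbr_super_poisson d' DD' DM'.

Definition pois F G := ssub (gbr D F G) = gbr D' (ssub F) (ssub G).

Lemma pois_0r F : pois F 0.
Proof. by rewrite /pois (sp_0r SP) ssub0 (sp_0r SP'). Qed.

Lemma pois_addr F G H : pois F G -> pois F H -> pois F (G + H).
Proof.
rewrite /pois => e1 e2.
by rewrite (gbr_addr DD) ssubD e1 e2 ssubD (gbr_addr DD').
Qed.

Lemma pois_mulr b b' F G H : spar b F -> spar b' G -> pois F G -> pois F H -> pois F (G * H).
Proof.
rewrite /pois => pF pG e1 e2; rewrite (sp_leib SP _ pF pG) ssubD !ssubM e1.
have -> (c : bool) (X : SF) : ssub (sg c X) = sg c (ssub X) by case: c; rewrite /sg ?ssubN.
by rewrite !ssubM e2 (sp_leib SP' _ (spar_ssub pF) (spar_ssub pG)).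
Qed.

Lemma pois_sym b b' F G : spar b F -> spar b' G -> pois F G -> pois G F.
Proof.
rewrite /pois => pF pG e1; rewrite (sp_anti SP pG pF) (sp_anti SP' (spar_ssub pG) (spar_ssub pF)).
by rewrite -e1; case: (b' && b); rewrite /sg !ssubN.
Qed.

Lemma pois_genl b b' F G : (forall g, pois (gval g) G) ->
  spar b F -> spar b' G -> pois F G.
Proof.
move=> Pg pF pG; apply: (pois_sym pG pF).
suff [] : spar b F /\ pois G F by [].
have PG g : pois G (gval g) by apply: pois_sym (Pg g); [exact: spar_gval|exact: pG].
move: b F pF; apply: spar_ind.
- by move=> b; split; [exact: spar0|exact: pois_0r].
- by move=> b F H [pF e1] [pH e2]; split; [exact: sparD|exact: pois_addr].
- by move=> b1 b2 F H [pF e1] [pH e2]; split; [exact: sparM|exact: (pois_mulr pG pF e1 e2)].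
- by move=> x; split; [exact: spar_gf|exact: (PG (Gf n d x))].
- by move=> c; split; [exact: spar_go|exact: (PG (Go C n c))].
by move=> k; split; [exact: spar_gx|exact: (PG (Gx C d k))].
Qed.

(** Both sides are derivations in each argument, hence a substitution that preserves
    the brackets of generators preserves all brackets. *)
Lemma ssub_br b b' F G :
  (forall g h, gbr D' (ssub (gval g)) (ssub (gval h)) = gf n' d' (f (gtab D g h))) ->
  spar b F -> spar b' G -> pois F G.
Proof.
move=> Pgh pF pG; apply: (pois_genl _ pF pG) => g.
apply: (pois_sym pG (@spar_gval C n d g)); apply: (pois_genl _ pG (@spar_gval C n d g)) => h.
by rewrite /pois gbr_gval // ssub_gf Pgh.
Qed.

(** A second argument of bidegree (k, 0) is a polynomial in the theta over the
    coefficients, so that only the brackets with these generators matter. *)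
Lemma ssub_br_theta b k F G :
  (forall g x, gbr D' (ssub (gval g)) (gf n' d' (f x)) = gf n' d' (f (gtab D g (Gf n d x)))) ->
  (forall g a, gbr D' (ssub (gval g)) (e (rshift d a)) =
     gf n' d' (f (gtab D g (Go C n (rshift d a))))) ->
  spar b F -> bihom k 0%N G -> pois F G.
Proof.
move=> Pf Pt pF HG; have pG := bihom_spar HG; apply: (pois_genl _ pF pG) => g.
suff H k' l G' : bihom k' l G' -> spar (odd (k' + l)) G' /\ (l = 0%N -> pois (gval g) G').
  by have [_ /(_ erefl)] := H _ _ _ HG.
move: k' l G' {HG pG}; clear k; apply: bihom_ind.
- by move=> k l; split=> [|_]; [exact: spar0|exact: pois_0r].
- move=> k l F1 F2 [p1 e1] [p2 e2]; split=> [|l0]; first exact: sparD.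
  by apply: pois_addr; [exact: e1|exact: e2].
- move=> k l k' l' F1 F2 [p1 e1] [p2 e2]; split=> [|/eqP].
    by rewrite addnACA oddD; exact: sparM.
  rewrite addn_eq0 => /andP[/eqP l0 /eqP l0'].
  by apply: (pois_mulr (@spar_gval C n d g) p1); [exact: e1|exact: e2].
- move=> x; split=> [|_]; first exact: spar_gf.
  by rewrite /pois (gbr_gval DD DM g (Gf n d x)) !ssub_gf Pf.
- by move=> a; split=> //; exact: spar_go.
- move=> a; split=> [|_]; first exact: spar_go.
  by rewrite /pois (gbr_gval DD DM g (Go C n (rshift d a))) ssub_gf ssub_go Pt.
by move=> i; split=> //; exact: spar_gx.
Qed.

(** The bracket with X is a derivation, which vanishes on the image as soon as it
    does on the images of the generators. *)
Lemma ssub_br0 b b' X F : spar b' X ->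
  (forall g, gbr D' X (ssub (gval g)) = 0) -> spar b F -> gbr D' X (ssub F) = 0.
Proof.
move=> pX Xg pF; suff [] : spar b F /\ gbr D' X (ssub F) = 0 by [].
move: b F pF; apply: spar_ind.
- by move=> b; split; [exact: spar0|rewrite ssub0 (sp_0r SP')].
- move=> b F H [pF e1] [pH e2]; split; first exact: sparD.
  by rewrite ssubD (gbr_addr DD') e1 e2 addr0.
- move=> b1 b2 F H [pF e1] [pH e2]; split; first exact: sparM.
  by rewrite ssubM (sp_leib SP' _ pX (spar_ssub pF)) e1 e2 mul0r mulr0 /sg oppr0 add0r; case: ifP.
- by move=> x; split; [exact: spar_gf|exact: (Xg (Gf n d x))].
- by move=> c; split; [exact: spar_go|exact: (Xg (Go C n c))].
by move=> k; split; [exact: spar_gx|exact: (Xg (Gx C d k))].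
Qed.

End Substitution.

(** Superfunctions are generated by the coefficients and the coordinates; the
    additivity and multiplicativity are taken as hypotheses so that composites of
    locked substitutions can be compared directly. *)
Lemma sf_morph_ext (C : comNzRingType) (n d : nat) (K : nzRingType)
    (phi psi : mpoly n (exterior C (d + d)) -> K) :
  (forall F G, phi (F + G) = phi F + phi G) -> (forall F G, psi (F + G) = psi F + psi G) ->
  (forall F G, phi (F * G) = phi F * phi G) -> (forall F G, psi (F * G) = psi F * psi G) ->
  (forall g, phi (gval g) = psi (gval g)) -> phi =1 psi.
Proof.
move=> aD bD aM bM ab F.
have a0 : phi 0 = 0 by apply: (addrI (phi 0)); rewrite -aD !addr0.
have b0 : psi 0 = 0 by apply: (addrI (psi 0)); rewrite -bD !addr0.
rewrite [F]sf_expand.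
apply: (big_ind (fun F => phi F = psi F)) => [|x y ex ey|w _].
- by rewrite a0 b0.
- by rewrite aD bD ex ey.
apply: (big_ind (fun F => phi F = psi F)) => [|x y ex ey|S _].
- by rewrite a0 b0.
- by rewrite aD bD ex ey.
apply: (@mono_ind C n d (fun _ _ G => phi G = psi G)) => [k l k' l' F1 F2 e1 e2|x|a|a|k].
- by rewrite aM bM e1 e2.
- exact: (ab (Gf n d x)).
- exact: (ab (Go C n (lshift d a))).
- exact: (ab (Go C n (rshift d a))).
exact: (ab (Gx C d k)).
Qed.

(** * Poissonization in a bigraded Poisson algebra *)

(** The part of the structure of the functions on T^*Pi(A) which the computations
    use: a graded Poisson bracket of bidegree (-1, -1) and an element I whose
    bracket measures the difference of the degrees. *)
Record bigraded_poisson (K : nzRingType) (par : bool -> K -> Prop)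
    (hom : int -> int -> K -> Prop) (br : K -> K -> K) (I : K) : Prop :=
  BigradedPoisson {
  bp_sp : super_poisson par br ;
  bp_jacobi : forall a b c x y z, par a x -> par b y -> par c z -> jacobi_id br a b x y z ;
  bp_tf : forall x : K, x + x = 0 -> x = 0 ;
  bp_par : forall k l x, hom k l x -> par (odd (absz (k + l))) x ;
  bp_homD : forall k l x y, hom k l x -> hom k l y -> hom k l (x + y) ;
  bp_homN : forall k l x, hom k l x -> hom k l (- x) ;
  bp_homM : forall k l k' l' x y, hom k l x -> hom k' l' y -> hom (k + k') (l + l') (x * y) ;
  bp_homB : forall k l k' l' x y, hom k l x -> hom k' l' y ->
    hom (k + k' - 1) (l + l' - 1) (br x y) ;
  bp_homI : hom 1 1 I ;
  bp_neg : forall k l x, hom k l x -> (k < 0) || (l < 0) -> x = 0 ;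
  bp_euler : forall k l x, hom k l x -> br I x = (l - k)%:~R * x }.

Lemma sg0 (V : zmodType) c : sg c (0 : V) = 0.
Proof. by case: c; rewrite /sg ?oppr0. Qed.

Section Calculus.
Variables (K : nzRingType) (par : bool -> K -> Prop) (hom : int -> int -> K -> Prop).
Variables (B : K -> K -> K) (I : K).
Hypothesis BP : bigraded_poisson par hom B I.
Let SP := bp_sp BP.
Implicit Types (a b c x y z : K).

Lemma leib_e p x y z : par p x -> par false y -> B x (y * z) = B x y * z + y * B x z.
Proof. by move=> px py; rewrite (sp_leib SP _ px py) andbF. Qed.

Lemma leib_d p x y z : par false x -> par p y -> B x (y * z) = B x y * z + y * B x z.
Proof. by move=> px py; rewrite (sp_leib SP _ px py). Qed.

Lemma leib_o x y z : par true x -> par true y -> B x (y * z) = B x y * z - y * B x z.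
Proof. by move=> px py; rewrite (sp_leib SP _ px py). Qed.

Lemma leibl_e p q x y z : par p x -> par false y -> par q z ->
  B (x * y) z = x * B y z + B x z * y.
Proof. by move=> px py pz; rewrite (sp_leibl SP px py pz). Qed.

Lemma leibl_d p q x y z : par p x -> par q y -> par false z ->
  B (x * y) z = x * B y z + B x z * y.
Proof. by move=> px py pz; rewrite (sp_leibl SP px py pz) andbF. Qed.

Lemma leibl_o p x y z : par p x -> par true y -> par true z ->
  B (x * y) z = x * B y z - B x z * y.
Proof. by move=> px py pz; rewrite (sp_leibl SP px py pz). Qed.

Lemma anti_e p x y : par false x -> par p y -> B x y = - B y x.
Proof. by move=> px py; rewrite (sp_anti SP px py). Qed.

Lemma anti_o x y : par true x -> par true y -> B x y = B y x.
Proof. by move=> px py; rewrite (sp_anti SP px py) /sg /= opprK. Qed.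

Lemma comm_e p x y : par false x -> par p y -> x * y = y * x.
Proof. by move=> px py; rewrite (sp_comm SP px py). Qed.

Lemma comm_o x y : par true x -> par true y -> x * y = - (y * x).
Proof. by move=> px py; rewrite (sp_comm SP px py). Qed.

Lemma sq_o x : par true x -> x * x = 0.
Proof. by move=> px; apply: (bp_tf BP); rewrite {1}(comm_o px px) addNr. Qed.

Lemma br_even_self x : par false x -> B x x = 0.
Proof. by move=> px; apply: (bp_tf BP); rewrite {1}(anti_e px px) addNr. Qed.

(** Many brackets vanish for reasons of degree only, such as those of two
    multivector fields. *)
Lemma hom_br0 k l k' l' x y : hom k l x -> hom k' l' y ->
  (k + k' - 1 < 0) || (l + l' - 1 < 0) -> B x y = 0.
Proof. by move=> hx hy; apply: (bp_neg BP) (bp_homB BP hx hy). Qed.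

(** Both relations are instances of the Jacobi identity: {al, .} squares to zero and
    maps P to minus {P, al}, and {{P, al}, .} kills P and al. *)
Lemma br_poisson_diff al P : par true al -> par false P -> B al al = 0 ->
  B (B P al) P = 0 -> B al (B P al) = 0 /\ B (B P al) (B P al) = 0.
Proof.
move=> pa pP aa PP; have pb := sp_parB SP pP pa.
have ab : B al (B P al) = 0.
  have := bp_jacobi BP pa pa pP; rewrite /jacobi_id aa (sp_0l SP) add0r /sg /=.
  move=> E; have {}E : B al (B al P) = 0 by apply: (bp_tf BP); rewrite {1}E addNr.
  by rewrite (anti_e pP pa) (sp_oppr SP) E oppr0.
split=> //; have := bp_jacobi BP pb pP pa.
by rewrite /jacobi_id PP (sp_0l SP) [B (B P al) al](anti_o pb pa) ab (sp_0r SP) add0r.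
Qed.

Lemma br_bialgebroid al be : par true al -> par true be ->
  B al al = 0 -> B al be = 0 -> B be be = 0 -> B (al + be) (al + be) = 0.
Proof.
move=> pa pb aa ab bb; rewrite !(sp_addl SP) !(sp_addr SP) aa ab bb.
by rewrite (anti_o pb pa) ab !addr0.
Qed.

(** The algebraic shadow of the geometric situation on p^*A: pt is the momentum of t,
    s is the function exp(-t) and s' its inverse. *)
Record jacobi_data (mu phi eps pi E pt s s' idB : K) : Prop := JacobiData {
  J_h_mu : hom 1 2 mu ;
  J_h_phi : hom 0 1 phi ;
  J_h_eps : hom 1 0 eps ;
  J_h_pi : hom 2 0 pi ;
  J_h_E : hom 1 0 E ;
  J_h_pt : hom 1 1 pt ;
  J_h_s : hom 0 0 s ;
  J_h_s' : hom 0 0 s' ;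
  J_mu_mu : B mu mu = 0 ;
  J_pi_mu_pi : B (B pi mu) pi = - (E * pi *+ 2) ;
  J_E_mu_pi : B (B E mu) pi = 0 ;
  J_phi_eps : B phi eps = 1 ;
  J_phi_mu : B phi mu = 0 ;
  J_phi_pi : B phi pi = 0 ;
  J_phi_E : B phi E = 0 ;
  J_eps_mu : B eps mu = 0 ;
  J_pt_s : B pt s = - s ;
  J_s_mu : B s mu = 0 ;
  J_s_phi : B s phi = 0 ;
  J_pt_mu : B pt mu = 0 ;
  J_pt_phi : B pt phi = 0 ;
  J_pt_eps : B pt eps = 0 ;
  J_pt_pi : B pt pi = 0 ;
  J_pt_E : B pt E = 0 ;
  J_s's : s' * s = 1 ;
  J_I_split : I = idB + phi * eps }.

Section Poissonization.
Variables (mu phi eps pi E pt s s' idB : K).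
Hypothesis JD : jacobi_data mu phi eps pi E pt s s' idB.
Let h_mu := J_h_mu JD.
Let h_phi := J_h_phi JD.
Let h_eps := J_h_eps JD.
Let h_pi := J_h_pi JD.
Let h_E := J_h_E JD.
Let h_pt := J_h_pt JD.
Let h_s := J_h_s JD.
Let h_s' := J_h_s' JD.
Let mu_mu := J_mu_mu JD.
Let pi_mu_pi := J_pi_mu_pi JD.
Let E_mu_pi := J_E_mu_pi JD.
Let phi_eps := J_phi_eps JD.
Let phi_mu := J_phi_mu JD.
Let phi_pi := J_phi_pi JD.
Let phi_E := J_phi_E JD.
Let eps_mu := J_eps_mu JD.
Let pt_s := J_pt_s JD.
Let s_mu := J_s_mu JD.
Let s_phi := J_s_phi JD.
Let pt_mu := J_pt_mu JD.
Let pt_phi := J_pt_phi JD.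
Let pt_eps := J_pt_eps JD.
Let pt_pi := J_pt_pi JD.
Let pt_E := J_pt_E JD.
Let s's := J_s's JD.
Let I_split := J_I_split JD.

Let p_mu : par true mu := bp_par BP h_mu.
Let p_phi : par true phi := bp_par BP h_phi.
Let p_eps : par true eps := bp_par BP h_eps.
Let p_pi : par false pi := bp_par BP h_pi.
Let p_E : par true E := bp_par BP h_E.
Let p_pt : par false pt := bp_par BP h_pt.
Let p_s : par false s := bp_par BP h_s.

(** With the bivector Lambda = pi + eps E, [mu0] and [nu1] are the Lie algebroid on
    p^*A and {Lambda, mu} + phi Lambda. The latter is [nu] with E I added ([nu1E]),
    which cancels the term of [nu] in the identity of B. *)
Definition biv := pi + eps * E.
Definition mu0 := mu + phi * pt.
Definition nu1 := B biv mu + phi * biv.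
Definition nu := B pi mu + phi * pi + eps * B mu E - E * idB.
Definition beta := s * (nu + (- E) * (pt + - I)).

Lemma h_biv : hom 2 0 biv.
Proof. by apply: (bp_homD BP) => //; exact: (bp_homM BP h_eps h_E). Qed.
Let p_biv : par false biv := bp_par BP h_biv.

Lemma h_mu0 : hom 1 2 mu0.
Proof. by apply: (bp_homD BP) => //; exact: (bp_homM BP h_phi h_pt). Qed.
Let p_mu0 : par true mu0 := bp_par BP h_mu0.

Lemma h_nu1 : hom 2 1 nu1.
Proof.
apply: (bp_homD BP); first exact: (bp_homB BP h_biv h_mu).
exact: (bp_homM BP h_phi h_biv).
Qed.
Let p_nu1 : par true nu1 := bp_par BP h_nu1.

Let g_even : par false (B mu E) := sp_parB SP p_mu p_E.

Lemma phi_biv : B phi biv = E.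
Proof.
by rewrite /biv (sp_addr SP) phi_pi (leib_o _ p_phi p_eps) phi_eps phi_E mul1r mulr0 subr0 add0r.
Qed.

Lemma biv_mu : B biv mu = B pi mu + eps * B mu E.
Proof.
rewrite /biv (sp_addl SP); congr (_ + _).
rewrite (leibl_o p_eps p_E p_mu) eps_mu mul0r subr0.
by rewrite (anti_o p_E p_mu).
Qed.

Lemma nu1E : nu1 = nu + E * I.
Proof.
rewrite /nu1 /nu biv_mu /biv I_split (mulrDr E).
rewrite [E * (phi * eps)]mulrA (comm_o p_E p_phi) mulNr -mulrA (comm_o p_E p_eps) mulrN opprK.
by ncring.
Qed.

Lemma betaE : beta = s * (nu1 - E * pt).
Proof. by rewrite /beta nu1E; congr (_ * _); ncring. Qed.

Lemma h_beta : hom 2 1 beta.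
Proof.
have h : hom 2 1 (nu1 - E * pt).
  apply: (bp_homD BP); first exact: h_nu1.
  by apply: (bp_homN BP); exact: (bp_homM BP h_E h_pt).
by rewrite betaE; exact: (bp_homM BP h_s h).
Qed.

Lemma mu0_mu0 : B mu0 mu0 = 0.
Proof.
have pt_pt := br_even_self p_pt.
have phi_phi : B phi phi = 0 by exact: hom_br0 h_phi h_phi _.
have mu_pt : B mu pt = 0 by rewrite -[LHS]opprK -(anti_e p_pt p_mu) pt_mu oppr0.
have p_ptphi : par true (phi * pt) := sp_parM SP p_phi p_pt.
have mf : B mu (phi * pt) = 0.
  by rewrite (leib_o _ p_mu p_phi) (anti_o p_mu p_phi) phi_mu mu_pt mul0r mulr0 subr0.
have ff : B (phi * pt) (phi * pt) = 0.
  rewrite (leib_o _ p_ptphi p_phi) (leibl_e p_phi p_pt p_phi) (leibl_e p_phi p_pt p_pt).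
  rewrite pt_phi phi_phi pt_pt.
  have -> : B phi pt = 0 by rewrite -[LHS]opprK -(anti_e p_pt p_phi) pt_phi oppr0.
  by ncring.
exact: br_bialgebroid.
Qed.

Lemma pt_biv : B pt biv = 0.
Proof. by rewrite /biv (sp_addr SP) pt_pi (leib_d _ p_pt p_eps) pt_eps pt_E; ncring. Qed.

Lemma hom_s_theta k x : hom k 0 x -> B s x = 0.
Proof. by move=> hx; apply: (hom_br0 h_s hx); rewrite orbC. Qed.

(** The momentum in mu0 differentiates s, which produces the term s phi Lambda, and
    phi differentiates Lambda, which produces - s E pt. *)
Lemma poissonization_eq : B (s * biv) mu0 = beta.
Proof.
rewrite (leibl_e p_s p_biv p_mu0) betaE.
have -> : B s mu0 = phi * s.
  rewrite /mu0 (sp_addr SP) s_mu (leib_d _ p_s p_phi) s_phi.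
  rewrite (anti_e p_s p_pt) pt_s; ncring.
have -> : B biv mu0 = B biv mu - E * pt.
  rewrite /mu0 (sp_addr SP) (leib_d _ p_biv p_phi) (anti_e p_biv p_phi) phi_biv.
  rewrite (anti_e p_biv p_pt) pt_biv; ncring.
by rewrite -(comm_e p_s p_phi) /nu1; ncring.
Qed.

(** The two equations of a Jacobi structure in one: eps has zero bracket with B, so
    that the components along eps of the left side reduce to the bracket of E
    with mu and pi, which vanishes. *)
Lemma biv_mu_biv : B (B biv mu) biv = - (E * biv) - E * biv.
Proof.
have g0 : B eps (B pi mu) = 0.
  rewrite (bp_jacobi BP p_eps p_pi p_mu) eps_mu (sp_0r SP) (hom_br0 h_eps h_pi) //.
  by rewrite (sp_0l SP) /sg /= addr0.
have p_pimu : par true (B pi mu) := sp_parB SP p_pi p_mu.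
have Emu : B E mu = B mu E := anti_o p_E p_mu.
have Epimu : B E (B pi mu) = 0.
  rewrite (bp_jacobi BP p_E p_pi p_mu) (hom_br0 h_E h_pi) // (sp_0l SP) add0r /sg /=.
  have p_Emu : par false (B E mu) := sp_parB SP p_E p_mu.
  by rewrite (anti_e p_pi p_Emu) E_mu_pi oppr0.
have g1 : B (B pi mu) (eps * E) = 0.
  rewrite (leib_o _ p_pimu p_eps) (anti_o p_pimu p_eps) g0 (anti_o p_pimu p_E) Epimu; ncring.
have g2 : B (eps * B mu E) pi = 0.
  by rewrite (leibl_e p_eps g_even p_pi) -Emu E_mu_pi (hom_br0 h_eps h_pi) //; ncring.
have g3 : B (eps * B mu E) (eps * E) = 0.
  have p_eg : par true (eps * B mu E) := sp_parM SP p_eps g_even.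
  have eg : B (B mu E) eps = 0.
    rewrite (anti_e g_even p_eps) (bp_jacobi BP p_eps p_mu p_E) eps_mu (sp_0l SP).
    by rewrite (hom_br0 h_eps h_E) // (sp_0r SP) /sg /= oppr0 addr0 oppr0.
  rewrite (leib_o _ p_eg p_eps) (leibl_e p_eps g_even p_eps) (leibl_e p_eps g_even p_E).
  rewrite eg (hom_br0 h_eps h_eps) // (hom_br0 h_eps h_E) //.
  have -> : eps * (eps * B (B mu E) E + 0 * B mu E) = (eps * eps) * B (B mu E) E by ncring.
  by rewrite (sq_o p_eps); ncring.
have -> : E * biv = E * pi.
  by rewrite /biv mulrDr mulrA (comm_o p_E p_eps) mulNr -mulrA (sq_o p_E); ncring.
rewrite biv_mu (sp_addl SP) /biv !(sp_addr SP) pi_mu_pi g1 g2 g3 mulr2n; ncring.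
Qed.

(** The brackets of nu1 - E pt, which is beta without its factor s, with s and with
    Lambda are E s and - E Lambda: they compensate each other. *)
Lemma poisson_eq : B beta (s * biv) = 0.
Proof.
rewrite betaE.
have p_N : par true (nu1 - E * pt).
  by apply: (sp_parD SP) => //; apply: (sp_parN SP); exact: (sp_parM SP p_E p_pt).
have p_sL : par false (s * biv) := sp_parM SP p_s p_biv.
rewrite (leibl_d p_s p_N p_sL) (leib_e _ p_N p_s) (leib_e _ p_s p_s).
rewrite (br_even_self p_s) (hom_s_theta h_biv).
have E_biv : B E biv = 0 by exact: hom_br0 h_E h_biv _.
have -> : B (nu1 - E * pt) s = E * s.
  rewrite (sp_addl SP) (sp_oppl SP) (leibl_e p_E p_pt p_s) pt_s.
  rewrite (hom_br0 h_E h_s) //.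
  have -> : B nu1 s = 0.
    rewrite -[LHS]opprK -(anti_e p_s p_nu1) /nu1 (sp_addr SP) (leib_d _ p_s p_phi) s_phi.
    rewrite (bp_jacobi BP p_s p_biv p_mu) (hom_s_theta h_biv) s_mu (sp_0l SP) (sp_0r SP).
    by rewrite /sg /=; ncring.
  by ncring.
have -> : B (nu1 - E * pt) biv = - (E * biv).
  rewrite (sp_addl SP) (sp_oppl SP) (leibl_e p_E p_pt p_biv) pt_biv E_biv.
  rewrite /nu1 (sp_addl SP) biv_mu_biv (leibl_e p_phi p_biv p_biv) (br_even_self p_biv) phi_biv.
  by ncring.
by rewrite -(comm_e p_s p_E); ncring.
Qed.

Lemma mu0_beta : B mu0 beta = 0 /\ B beta beta = 0.
Proof.
rewrite -poissonization_eq; apply: br_poisson_diff => //.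
- exact: (sp_parM SP p_s p_biv).
- exact: mu0_mu0.
by rewrite poissonization_eq poisson_eq.
Qed.

(** The differential and the bracket of the Jacobi bialgebroid, on multivectors. *)
Definition jd c := B nu c + (- E) * c.
Definition jbr a b := B (B a (mu + I * phi)) b - a * B phi b + B a phi * b.

Lemma B_mulrzl x y (z : int) : B (x *~ z) y = B x y *~ z.
Proof.
have Bn (n : nat) : B (x *+ n) y = B x y *+ n.
  by elim: n => [|n IH]; rewrite ?mulr0n ?(sp_0l SP) // !mulrS (sp_addl SP) IH.
by case: z => n; rewrite ?NegzE ?mulrNz ?(sp_oppl SP) -!pmulrn Bn.
Qed.

Lemma par_mulrz p x (z : int) : par p x -> par p (x *~ z).
Proof.
move=> px; have pn (n : nat) : par p (x *+ n).
  elim: n => [|n IH]; last by rewrite mulrS; exact: (sp_parD SP).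
  by rewrite mulr0n -(subrr x); apply: (sp_parD SP) => //; exact: (sp_parN SP).
by case: z => n; rewrite ?NegzE ?mulrNz -?pmulrn //; apply: (sp_parN SP).
Qed.

Lemma euler k l x : hom k l x -> B I x = x *~ (l - k).
Proof. by move=> hx; rewrite (bp_euler BP hx) mulrzl. Qed.

(** Independence of t and of its momentum: {pt, .} is the derivative along t, and
    {s, .} is s times the derivative along pt. *)
Definition tfree p x := [/\ par p x, B s x = 0 & B pt x = 0].

Lemma tfree_D p x y : tfree p x -> tfree p y -> tfree p (x + y).
Proof.
move=> [px sx tx] [py sy ty]; split; first exact: (sp_parD SP).
  by rewrite (sp_addr SP) sx sy addr0.
by rewrite (sp_addr SP) tx ty addr0.
Qed.

Lemma tfree_N p x : tfree p x -> tfree p (- x).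
Proof.
move=> [px sx tx]; split; first exact: (sp_parN SP).
  by rewrite (sp_oppr SP) sx oppr0.
by rewrite (sp_oppr SP) tx oppr0.
Qed.

Lemma tfree_M p q x y : tfree p x -> tfree q y -> tfree (p (+) q) (x * y).
Proof.
move=> [px sx tx] [py sy ty]; split; first exact: (sp_parM SP).
  by rewrite (leib_d _ p_s px) sx sy mul0r mulr0 addr0.
by rewrite (leib_d _ p_pt px) tx ty mul0r mulr0 addr0.
Qed.

Lemma tfree_B p q x y : tfree p x -> tfree q y -> tfree (p (+) q) (B x y).
Proof.
move=> [px sx tx] [py sy ty]; split; first exact: (sp_parB SP).
  by rewrite (bp_jacobi BP p_s px py) sx sy (sp_0l SP) (sp_0r SP) /sg /= addr0.
by rewrite (bp_jacobi BP p_pt px py) tx ty (sp_0l SP) (sp_0r SP) /sg /= addr0.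
Qed.

Let t_mu : tfree true mu. Proof. by []. Qed.
Let t_phi : tfree true phi. Proof. by []. Qed.
Let t_eps : tfree true eps. Proof. by split=> //; exact: hom_s_theta h_eps. Qed.
Let t_pi : tfree false pi. Proof. by split=> //; exact: hom_s_theta h_pi. Qed.
Let t_E : tfree true E. Proof. by split=> //; exact: hom_s_theta h_E. Qed.

Let p_I : par false I := bp_par BP (bp_homI BP).

Let t_I : tfree false I.
Proof.
split=> //; first by rewrite (anti_e p_s p_I) (euler h_s) mulr0z oppr0.
by rewrite (anti_e p_pt p_I) (euler h_pt) mulr0z oppr0.
Qed.

Let t_biv : tfree false biv.
Proof. by apply: (tfree_D t_pi); exact: (tfree_M t_eps t_E). Qed.

Let t_nu1 : tfree true nu1.
Proof. by apply: tfree_D; [exact: (tfree_B t_biv t_mu)|exact: (tfree_M t_phi t_biv)]. Qed.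

Lemma nu_nu1 : nu = nu1 - E * I.
Proof. by rewrite nu1E; ncring. Qed.

Let t_nu : tfree true nu.
Proof.
rewrite nu_nu1; apply: (tfree_D t_nu1); apply: tfree_N; exact: (tfree_M t_E t_I).
Qed.

Lemma h_nu : hom 2 1 nu.
Proof.
rewrite nu_nu1; apply: (bp_homD BP) h_nu1 _; apply: (bp_homN BP).
exact: (bp_homM BP h_E (bp_homI BP)).
Qed.

Lemma hom_jd k c : hom k 0 c -> hom (k + 1) 0 (jd c).
Proof.
move=> hc; apply: (bp_homD BP).
  have -> : k + 1 = 2 + k - 1 by ring.
  exact: (bp_homB BP h_nu hc).
rewrite [k + 1]addrC; exact: (bp_homM BP (bp_homN BP h_E) hc).
Qed.

Lemma tfree_jd p c : tfree p c -> tfree (~~ p) (jd c).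
Proof.
move=> tc; rewrite -addTb; apply: tfree_D; first exact: tfree_B.
by apply: tfree_M => //; exact: tfree_N.
Qed.

Lemma hom_jbr k l a b : hom k 0 a -> hom l 0 b -> hom (k + l - 1) 0 (jbr a b).
Proof.
move=> ha hb.
have hM : hom 1 2 (mu + I * phi).
  by apply: (bp_homD BP) => //; exact: (bp_homM BP (bp_homI BP) h_phi).
apply: (bp_homD BP); first apply: (bp_homD BP).
- have -> : k + l - 1 = k + 1 - 1 + l - 1 by ring.
  exact: (bp_homB BP (bp_homB BP ha hM) hb).
- have -> : k + l - 1 = k + (0 + l - 1) by ring.
  apply: (bp_homN BP); exact: (bp_homM BP ha (bp_homB BP h_phi hb)).
have -> : k + l - 1 = (k + 0 - 1) + l by ring.
exact: (bp_homM BP (bp_homB BP ha h_phi) hb).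
Qed.

Lemma tfree_jbr p q a b : tfree p a -> tfree q b -> tfree (~~ (p (+) q)) (jbr a b).
Proof.
move=> ta tb.
have tM : tfree true (mu + I * phi) by apply: tfree_D => //; exact: (tfree_M t_I t_phi).
apply: tfree_D; first apply: tfree_D.
- have -> : ~~ (p (+) q) = p (+) true (+) q by case: p {ta}; case: q {tb}.
  by apply: tfree_B => //; exact: tfree_B.
- have -> : ~~ (p (+) q) = p (+) (true (+) q) by case: p {ta}; case: q {tb}.
  by apply: tfree_N; apply: tfree_M => //; exact: tfree_B.
have -> : ~~ (p (+) q) = p (+) true (+) q by case: p {ta}; case: q {tb}.
by apply: tfree_M => //; exact: tfree_B.
Qed.

(** The term E I of [nu] acts on multivectors of degree k as multiplication by
    a multiple of E, by the Euler identity. *)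
Lemma jd_nu1 k p c : hom k 0 c -> par p c -> jd c = B nu1 c + (E * c) *~ (k - 1).
Proof.
move=> hc pc; rewrite /jd nu_nu1 (sp_addl SP) (sp_oppl SP) (leibl_e p_E p_I pc).
rewrite (hom_br0 h_E hc) ?orbT // (euler hc) mul0r addr0 mulrzAr -addrA; congr (_ + _).
by rewrite sub0r mulrNz opprK mulrzBr mulr1z mulNr.
Qed.

Lemma jbr_mu k l p q a b : hom k 0 a -> hom l 0 b -> par p a -> par q b ->
  jbr a b = B (B a mu) b + (a * B phi b) *~ (k - 1) - (B a phi * b) *~ (l - 1).
Proof.
move=> ha hb pa pb; rewrite /jbr (sp_addr SP) (sp_addl SP).
have pu : par (p (+) true) (B a phi) := sp_parB SP pa p_phi.
have hu : hom (k - 1) 0 (B a phi).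
  have -> : k - 1 = k + 0 - 1 by ring.
  exact: (bp_homB BP ha h_phi).
have ab0 : B a b = 0 by apply: (hom_br0 ha hb); rewrite orbT.
have ub0 : B (B a phi) b = 0 by apply: (hom_br0 hu hb); rewrite orbT.
have aI : B a I = a *~ k.
  by rewrite -[LHS]opprK -(anti_e p_I pa) (euler ha) sub0r mulrNz opprK.
have -> : B (B a (I * phi)) b = (a * B phi b) *~ k - (B a phi * b) *~ l.
  rewrite (leib_e _ pa p_I) aI (sp_addl SP) (sp_leibl SP p_I pu pb) ub0 mulr0 add0r.
  have -> : B (a *~ k * phi) b = (a * B phi b) *~ k.
    rewrite mulrzAl B_mulrzl (sp_leibl SP pa p_phi pb) ab0 mul0r.
    by rewrite /sg oppr0; case: ifP; rewrite addr0.
  congr (_ + _); rewrite (euler hb) sub0r mulrNz mulNr mulrzAl (sp_comm SP pu pb).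
  by rewrite [_ && q]andbC; case: (q && _); rewrite /sg ?mulNrz ?opprK.
rewrite !mulrzBr !mulr1z; ncring.
Qed.

(** The powers r = s^(z - 1), through the properties that serve: the factor r turns
    the coefficients z - 1 of [jd_nu1] and [jbr_mu] into derivatives along t. For
    z = 0 this is the inverse of s. *)
Record weight (z : int) (r : K) : Prop := Weight {
  w_par : par false r ;
  w_pt : B pt r = r *~ (1 - z) ;
  w_br : forall p x, par p x -> B s x = 0 -> B r x = 0 ;
  w_inv : exists r', r' * r = 1 }.

Lemma weight_M (z1 z2 : int) r1 r2 : weight z1 r1 -> weight z2 r2 -> weight (z1 + z2 - 1) (r1 * r2).
Proof.
move=> [p1 t1 b1 [v1 i1]] [p2 t2 b2 [v2 i2]]; split.
- exact: (sp_parM SP p1 p2).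
- rewrite (leib_d _ p_pt p1) t1 t2 mulrzAl mulrzAr -mulrzDr; congr (_ *~ _); ring.
- by move=> p x px sx; rewrite (leibl_e p1 p2 px) (b1 _ _ px sx) (b2 _ _ px sx) mulr0 mul0r addr0.
by exists (v2 * v1); rewrite mulrA -[v2 * v1 * r1]mulrA i1 mulr1.
Qed.

Let p_s' : par false s' := bp_par BP h_s'.

Lemma weight_s : weight 2 s.
Proof.
by split=> //; exists s'.
Qed.

Lemma weight_s' : weight 0 s'.
Proof.
have ss' : s * s' = 1 by rewrite (comm_e p_s p_s').
have B1 p x : par p x -> B x 1 = 0.
  move=> px; have p1 : par false 1 by rewrite -s's; exact: (sp_parM SP p_s' p_s).
  have := leib_e 1 px p1; rewrite !mulr1 mul1r => E1.
  by apply: (addrI (B x 1)); rewrite -E1 addr0.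
split=> //; last by exists s.
- have := B1 _ _ p_pt; rewrite -s's (leib_e _ p_pt p_s') pt_s mulrN.
  by move/eqP; rewrite subr_eq0 subr0 mulr1z => /eqP/(congr1 (fun x => x * s'));
    rewrite -!mulrA ss' !mulr1.
move=> p x px sx; have := B1 _ _ px; rewrite -s's (leib_e _ px p_s').
have -> : B x s = 0 by rewrite -[LHS]opprK -(anti_e p_s px) sx oppr0.
rewrite mulr0 addr0 => /(congr1 (fun y => y * s')); rewrite -mulrA ss' mulr1 mul0r => xs'.
by rewrite (anti_e p_s' px) xs' oppr0.
Qed.

Lemma weight_ex (k : nat) : exists r, weight k%:Z r.
Proof.
elim: k => [|k [r wr]]; first by exists s'; exact: weight_s'.
exists (r * s); have -> : k.+1%:Z = k%:Z + 2 - 1 by rewrite -addn1 PoszD; ring.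
exact: weight_M wr weight_s.
Qed.

Lemma weight_s0 (z : int) r : weight z r -> B s r = 0.
Proof.
move=> [pr _ br _].
by rewrite -[LHS]opprK -(anti_e pr p_s) (br _ _ p_s (br_even_self p_s)) oppr0.
Qed.

Lemma weight_r0 (z : int) r p x : weight z r -> par p x -> B s x = 0 -> B x r = 0.
Proof.
by move=> [pr _ br _] px sx; rewrite -[LHS]opprK -(anti_e pr px) (br _ _ px sx) oppr0.
Qed.

(** The derivative of r along t gives (k - 1) E, which is exactly the term of the
    differential that depends on the degree. *)
Lemma beta_act (k : int) p r c : weight k r -> hom k 0 c -> tfree p c ->
  B beta (r * c) = r * s * jd c.
Proof.
move=> wr hc [pc sc tc]; have [pr tr br _] := wr; rewrite (jd_nu1 hc pc) betaE.
have p_N : par true (nu1 - E * pt).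
  by apply: (sp_parD SP) => //; apply: (sp_parN SP); exact: (sp_parM SP p_E p_pt).
have Ec : B E c = 0 by apply: (hom_br0 h_E hc); rewrite orbT.
have [_ s_nu1 _] := t_nu1; have [_ s_E _] := t_E.
have p_sN := sp_parM SP p_s p_N.
rewrite (leib_e _ p_sN pr).
have -> : B (s * (nu1 - E * pt)) r = s * r * E *~ (k - 1).
  rewrite (leibl_d p_s p_N pr) (weight_s0 wr) mul0r addr0 (sp_addl SP) (sp_oppl SP).
  rewrite (weight_r0 wr p_nu1 s_nu1) (leibl_d p_E p_pt pr) (weight_r0 wr p_E s_E) tr.
  by rewrite mul0r addr0 sub0r mulrzAr -mulrNz opprB -(comm_e pr p_E) mulrzAr mulrA.
have -> : B (s * (nu1 - E * pt)) c = s * B nu1 c.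
  rewrite (sp_leibl SP p_s p_N pc) sc (sp_addl SP) (sp_oppl SP) (sp_leibl SP p_E p_pt pc) tc Ec.
  by rewrite !mul0r !sg0 mulr0 addr0 ?oppr0 ?addr0 ?oppr0 ?addr0.
rewrite mulrzAl mulrDr mulrzAr (comm_e p_s pr) addrC !mulrA.
by congr (_ + _); rewrite -!mulrA.
Qed.

(** The derivatives of r1 and r2 along t give the two terms of [jbr_mu] which depend
    on the degrees. *)
Lemma bracket_act (k l : int) p q r1 r2 a b : weight k r1 -> weight l r2 ->
  hom k 0 a -> hom l 0 b -> tfree p a -> tfree q b ->
  B (B (r1 * a) mu0) (r2 * b) = r1 * r2 * jbr a b.
Proof.
move=> w1 w2 ha hb [pa sa ta] [pb sb tb]; rewrite (jbr_mu ha hb pa pb).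
have [p1 t1 b1 _] := w1; have [p2 t2 b2 _] := w2.
have a_pt : B a pt = 0 by rewrite -[LHS]opprK -(anti_e p_pt pa) ta oppr0.
have b_pt : B b pt = 0 by rewrite -[LHS]opprK -(anti_e p_pt pb) tb oppr0.
have p_u : par (~~ p) (B a phi) by rewrite -addbT; exact: (sp_parB SP pa p_phi).
have p_amu : par (~~ p) (B a mu) by rewrite -addbT; exact: (sp_parB SP pa p_mu).
have p_af : par (~~ p) (a * phi) by rewrite -addbT; exact: (sp_parM SP pa p_phi).
have ab0 : B a b = 0 by apply: (hom_br0 ha hb); rewrite orbT.
have ub0 : B (B a phi) b = 0.
  by apply: (hom_br0 (bp_homB BP ha h_phi) hb); rewrite orbT.
have p_X : par (~~ p) (B a mu + B a phi * pt + a * phi *~ (k - 1)).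
  apply: (sp_parD SP); first apply: (sp_parD SP) => //.
    by rewrite -[~~ p]addbF; exact: (sp_parM SP).
  exact: par_mulrz.
have -> : B (r1 * a) mu0 = r1 * (B a mu + B a phi * pt + a * phi *~ (k - 1)).
  rewrite (sp_leibl SP p1 pa p_mu0).
  have -> : B a mu0 = B a mu + B a phi * pt.
    rewrite /mu0 (sp_addr SP) (sp_leib SP _ pa p_phi) a_pt mulr0.
    by rewrite /sg oppr0; case: ifP; rewrite addr0.
  have -> : B r1 mu0 = phi * r1 *~ (k - 1).
    rewrite /mu0 (sp_addr SP) (b1 _ _ p_mu s_mu) (leib_d _ p1 p_phi) (b1 _ _ p_phi s_phi).
    by rewrite (anti_e p1 p_pt) t1 mul0r !add0r -mulrNz opprB mulrzAr.
  rewrite [RHS]mulrDr; congr (_ + _); rewrite mulrzAr mulrzAl andbT.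
  rewrite [a * phi](sp_comm SP pa p_phi) andbT -(comm_e p1 p_phi) -mulrA.
  by case: p {pa p_u p_amu p_af p_X}; rewrite /sg ?mulrN // mulNrz.
have Xr : B (B a mu + B a phi * pt + a * phi *~ (k - 1)) r2 = B a phi * r2 *~ (1 - l).
  rewrite !(sp_addl SP).
  have s_u : B s (B a phi) = 0.
    by rewrite (bp_jacobi BP p_s pa p_phi) sa s_phi (sp_0l SP) (sp_0r SP) /sg /= addr0.
  have s_amu : B s (B a mu) = 0.
    by rewrite (bp_jacobi BP p_s pa p_mu) sa s_mu (sp_0l SP) (sp_0r SP) /sg /= addr0.
  have s_af : B s (a * phi) = 0 by rewrite (leib_d _ p_s pa) sa s_phi mulr0 mul0r addr0.
  rewrite (weight_r0 w2 p_amu s_amu) (leibl_d p_u p_pt p2) (weight_r0 w2 p_u s_u) t2.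
  rewrite mul0r addr0 add0r mulrzAr B_mulrzl (weight_r0 w2 p_af s_af) mul0rz addr0.
  by [].
set X := _ + _ in p_X Xr *.
have Xb : B X b = B (B a mu) b + (a * B phi b) *~ (k - 1).
  rewrite /X !(sp_addl SP) B_mulrzl (sp_leibl SP p_u p_pt pb) tb ub0 mulr0 mul0r sg0.
  by rewrite (sp_leibl SP pa p_phi pb) ab0 mul0r sg0 !addr0.
have p_r2b : par q (r2 * b) by rewrite -[q]addFb; exact: (sp_parM SP).
rewrite (sp_leibl SP p1 p_X p_r2b).
have -> : B r1 (r2 * b) = 0.
  by rewrite (leib_d _ p1 p2) (b1 _ _ pb sb) (b1 _ _ p2 (weight_s0 w2)) mul0r mulr0 addr0.
rewrite mul0r /sg oppr0 if_same addr0 (leib_e _ p_X p2) Xr Xb.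
have ur2b : B a phi * r2 * b = r2 * (B a phi * b).
  by rewrite -(comm_e p2 p_u) mulrA.
rewrite mulrzAl ur2b -mulrA -(opprB l 1) mulrNz.
rewrite -mulrzAr -mulrN -mulrDr; congr (_ * _); congr (_ * _).
by rewrite [LHS]addrC.
Qed.

Lemma cancel_weight r x : (exists r', r' * r = 1) -> r * x = 0 -> x = 0.
Proof. by move=> [r' rr] rx; rewrite -[x]mul1r -rr -mulrA rx mulr0. Qed.

Lemma tfree_jd_weight (k : int) p c r : weight k r -> tfree p c -> par p (r * c).
Proof. by move=> [pr _ _ _] [pc _ _]; rewrite -[p]addFb; exact: (sp_parM SP). Qed.

(** Multiplied by an invertible factor, the square of the differential is
    {beta, {beta, r c}}, which vanishes since {beta, beta} = 0. *)
Theorem jd_jd (k : nat) p c : hom k%:Z 0 c -> tfree p c -> jd (jd c) = 0.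
Proof.
move=> hc tc; have [r wr] := weight_ex k.
have p_be : par true beta := bp_par BP h_beta.
have [_ bb] := mu0_beta.
have pc := tfree_jd_weight wr tc.
have := bp_jacobi BP p_be p_be pc; rewrite /jacobi_id bb (sp_0l SP) add0r /sg /= => E2.
have {}E2 : B beta (B beta (r * c)) = 0 by apply: (bp_tf BP); rewrite {1}E2 addNr.
have wrs : weight (k%:Z + 1) (r * s).
  have -> : k%:Z + 1 = k%:Z + 2 - 1 by ring.
  exact: weight_M wr weight_s.
move: E2; rewrite (beta_act wr hc tc) (beta_act wrs (hom_jd hc) (tfree_jd tc)).
apply: cancel_weight; have [_ _ _ inv] := weight_M wrs weight_s; exact: inv.
Qed.

(** Multiplied by an invertible factor, the compatibility is the Jacobi identity for
    beta, {r1 a, mu0} and r2 b, as beta commutes with mu0. *)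
Theorem jd_jbr (k l : nat) p q a b :
  hom k%:Z 0 a -> hom l%:Z 0 b -> tfree p a -> tfree q b ->
  jd (jbr a b) = jbr (jd a) b + sg (~~ p) (jbr a (jd b)).
Proof.
move=> ha hb ta tb; have [r1 w1] := weight_ex k; have [r2 w2] := weight_ex l.
have p_be : par true beta := bp_par BP h_beta.
have [mb bb] := mu0_beta.
have pA := tfree_jd_weight w1 ta; have pB := tfree_jd_weight w2 tb.
have wS (z : int) r : weight z r -> weight (z + 1) (r * s).
  move=> w; have -> : z + 1 = z + 2 - 1 by ring.
  exact: weight_M w weight_s.
have EU : B beta (B (r1 * a) mu0) = B (B beta (r1 * a)) mu0.
  by rewrite (bp_jacobi BP p_be pA p_mu0) [B beta mu0](anti_o p_be p_mu0) mb (sp_0r SP) sg0 addr0.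
have := bp_jacobi BP p_be (sp_parB SP pA p_mu0) pB.
rewrite /jacobi_id EU (bracket_act w1 w2 ha hb ta tb).
rewrite (beta_act (weight_M w1 w2) (hom_jbr ha hb) (tfree_jbr ta tb)).
rewrite (beta_act w1 ha ta) (beta_act w2 hb tb).
rewrite (bracket_act (wS _ _ w1) w2 (hom_jd ha) hb (tfree_jd ta) tb).
rewrite (bracket_act w1 (wS _ _ w2) ha (hom_jd hb) ta (tfree_jd tb)) addbT /=.
have [p1 _ _ i1] := w1; have [p2 _ _ i2] := w2.
have -> : r1 * s * r2 = r1 * r2 * s by rewrite -!mulrA (comm_e p_s p2).
have -> : r1 * (r2 * s) = r1 * r2 * s by rewrite mulrA.
move=> E3; apply/eqP; rewrite -subr_eq0; apply/eqP.
have [_ _ _ inv] := wS _ _ (weight_M w1 w2); apply: (cancel_weight inv).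
rewrite [LHS]mulrBr [X in _ - X]mulrDr E3; case: (~~ p); rewrite /sg ?mulrN; exact: subrr.
Qed.

End Poissonization.
End Calculus.

Section BracketMorphism.
Variables (K K' : nzRingType) (B : K -> K -> K) (B' : K' -> K' -> K') (J : K -> K').
Hypotheses (J_D : forall x y, J (x + y) = J x + J y) (J_N : forall x, J (- x) = - J x).
Hypotheses (J_M : forall x y, J (x * y) = J x * J y) (J_B : forall x y, J (B x y) = B' (J x) (J y)).

Lemma morph_nu mu phi eps pi E idB : J (nu B mu phi eps pi E idB) =
  nu B' (J mu) (J phi) (J eps) (J pi) (J E) (J idB).
Proof. by rewrite /nu !(J_D, J_N, J_M, J_B). Qed.

Lemma morph_jd mu phi eps pi E idB c : J (jd B mu phi eps pi E idB c) =
  jd B' (J mu) (J phi) (J eps) (J pi) (J E) (J idB) (J c).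
Proof. by rewrite /jd /nu !(J_D, J_N, J_M, J_B). Qed.

Lemma morph_jbr I mu phi a b : J (jbr B I mu phi a b) = jbr B' (J I) (J mu) (J phi) (J a) (J b).
Proof. by rewrite /jbr !(J_D, J_N, J_M, J_B). Qed.
End BracketMorphism.

Section BracketAdditive.
Variables (K : nzRingType) (B : K -> K -> K).
Hypotheses (B_addr : forall x y z, B x (y + z) = B x y + B x z).

Lemma jd_add mu phi eps pi E idB c c' : jd B mu phi eps pi E idB (c + c') =
  jd B mu phi eps pi E idB c + jd B mu phi eps pi E idB c'.
Proof. by rewrite /jd B_addr mulrDr addrACA. Qed.

Lemma jbr_add I mu phi a b b' : jbr B I mu phi a (b + b') = jbr B I mu phi a b + jbr B I mu phi a b'.
Proof.
rewrite /jbr; move: (mu + I * phi) => m; rewrite !B_addr !mulrDr.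
move: (B (B a m) b) (B (B a m) b') (a * _) (a * _) (B a phi * b) (B a phi * b') => u u' v v' w w'.
by rewrite opprD [u + u' + _]addrACA [LHS]addrACA.
Qed.
End BracketAdditive.

(** * Changes of coordinates *)

(** Mutually inverse matrices of central elements define the same contraction of X
    with T; this makes the identity of A independent of the frame. *)
Lemma dual_frames (S : nzRingType) (d : nat) (H Q : 'I_d -> 'I_d -> S) (X T : 'I_d -> S) :
  (forall a b y, Q a b * y = y * Q a b) ->
  (forall c b, \sum_a Q a b * H c a = (c == b)%:R) ->
  \sum_b X b * T b = \sum_a (\sum_b Q a b * X b) * (\sum_c H c a * T c).
Proof.
move=> Qc HQ; transitivity (\sum_a \sum_b \sum_c X b * ((Q a b * H c a) * T c)); last first.
  apply: eq_bigr => a _; rewrite mulr_suml; apply: eq_bigr => b _; rewrite mulr_sumr.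
  by apply: eq_bigr => c _; rewrite (Qc _ _ (X b)) !mulrA.
rewrite exchange_big; apply: eq_bigr => b _; rewrite exchange_big /= (bigD1 b) //=.
rewrite -mulr_sumr -mulr_suml HQ eqxx mul1r big1 ?addr0 // => c /negPf cb.
by rewrite -mulr_sumr -mulr_suml HQ cb mul0r mulr0.
Qed.

Section ChangePoisson.
Variables (C C' : comNzRingType) (n d : nat).
Variables (D : 'I_n -> C -> C) (D' : 'I_n -> C' -> C').
Hypothesis DD' : forall k f g, D' k (f + g) = D' k f + D' k g.
Hypothesis DM' : forall k f g, D' k (f * g) = D' k f * g + f * D' k g.
Variables (th : {rmorphism C -> C'}) (X : 'I_n -> C) (h : 'I_d -> 'I_d -> C) (q : 'I_d -> 'I_d -> C').
Hypothesis chain : forall k f, th (D k f) = \sum_l th (D k (X l)) * D' l (th f).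
Hypothesis hq : forall a b, \sum_c q a c * th (h c b) = (a == b)%:R.
Local Notation SF' := (mpoly n (exterior C' (d + d))).
Local Notation gf := (gf n d).
Local Notation go := (go C' n).
Local Notation gx := (gx C' d).
Local Notation br := (gbr D').
Let SP := gbr_super_poisson d DD' DM'.

(** The change of coordinates over abstract rings of functions: th is the
    composition with the change of base coordinates, X are these coordinates, and
    h and q are the cocycle and its inverse. *)
Definition chg_xi a : SF' := \sum_b gf (q a b) * go (lshift d b).
Definition chg_theta a : SF' := \sum_b gf (th (h b a)) * go (rshift d b).
Definition chg_odd c : SF' :=
  match fintype.split c with inl a => chg_xi a | inr a => chg_theta a end.
Definition chg_p k : SF' := \sum_l gf (th (D k (X l))) * gx l +
  \sum_a \sum_b gf (th (D k (h b a))) * (chg_xi a * go (rshift d b)).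

Lemma chg_gid : (forall a b, \sum_c th (h a c) * q c b = (a == b)%:R) ->
  gid C' n d = \sum_a chg_xi a * chg_theta a.
Proof.
move=> hq'.
apply: (@dual_frames _ d (fun c a => gf (th (h c a))) (fun a b => gf (q a b))
  (fun b => go (lshift d b)) (fun c => go (rshift d c))) => [a b y|c b].
  by rewrite gf_comm.
transitivity (gf (\sum_a th (h c a) * q a b)); last first.
  by rewrite hq'; case: (c == b); rewrite ?gf1 ?gf0.
rewrite (big_morph gf (@gfD C' n d) (gf0 C' n d)); apply: eq_bigr => a _.
by rewrite mulrC gfM.
Qed.

Lemma spar_gf_go (b : bool) x (F : SF') : spar b F -> spar b (gf x * F).
Proof. by move=> pF; rewrite -[b]addFb; apply: sparM => //; exact: spar_gf. Qed.

Lemma spar_chg_xi a : spar true (chg_xi a).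
Proof. by apply: spar_sum => b; apply: spar_gf_go; exact: spar_go. Qed.

Lemma spar_chg_theta a : spar true (chg_theta a).
Proof. by apply: spar_sum => b; apply: spar_gf_go; exact: spar_go. Qed.

Lemma spar_chg_odd c : spar true (chg_odd c).
Proof.
by rewrite /chg_odd; case: fintype.split => a; [exact: spar_chg_xi|exact: spar_chg_theta].
Qed.

Lemma spar_chg_p k : spar false (chg_p k).
Proof.
apply: sparD; apply: spar_sum => l; first by apply: spar_gf_go; exact: spar_gx.
apply: spar_sum => b; apply: spar_gf_go; rewrite -(addbb true).
by apply: sparM; [exact: spar_chg_xi|exact: spar_go].
Qed.

Lemma br_suml (I : finType) (F : I -> SF') G : br (\sum_i F i) G = \sum_i br (F i) G.
Proof.
elim/big_rec2: _ => [|i x y _ <-]; first exact: (sp_0l SP).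
exact: (sp_addl SP).
Qed.

Lemma br_sumr (I : finType) (F : I -> SF') G : br G (\sum_i F i) = \sum_i br G (F i).
Proof.
elim/big_rec2: _ => [|i x y _ <-]; first exact: (sp_0r SP).
exact: (sp_addr SP).
Qed.

Lemma br_gfl (b b' : bool) x (F G : SF') : spar b F -> spar b' G ->
  br (gf x * F) G = gf x * br F G + sg (b && b') (br (gf x) G * F).
Proof. by move=> pF pG; exact: (sp_leibl SP (@spar_gf C' n d x) pF pG). Qed.

Lemma br_gfr (b : bool) x (F G : SF') : spar b G ->
  br G (gf x * F) = br G (gf x) * F + gf x * br G F.
Proof. by move=> pG; rewrite (sp_leib SP _ pG (@spar_gf C' n d x)) andbF. Qed.

Lemma br_gf_gf x y : br (gf x) (gf y) = 0.
Proof. by rewrite (gbr_gval DD' DM' (Gf n d x) (Gf n d y)) gf0. Qed.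
Lemma br_gf_go x c : br (gf x) (go c) = 0.
Proof. by rewrite (gbr_gval DD' DM' (Gf n d x) (Go C' n c)) gf0. Qed.
Lemma br_go_gf x c : br (go c) (gf x) = 0.
Proof. by rewrite (gbr_gval DD' DM' (Go C' n c) (Gf n d x)) gf0. Qed.
Lemma br_gx_gf x k : br (gx k) (gf x) = gf (D' k x).
Proof. by rewrite (gbr_gval DD' DM' (Gx C' d k) (Gf n d x)). Qed.
Lemma br_gx_go c k : br (gx k) (go c) = 0.
Proof. by rewrite (gbr_gval DD' DM' (Gx C' d k) (Go C' n c)) gf0. Qed.

Lemma br_xi_theta a b : br (go (lshift d a)) (go (rshift d b)) = if a == b then 1 else 0.
Proof.
rewrite (gbr_gval DD' DM' (Go C' n _) (Go C' n _)) /= /conj_ix.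
rewrite (unsplitK (inl _ a : 'I_d + 'I_d)) (inj_eq (@rshift_inj _ _)) eq_sym.
by case: (a == b); rewrite ?gf1 ?gf0.
Qed.

Lemma br_theta_theta a b : br (go (rshift d a)) (go (rshift d b)) = 0.
Proof.
rewrite (gbr_gval DD' DM' (Go C' n _) (Go C' n _)) /= /conj_ix.
by rewrite (unsplitK (inr _ a : 'I_d + 'I_d)) eq_rlshift gf0.
Qed.

Lemma br_chg_odd_gf c x : br (chg_odd c) (gf x) = 0.
Proof.
rewrite /chg_odd; case: fintype.split => a; rewrite br_suml big1 // => b _;
  by rewrite (br_gfl _ (@spar_go C' n d _) (@spar_gf C' n d x)) br_go_gf br_gf_gf mulr0 mul0r addr0.
Qed.

Lemma br_chg_p_gf k f : br (chg_p k) (gf (th f)) = gf (th (D k f)).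
Proof.
have pf := @spar_gf C' n d (th f).
rewrite /chg_p (sp_addl SP) !br_suml [X in _ + X]big1 ?addr0 => [|a _].
  rewrite chain [RHS](big_morph gf (@gfD C' n d) (gf0 C' n d)); apply: eq_bigr => l _.
  by rewrite (br_gfl _ (@spar_gx C' n d l) pf) br_gx_gf br_gf_gf mul0r addr0 gfM.
rewrite br_suml big1 // => b _.
have pxt : spar false (chg_xi a * go (rshift d b)).
  by rewrite -(addbb true); apply: sparM; [exact: spar_chg_xi|exact: spar_go].
rewrite (br_gfl _ pxt pf) br_gf_gf mul0r addr0.
rewrite (sp_leibl SP (@spar_chg_xi a) (@spar_go C' n d _) pf) br_go_gf.
have := br_chg_odd_gf (lshift d a) (th f).
by rewrite /chg_odd (unsplitK (inl _ a : 'I_d + 'I_d)) => ->; rewrite mul0r mulr0 addr0 mulr0.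
Qed.

Lemma br_chg_xi_theta a b : br (chg_xi a) (go (rshift d b)) = gf (q a b).
Proof.
rewrite br_suml (bigD1 b) //= big1 ?addr0 => [|c cb];
  rewrite (br_gfl _ (@spar_go C' n d _) (@spar_go C' n d _)) br_gf_go br_xi_theta mul0r /sg oppr0 addr0.
  by rewrite eqxx mulr1.
by rewrite (negPf cb) mulr0.
Qed.

Lemma br_chg_theta_theta a b : br (chg_theta a) (go (rshift d b)) = 0.
Proof.
rewrite br_suml big1 // => c _.
rewrite (br_gfl _ (@spar_go C' n d _) (@spar_go C' n d _)) br_gf_go br_theta_theta.
by rewrite mul0r mulr0 /sg oppr0 addr0.
Qed.

Lemma br_chg_thetar (b : bool) F a : spar b F -> br F (chg_theta a) =
  \sum_c (br F (gf (th (h c a))) * go (rshift d c) + gf (th (h c a)) * br F (go (rshift d c))).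
Proof. by move=> pF; rewrite br_sumr; apply: eq_bigr => c _; exact: (br_gfr _ _ pF). Qed.

(** The mixed term of the new momenta is there to make them commute with the new
    theta: it compensates the derivative of the cocycle. *)
Lemma br_chg_p_theta k a : br (chg_p k) (chg_theta a) = 0.
Proof.
have E b : br (chg_p k) (go (rshift d b)) =
    - \sum_a' \sum_b' gf (th (D k (h b' a'))) * (gf (q a' b) * go (rshift d b')).
  have pb := @spar_go C' n d (rshift d b).
  rewrite /chg_p (sp_addl SP) !br_suml big1 ?add0r => [|l _]; last first.
    by rewrite (br_gfl _ (@spar_gx C' n d l) pb) br_gx_go br_gf_go mul0r mulr0 addr0.
  rewrite -sumrN; apply: eq_bigr => a' _; rewrite br_suml -sumrN; apply: eq_bigr => b' _.
  have pxt : spar false (chg_xi a' * go (rshift d b')).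
    by rewrite -(addbb true); apply: sparM; [exact: spar_chg_xi|exact: spar_go].
  rewrite (br_gfl _ pxt pb) br_gf_go mul0r addr0 -mulrN; congr (_ * _).
  rewrite (sp_leibl SP (@spar_chg_xi a') (@spar_go C' n d _) pb) br_theta_theta mulr0 add0r.
  by rewrite br_chg_xi_theta.
rewrite (br_chg_thetar _ (@spar_chg_p k)) big_split /=.
under [X in X + _]eq_bigr => c _ do rewrite br_chg_p_gf.
under [X in _ + X]eq_bigr => c _ do rewrite E mulrN mulr_sumr.
rewrite sumrN [X in _ - X](_ : _ = \sum_b gf (th (D k (h b a))) * go (rshift d b)) ?subrr //.
have T a' : \sum_c gf (th (h c a)) * (\sum_b' gf (th (D k (h b' a'))) * (gf (q a' c) * go (rshift d b')))
    = if a' == a then \sum_b gf (th (D k (h b a))) * go (rshift d b) else 0.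
  under eq_bigr => c _ do rewrite mulr_sumr.
  transitivity (\sum_b gf (th (D k (h b a'))) * gf (\sum_c q a' c * th (h c a)) * go (rshift d b)).
    rewrite exchange_big; apply: eq_bigr => b _.
    rewrite (big_morph gf (@gfD C' n d) (gf0 C' n d)) mulr_sumr mulr_suml; apply: eq_bigr => c _.
    by rewrite gfM !mulrA -!gfM; congr (gf _ * _); ring.
  rewrite hq; case: eqP => [->|_].
    by apply: eq_bigr => b _; rewrite gf1 mulr1.
  by rewrite big1 // => b _; rewrite gf0 mulr0 mul0r.
by rewrite exchange_big (bigD1 a) //= T eqxx [X in _ + X]big1 ?addr0 // => a' /negPf a'a; rewrite T a'a.
Qed.

Hypothesis tf : forall x : C', x + x = 0 -> x = 0.
Definition chg : mpoly n (exterior C (d + d)) -> SF' := ssub th chg_odd chg_p.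

Lemma chg_odd_sq c : chg_odd c * chg_odd c = 0.
Proof. by apply: odd_sq => //; exact: spar_chg_odd. Qed.

Hypothesis DD : forall k f g, D k (f + g) = D k f + D k g.
Hypothesis DM : forall k f g, D k (f * g) = D k f * g + f * D k g.

(** By [ssub_br_theta] the brackets of the new coordinates with the functions and
    the new theta suffice, and these do not involve the brackets of the new
    momenta with each other. *)
Lemma chg_br (pr : bool) k (F G : mpoly n (exterior C (d + d))) : spar pr F -> bihom k 0%N G ->
  chg (gbr D F G) = br (chg F) (chg G).
Proof.
have So := spar_chg_odd; have Sp := spar_chg_p; have Sq := chg_odd_sq.
apply: ssub_br_theta => // [[x|c|l] y|[x|c|l] a] /=.
- by rewrite ssub_gf // br_gf_gf rmorph0 gf0.
- by rewrite ssub_go // br_chg_odd_gf rmorph0 gf0.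
- by rewrite ssub_gx // br_chg_p_gf.
- rewrite ssub_gf // /chg_odd (unsplitK (inr _ a : 'I_d + 'I_d)) rmorph0 gf0.
  rewrite (br_chg_thetar _ (@spar_gf C' n d (th x))) big1 // => b _.
  by rewrite br_gf_gf br_gf_go mul0r mulr0 addr0.
- rewrite ssub_go // [X in br _ X]/chg_odd (unsplitK (inr _ a : 'I_d + 'I_d)).
  rewrite (br_chg_thetar _ (@spar_chg_odd c)).
  under eq_bigr => b _ do rewrite br_chg_odd_gf mul0r add0r.
  rewrite /conj_ix /chg_odd; case: (fintype.split c) => a'.
    rewrite (inj_eq (@rshift_inj _ _)) rmorph_nat eq_sym -hq.
    rewrite (big_morph gf (@gfD C' n d) (gf0 C' n d)); apply: eq_bigr => b _.
    by rewrite br_chg_xi_theta -gfM mulrC.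
  rewrite eq_rlshift rmorph0 gf0 big1 // => b _.
  by rewrite br_chg_theta_theta mulr0.
by rewrite ssub_gx // /chg_odd (unsplitK (inr _ a : 'I_d + 'I_d)) br_chg_p_theta rmorph0 gf0.
Qed.

End ChangePoisson.

(** * Inclusions of generators *)
Section ParitySplit.
Variables (C : comNzRingType) (n d : nat).
Local Notation SF := (mpoly n (exterior C (d + d))).

(** Bracket identities known for elements with a parity extend to all elements by
    biadditivity. *)
Lemma spar_split (F : SF) : exists F0 F1, [/\ F = F0 + F1, spar false F0 & spar true F1].
Proof.
rewrite [F]sf_expand.
pose P (F : SF) := exists F0 F1, [/\ F = F0 + F1, spar false F0 & spar true F1].
have P0 : P 0 by exists 0, 0; rewrite addr0; split=> //; exact: spar0.
have PD F1 F2 : P F1 -> P F2 -> P (F1 + F2).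
  move=> [G0 [G1 [-> p0 p1]]] [H0 [H1 [-> q0 q1]]]; exists (G0 + H0), (G1 + H1).
  by rewrite addrACA; split=> //; exact: sparD.
elim/big_ind: _ => // w _; elim/big_ind: _ => // S _.
have H : spar (odd (tdeg w S + xdeg w S))
    (gf n d (mcoeff w F S) * mpolyC n (eprod (@egen C (d + d)) S) * mpolyX _ w).
  apply: (mono_ind (P := fun k l => spar (odd (k + l)))) => [k l k' l' G1 G2 p1 p2|f|a|a|k].
  - by rewrite addnACA oddD; exact: sparM.
  - exact: spar_gf.
  - exact: spar_go.
  - exact: spar_go.
  exact: spar_gx.
case: (odd _) H => H; [exists 0; eexists|eexists; exists 0]; rewrite ?add0r ?addr0;
  by split; [exact: erefl|by [exact: spar0|exact: H]..].
Qed.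
End ParitySplit.

Section OddIndex.
Variables (d d' : nat) (r : 'I_d -> 'I_d').
Definition odd_ix (c : 'I_(d + d)) : 'I_(d' + d') :=
  match fintype.split c with inl a => lshift d' (r a) | inr a => rshift d' (r a) end.

Lemma odd_ix_l a : odd_ix (lshift d a) = lshift d' (r a).
Proof. by rewrite /odd_ix (unsplitK (inl _ a)). Qed.

Lemma odd_ix_r a : odd_ix (rshift d a) = rshift d' (r a).
Proof. by rewrite /odd_ix (unsplitK (inr _ a)). Qed.

Lemma odd_ix_conj c : odd_ix (conj_ix c) = conj_ix (odd_ix c).
Proof.
rewrite /conj_ix; case: (split_ordP c) => a ->.
  by rewrite odd_ix_l odd_ix_r (unsplitK (inl _ (r a))).
by rewrite odd_ix_l odd_ix_r (unsplitK (inr _ (r a))).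
Qed.

Lemma odd_ix_inj : injective r -> injective odd_ix.
Proof.
move=> ri c c'; case: (split_ordP c) => a ->; case: (split_ordP c') => b ->;
  rewrite ?odd_ix_l ?odd_ix_r.
- by move/lshift_inj/ri ->.
- by move/eqP; rewrite eq_lrshift.
- by move/eqP; rewrite eq_rlshift.
by move/rshift_inj/ri ->.
Qed.

Lemma odd_ix_mono : (forall a b : 'I_d, (a < b)%N -> (r a < r b)%N) ->
  forall c c' : 'I_(d + d), (c < c')%N -> (odd_ix c < odd_ix c')%N.
Proof.
move=> rm c c'; case: (split_ordP c) => a ->; case: (split_ordP c') => b ->;
  rewrite ?odd_ix_l ?odd_ix_r /=.
- exact: rm.
- by move=> _; apply: leq_trans (ltn_ord (r a)) _; rewrite leq_addr.
- by rewrite ltnNge (leq_trans (ltnW (ltn_ord b))) ?leq_addr.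
by rewrite !ltn_add2l; exact: rm.
Qed.
End OddIndex.

Section IncreasingMap.
Variables (C C' : comNzRingType) (m m' n' : nat) (f : {rmorphism C -> C'}).
Variable h : 'I_m -> 'I_m'.
Hypothesis h_mono : forall a b : 'I_m, (a < b)%N -> (h a < h b)%N.

Lemma mono_inj : injective h.
Proof.
move=> a b hab; apply: val_inj.
by case: (ltngtP a b) => // /h_mono; rewrite hab ltnn.
Qed.

Lemma eincl_expand (u : exterior C m) :
  emap f (eincl h u) = \sum_S escal m' (f (u S)) * eprod (@egen C' m') [set h a | a in S].
Proof.
apply/ffunP => T; rewrite !ffunE sum_ffunE.
have E S : (escal m' (f (u S)) * eprod (@egen C' m') [set h a | a in S]) T
    = if T == [set h a | a in S] then f (u S) else 0.
  by rewrite escal_mulE eprod_egenE; case: (_ == _); rewrite ?mulr1 ?mulr0.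
under eq_bigr => S _ do rewrite E.
case: ifP => [/subsetP TI|/negP TI]; last first.
  rewrite rmorph0 big1 // => S _; case: eqP => // TE; case: TI.
  by rewrite TE; apply: imsetS; apply/fintype.subsetP => x; rewrite inE.
have TE : T = [set h a | a in h @^-1: T].
  apply/setP => x; apply/idP/imsetP => [xT|[a]]; last by rewrite inE => ? ->.
  by have /imsetP[a _ xE] := TI x xT; exists a; rewrite // inE -xE.
rewrite (bigD1 (h @^-1: T)) //= -TE eqxx big1 ?addr0 // => S /eqP nS.
case: eqP => // TS; case: nS; rewrite TS; apply/setP => a; rewrite inE.
by rewrite mem_imset //; exact: mono_inj.
Qed.

(** An increasing injection of the odd generators respects the order in the
    monomials, so that no sign appears in the coefficients. *)
Lemma esub_mono_incl (u : exterior C m) :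
  esub ((@mpolyC n' _ \o (@escal C' m' \o f)) : {rmorphism C -> _})
    (fun c => mpolyC n' (egen C' (h c))) u = mpolyC n' (emap f (eincl h u)).
Proof.
rewrite eincl_expand raddf_sum; apply: eq_bigr => S _.
rewrite [RHS]rmorphM; congr (_ * _).
by rewrite /eprod enum_imset_mono // big_map rmorph_prod.
Qed.
End IncreasingMap.

Section GenIncl.
Variables (C C' : comNzRingType) (n d n' d' : nat).
Variables (th : {rmorphism C -> C'}) (r : 'I_d -> 'I_d') (s : 'I_n -> 'I_n').
Local Notation SF := (mpoly n (exterior C (d + d))).
Local Notation SF' := (mpoly n' (exterior C' (d' + d'))).

(** The common form of the inclusions of F_B in F_A and of F_A in F_(p^*A): the
    generators are sent to generators. *)
Definition gincl : SF -> SF' :=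
  ssub th (fun c => go C' n' (odd_ix r c)) (fun k => gx C' d' (s k)).

Let e_odd c : spar true (go C' n' (odd_ix r c)). Proof. exact: spar_go. Qed.
Let e_sq c : go C' n' (odd_ix r c) * go C' n' (odd_ix r c) = 0. Proof. exact: go_sq. Qed.
Let p_even k : spar false (gx C' d' (s k)). Proof. exact: spar_gx. Qed.

Definition gen_incl (g : gen C n d) : gen C' n' d' :=
  match g with
  | Gf f => Gf n' d' (th f)
  | Go c => Go C' n' (odd_ix r c)
  | Gx k => Gx C' d' (s k)
  end.

Lemma gincl_gval g : gincl (gval g) = gval (gen_incl g).
Proof.
by case: g => [f|c|k] /=; [exact: ssub_gf|exact: (ssub_go th)|exact: (ssub_gx th)].
Qed.

Lemma ginclD F G : gincl (F + G) = gincl F + gincl G.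
Proof. exact: ssubD. Qed.
Lemma gincl0 : gincl 0 = 0.
Proof. exact: (ssub0 th _ e_odd e_sq). Qed.
Lemma ginclN F : gincl (- F) = - gincl F.
Proof. exact: ssubN. Qed.
Lemma ginclM F G : gincl (F * G) = gincl F * gincl G.
Proof. exact: ssubM. Qed.

Lemma spar_gincl b F : spar b F -> spar b (gincl F).
Proof. exact: spar_ssub. Qed.

Lemma bihom_gincl k l F : bihom k l F -> bihom k l (gincl F).
Proof.
apply: (bihom_ssub e_odd e_sq p_even) => a.
- by rewrite odd_ix_l; exact: bihom_xi.
- by rewrite odd_ix_r; exact: bihom_theta.
exact: bihom_gx.
Qed.

Lemma gincl_gid :
  gincl (gid C n d) = \sum_a go C' n' (lshift d' (r a)) * go C' n' (rshift d' (r a)).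
Proof.
apply: etrans (big_morph gincl ginclD gincl0 _ _ _) _; apply: eq_bigr => a _.
rewrite ginclM (gincl_gval (Go C n (lshift d a))) (gincl_gval (Go C n (rshift d a))) /=.
by rewrite odd_ix_l odd_ix_r.
Qed.

Lemma ginclE F : (forall a b : 'I_d, (a < b)%N -> (r a < r b)%N) ->
  gincl F = mmap (fun u => mpolyC n' (emap th (eincl (odd_ix r) u))) (fun k => gx C' d' (s k)) F.
Proof.
move=> rm; rewrite /gincl ssubE /mmap; apply: eq_bigr => w _; congr (_ * _).
exact: (@esub_mono_incl C C' _ _ n' th _ (odd_ix_mono rm)).
Qed.

Variables (D : 'I_n -> C -> C) (D' : 'I_n' -> C' -> C').
Hypothesis DD : forall k f g, D k (f + g) = D k f + D k g.
Hypothesis DM : forall k f g, D k (f * g) = D k f * g + f * D k g.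
Hypothesis DD' : forall k f g, D' k (f + g) = D' k f + D' k g.
Hypothesis DM' : forall k f g, D' k (f * g) = D' k f * g + f * D' k g.
Hypothesis thD : forall k f, D' (s k) (th f) = th (D k f).
Hypothesis r_inj : injective r.

(** The tables of brackets of the generators agree. *)
Lemma gincl_br F G : gincl (gbr D F G) = gbr D' (gincl F) (gincl G).
Proof.
have H b b' F' G' : spar b F' -> spar b' G' -> gincl (gbr D F' G') = gbr D' (gincl F') (gincl G').
  apply: (ssub_br e_odd e_sq p_even DD DM DD' DM') => g h.
  rewrite -/gincl 2!gincl_gval (gbr_gval DD' DM'); congr gf.
  case: g h => [f|c|k] [g|c'|k'] //=; rewrite ?rmorph0 ?rmorphN ?thD //.
  by rewrite -odd_ix_conj (inj_eq (odd_ix_inj r_inj)) rmorph_nat.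
have [F0 [F1 [-> p0 p1]]] := spar_split F; have [G0 [G1 [-> q0 q1]]] := spar_split G.
rewrite (gbr_addl DD) 2!(gbr_addr DD) !ginclD (gbr_addl DD') 2!(gbr_addr DD').
by rewrite (H _ _ _ _ p0 q0) (H _ _ _ _ p0 q1) (H _ _ _ _ p1 q0) (H _ _ _ _ p1 q1).
Qed.

Lemma gincl_br0 g' F : (forall g, gtab D' g' (gen_incl g) = 0) -> gbr D' (gval g') (gincl F) = 0.
Proof.
move=> g'0.
have H b F' : spar b F' -> gbr D' (gval g') (gincl F') = 0.
  apply: (ssub_br0 e_odd e_sq p_even DD' DM' (@spar_gval C' n' d' g')) => g.
  by rewrite -/gincl gincl_gval (gbr_gval DD' DM') g'0 gf0.
have [F0 [F1 [-> p0 p1]]] := spar_split F.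
by rewrite ginclD (gbr_addr DD') (H _ _ p0) (H _ _ p1) addr0.
Qed.
End GenIncl.

From mathcomp Require Import all_classical all_reals all_analysis.
Import numFieldNormedType.Exports.
Local Open Scope classical_set_scope.

(** * Functions of class C^k *)
Section CkTheory.
Variables (R : realType) (n : nat).
Implicit Types (V W : set 'rV[R]_n) (f g : 'rV[R]_n -> R).

Lemma CkW r V f : Ck r.+1 V f -> Ck r V f.
Proof.
elim: r f => [|r IH] f /= [cf df]; split=> // k.
by have [dk Ckk] := df k; split=> //; exact: IH.
Qed.

Lemma Ck_sub r V W f : V `<=` W -> Ck r W f -> Ck r V f.
Proof.
move=> VW; elim: r f => [|r IH] f /= [cf df]; split=> //.
- by move=> x /VW; exact: cf.
- by move=> x /VW; exact: cf.
by move=> k; have [dk Ckk] := df k; split=> [x /VW|]; [exact: dk|exact: IH].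
Qed.

Lemma partial_add V f g k x : Ck 1 V f -> Ck 1 V g -> V x ->
  partial k (f + g) x = partial k f x + partial k g x.
Proof.
move=> [_ df] [_ dg] Vx; have [dfk _] := df k; have [dgk _] := dg k.
by rewrite /partial deriveD //; [exact: dfk|exact: dgk].
Qed.

Lemma partial_mul V f g k x : Ck 1 V f -> Ck 1 V g -> V x ->
  partial k (f * g) x = f x * partial k g x + partial k f x * g x.
Proof.
move=> [_ df] [_ dg] Vx; have [dfk _] := df k; have [dgk _] := dg k.
rewrite /partial deriveM //; [|exact: dfk|exact: dgk].
by rewrite /GRing.scale /= [g x * _]mulrC.
Qed.

Lemma Ck_add r V f g : open V -> Ck r V f -> Ck r V g -> Ck r V (f + g).
Proof.
move=> oV; elim: r f g => [|r IH] f g Cf Cg.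
  split=> // x Vx; apply: continuousD; [exact: Cf.1|exact: Cg.1].
split=> [x Vx|k].
  by apply: continuousD; [exact: Cf.1|exact: Cg.1].
have [_ /(_ k)[df Cdf]] := Cf; have [_ /(_ k)[dg Cdg]] := Cg; split=> [x Vx|].
  by apply: derivableD; [exact: df|exact: dg].
apply: (@Ck_eq _ _ _ _ (partial k f + partial k g)) => //; last exact: IH.
move=> x Vx; rewrite /partial deriveD //; [exact: df|exact: dg].
Qed.

Lemma Ck_mul r V f g : open V -> Ck r V f -> Ck r V g -> Ck r V (f * g).
Proof.
move=> oV; elim: r f g => [|r IH] f g Cf Cg.
  split=> // x Vx; apply: continuousM; [exact: Cf.1|exact: Cg.1].
split=> [x Vx|k].
  by apply: continuousM; [exact: Cf.1|exact: Cg.1].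
have [_ /(_ k)[df Cdf]] := Cf; have [_ /(_ k)[dg Cdg]] := Cg; split=> [x Vx|].
  by apply: derivableM; [exact: df|exact: dg].
apply: (@Ck_eq _ _ _ _ (f * partial k g + partial k f * g)) => //.
  move=> x Vx; rewrite /partial deriveM; [|exact: df|exact: dg].
  by rewrite /GRing.scale /= [g x * _]mulrC.
by apply: Ck_add => //; apply: IH => //; exact: CkW.
Qed.

Lemma Ck_opp r V f : open V -> Ck r V f -> Ck r V (- f).
Proof.
move=> oV Cf; rewrite -mulN1r; apply: Ck_mul => //.
exact: (@Ck_cst _ _ _ _ (- 1)).
Qed.

Lemma smooth_partial V f k : smooth_on V f -> smooth_on V (partial k f).
Proof. by move=> sf r; have [_ /(_ k)[]] := sf r.+1. Qed.

Lemma partial_near_eq V f g k x : open V -> V x ->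
  (forall y, V y -> f y = g y) -> partial k f x = partial k g x.
Proof.
move=> oV Vx fg; apply: near_eq_derive.
have : nbhs x V by apply: open_nbhs_nbhs.
by apply: filterS => y /fg.
Qed.

End CkTheory.

Section Differentiable.
Variables (R : realType) (n : nat).
Implicit Types (V W : set 'rV[R]_n) (f g : 'rV[R]_n -> R).

Lemma derive_line f (x v : 'rV[R]_n) (s : R) :
  derivable f (x + s *: v) v ->
  is_derive s 1 (fun u : R => f (x + u *: v)) ('D_v f (x + s *: v)).
Proof.
move=> df.
have E : (fun h : R => h^-1 *: (((fun u : R => f (x + u *: v)) \o shift s) (h *: 1)
           - f (x + s *: v))) =
         (fun h : R => h^-1 *: ((f \o shift (x + s *: v)) (h *: v) - f (x + s *: v))).
  apply/funext => h /=; congr (_ *: (f _ - _)).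
  by rewrite scalerDl [h%:A]mulr1 addrCA.
by apply: DeriveDef; rewrite /derivable /derive E.
Qed.

Lemma mean_value f (x v : 'rV[R]_n) (t : R) :
  (forall s, `|s| <= `|t| -> derivable f (x + s *: v) v) ->
  exists2 s, `|s| <= `|t| & f (x + t *: v) - f x = 'D_v f (x + s *: v) * t.
Proof.
move=> df; pose phi (u : R) : R := f (x + u *: v).
have dphi (s : R) : `|s| <= `|t| -> is_derive s (1 : R) phi ('D_v f (x + s *: v)).
  by move=> /df; exact: derive_line.
have cphi (s : R) : `|s| <= `|t| -> {for s, continuous phi}.
  move=> /dphi ds; apply: differentiable_continuous.
  by apply/derivable1_diffP; exact: ex_derive.
have -> : f x = phi 0 by rewrite /phi scale0r addr0.
have [t0|t0] := leP 0 t.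
  have H s : s \in `[0, t]%R -> `|s| <= `|t|.
    by rewrite in_itv /= => /andP[s0 st]; rewrite !ger0_norm.
  have [|||s sI ->] := @MVT_segment R phi (fun s => 'D_v f (x + s *: v)) 0 t => //.
  - by move=> s sI; apply/dphi/H; exact: subset_itv_oo_cc.
  - apply: continuous_in_subspaceT => s; rewrite inE /= => sI; exact/cphi/H.
  by exists s; rewrite ?subr0 //; exact: H.
have H s : s \in `[t, 0]%R -> `|s| <= `|t|.
  by rewrite in_itv /= => /andP[ts s0]; rewrite !ler0_norm ?lerN2 // ltW.
have [|||s sI E] := @MVT_segment R phi (fun s => 'D_v f (x + s *: v)) t 0 => //.
- exact: ltW.
- by move=> s sI; apply/dphi/H; exact: subset_itv_oo_cc.
- apply: continuous_in_subspaceT => s; rewrite inE /= => sI; exact/cphi/H.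
exists s; first exact: H.
by apply: oppr_inj; rewrite opprB E sub0r mulrN.
Qed.

End Differentiable.

Section Differentiable.
Variables (R : realType) (n : nat).
Implicit Types (V W : set 'rV[R]_n) (f g : 'rV[R]_n -> R).

Lemma rV_norm_le (h : 'rV[R]_n) (e : R) : 0 <= e ->
  (forall k, `|h ord0 k| <= e) -> `|h| <= e.
Proof.
move=> e0 he; rewrite /Num.Def.normr/= mx_normrE bigmax_le // => -[i k] _.
by rewrite ord1; exact: he.
Qed.

Lemma rV_coord_le (h : 'rV[R]_n) k : `|h ord0 k| <= `|h|.
Proof.
rewrite [leRHS]/Num.Def.normr/= mx_normrE.
exact: (le_bigmax _ (fun ij : 'I_1 * 'I_n => `|h ij.1 ij.2|) (ord0, k)).
Qed.

Definition row_lin (c : 'I_n -> R) (h : 'rV[R]_n) : R :=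
  \sum_k h ord0 k * c k.

Lemma row_lin_is_linear c : linear (row_lin c).
Proof.
move=> a u v; rewrite /row_lin scaler_sumr -big_split /=; apply: eq_bigr => k _.
by rewrite !mxE mulrDl scalerAl.
Qed.

HB.instance Definition _ c :=
  GRing.isLinear.Build R 'rV[R]_n R _ (row_lin c) (row_lin_is_linear c).

Lemma row_lin_continuous c : continuous (row_lin c : 'rV[R]_n -> R).
Proof.
move=> x; rewrite /row_lin.
rewrite (_ : (fun h : 'rV[R]_n => _) = \sum_k (fun h : 'rV[R]_n => h ord0 k * c k)); last first.
  by apply/funext => h; rewrite fct_sumE.
elim/big_rec: _ => [|k F _ cF]; first exact: cst_continuous.
apply: continuousD => //; apply: continuousM; [exact: coord_continuous|exact: cst_continuous].
Qed.

(** The increment is split along the coordinate axes, and the mean value theorem is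
    applied on each segment. *)
Lemma C1_increment V f x : open V -> Ck 1 V f -> V x -> forall e, 0 < e ->
  \forall h \near (0 : 'rV[R]_n),
    `|f (h + x) - (f x + row_lin (fun k => partial k f x) h)| <= e * `|h|.
Proof.
move=> oV [_ df] Vx e e0.
pose e' := e / n.+1%:R; have e'0 : 0 < e' by rewrite divr_gt0.
have : nbhs x (V `&` [set y | forall k, `|partial k f x - partial k f y| <= e']).
  apply: filterI; first exact: open_nbhs_nbhs.
  apply: (@filter_forall _ _ (fun k y => `|partial k f x - partial k f y| <= e') _ (@nbhs_filter _ x)) => k; have [_ [ck _]] := df k.
  by have /cvgrPdist_le/(_ _ e'0) := ck x Vx.
move=> /nbhs_ballP[d /= d0 dV].
pose tr (h : 'rV[R]_n) (j : nat) : 'rV[R]_n :=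
  \row_k (if (k < j)%N then h ord0 k else 0).
apply/nbhs_ballP; exists d => // h; rewrite -ball_normE /= sub0r normrN => hd.
have near_x (v : 'rV[R]_n) : `|v| <= `|h| ->
    V (x + v) /\ forall k, `|partial k f x - partial k f (x + v)| <= e'.
  move=> vh; have [] : (V `&` [set y | forall k, `|partial k f x - partial k f y| <= e']) (x + v) => //.
  apply: dV; rewrite -ball_normE /= opprD addrA subrr sub0r normrN.
  exact: le_lt_trans hd.
have trS (j : 'I_n) : tr h j.+1 = tr h j + h ord0 j *: delta_mx ord0 j.
  apply/rowP => k; rewrite !mxE eqxx /= ltnS.
  have [->|kj] := eqVneq k j; first by rewrite leqnn ltnn add0r mulr1.
  by rewrite mulr0 addr0 ltn_neqAle kj.
have step (j : 'I_n) : exists2 v : 'rV[R]_n, `|v| <= `|h| &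
    f (x + tr h j.+1) - f (x + tr h j) = partial j f (x + v) * h ord0 j.
  have bnd s : `|s| <= `|h ord0 j| -> `|tr h j + s *: delta_mx ord0 j| <= `|h|.
    move=> sh; apply: rV_norm_le => // k; rewrite !mxE eqxx /=.
    have [->|kj] := eqVneq k j.
      by rewrite ltnn add0r mulr1; apply: le_trans sh _; exact: rV_coord_le.
    rewrite mulr0 addr0; case: ifP => _; first exact: rV_coord_le.
    by rewrite normr0.
  have [|s /bnd vh E] := @mean_value _ _ f (x + tr h j) (delta_mx ord0 j) (h ord0 j).
    by move=> s /bnd /near_x[Vv _]; have [dj _] := df j; apply: dj; rewrite -addrA.
  by exists (tr h j + s *: delta_mx ord0 j); rewrite // trS addrA E addrA.
have -> : f (h + x) - (f x + row_lin (fun k => partial k f x) h) =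
   \sum_(j < n) (f (x + tr h j.+1) - f (x + tr h j) - h ord0 j * partial j f x).
  rewrite sumrB -(big_mkord xpredT (fun j => f (x + tr h j.+1) - f (x + tr h j))) (telescope_sumr (fun j => f (x + tr h j))) //.
  have -> : tr h n = h by apply/rowP => k; rewrite !mxE ltn_ord.
  have -> : tr h 0%N = 0 by apply/rowP => k; rewrite !mxE ltn0.
  by rewrite addr0 opprD addrA [h + x]addrC.
apply: le_trans (ler_norm_sum _ _ _) _.
have -> : e * `|h| = \sum_(j < n.+1) e' * `|h|.
  by rewrite sumr_const card_ord -mulrnAl -[X in _ = X * _]mulr_natr /e' divfK // pnatr_eq0.
rewrite big_ord_recr /= -[leLHS]addr0; apply: lerD; last by rewrite mulr_ge0 // ltW.
apply: ler_sum => j _; have [v /near_x[_ vh] ->] := step j.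
rewrite [h _ _ * _]mulrC -mulrBl normrM; apply: ler_pM => //.
  by rewrite distrC.
exact: rV_coord_le.
Qed.

Lemma C1_differentiable V f x : open V -> Ck 1 V f -> V x ->
  differentiable f x /\ ('d f x : 'rV[R]_n -> R) = row_lin (fun k => partial k f x).
Proof.
move=> oV Cf Vx; pose c k := partial k f x.
have E : f \o shift x = cst (f x) + row_lin c +o_ (0 : 'rV[R]_n) id.
  by apply/eqaddoP => e e0; exact: C1_increment Cf Vx e e0.
have dE : ('d f x : 'rV[R]_n -> R) = row_lin c.
  by apply: diff_unique E; exact: row_lin_continuous.
split=> //; apply/diff_locallyP; rewrite dE; split=> //; exact: row_lin_continuous.
Qed.
End Differentiable.

Section Chain.
Variables (R : realType) (n m : nat).
Implicit Types (V : set 'rV[R]_n) (W : set 'rV[R]_m).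

Lemma C1_rV_differentiable V (g : 'rV[R]_n -> 'rV[R]_m) x :
  open V -> (forall l, Ck 1 V (fun y => g y ord0 l)) -> V x -> differentiable g x.
Proof.
move=> oV Cg Vx.
have -> : g = \sum_(l < m) (fun y => g y ord0 l *: (delta_mx ord0 l : 'rV[R]_m)).
  apply/funext => y; rewrite fct_sumE; apply/rowP => j.
  rewrite summxE (bigD1 j) //= big1 ?addr0 => [|l lj]; rewrite !mxE ?eqxx ?mulr1 //=.
  by rewrite eq_sym (negPf lj) mulr0.
apply: differentiable_sum => l; apply: differentiableZl.
by have [] := C1_differentiable oV (Cg l) Vx.
Qed.

Lemma chain_rule V W (g : 'rV[R]_n -> 'rV[R]_m) (f : 'rV[R]_m -> R) k x :
  open V -> open W -> (forall l, Ck 1 V (fun y => g y ord0 l)) ->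
  (forall y, V y -> W (g y)) -> Ck 1 W f -> V x ->
  derivable (f \o g) x (delta_mx ord0 k) /\
  partial k (f \o g) x =
    \sum_l partial l f (g x) * partial k (fun y => g y ord0 l) x.
Proof.
move=> oV oW Cg VW Cf Vx.
have [df dfE] := C1_differentiable oW Cf (VW _ Vx).
have dg := C1_rV_differentiable oV Cg Vx.
have dfg : differentiable (f \o g) x by exact: differentiable_comp.
split; first exact: diff_derivable.
rewrite /partial deriveE // diff_comp //= dfE -deriveE // derive_mx; last exact: diff_derivable.
by apply: eq_bigr => l _; rewrite mxE mulrC.
Qed.

Lemma Ck_sum r (I : Type) (s : seq I) (V : set 'rV[R]_n) (F : I -> 'rV[R]_n -> R) :
  open V -> (forall i, Ck r V (F i)) -> Ck r V (\sum_(i <- s) F i).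
Proof.
move=> oV CF; elim/big_rec: _ => [|i f _ Cf]; first exact: (@Ck_cst _ _ _ _ 0).
exact: Ck_add.
Qed.

(** By induction on the order: the chain rule expresses the partial derivatives of
    the composite through composites of a lower order. *)
Lemma Ck_comp r V W (g : 'rV[R]_n -> 'rV[R]_m) (f : 'rV[R]_m -> R) :
  open V -> open W -> (forall l, smooth_on V (fun y => g y ord0 l)) ->
  (forall y, V y -> W (g y)) -> smooth_on W f -> Ck r V (f \o g).
Proof.
move=> oV oW Cg VW; elim: r f => [|r IH] f Cf.
  split=> // x Vx; apply: differentiable_continuous; apply: differentiable_comp.
    by apply: C1_rV_differentiable Vx => // l; exact: Cg.
  by have [] := C1_differentiable oW (Cf 1%N) (VW _ Vx).
split=> [x Vx|k].
  apply: differentiable_continuous; apply: differentiable_comp.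
    by apply: C1_rV_differentiable Vx => // l; exact: Cg.
  by have [] := C1_differentiable oW (Cf 1%N) (VW _ Vx).
have ch x : V x -> _ := @chain_rule V W g f k x oV oW (fun l => Cg l 1%N) VW (Cf 1%N).
split=> [x /ch[]//|].
apply: (@Ck_eq _ _ _ _ (\sum_l (partial l f \o g) * partial k (fun y => g y ord0 l))) => //.
  by move=> x /ch[_ ->]; rewrite fct_sumE.
apply: Ck_sum => // l; apply: Ck_mul => //; first by apply: IH; exact: smooth_partial.
by apply: smooth_partial; exact: Cg.
Qed.
End Chain.

Section Schwarz.
Variables (R : realType) (n : nat).
Implicit Types (V : set 'rV[R]_n) (f : 'rV[R]_n -> R).
Local Notation e_ k := (delta_mx ord0 k : 'rV[R]_n).

Lemma derivable_translate f (w z v : 'rV[R]_n) :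
  derivable (fun y => f (y + w)) z v <-> derivable f (z + w) v.
Proof.
rewrite /derivable.
have -> : (fun h : R => h^-1 *: (((fun y => f (y + w)) \o shift z) (h *: v) - f (z + w)))
  = (fun h => h^-1 *: ((f \o shift (z + w)) (h *: v) - f (z + w))) => //.
by apply/funext => h /=; rewrite addrA.
Qed.

Lemma derive_translate f (w z v : 'rV[R]_n) :
  'D_v (fun y => f (y + w)) z = 'D_v f (z + w).
Proof.
rewrite /derive.
have -> : (fun h : R => h^-1 *: (((fun y => f (y + w)) \o shift z) (h *: v) - f (z + w)))
  = (fun h => h^-1 *: ((f \o shift (z + w)) (h *: v) - f (z + w))) => //.
by apply/funext => h /=; rewrite addrA.
Qed.

Lemma mulIf2 (t a b : R) : 0 < t -> a * t * t = b * t * t -> a = b.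
Proof. by move=> /lt0r_neq0 t0 /(mulIf t0)/(mulIf t0). Qed.

Lemma le_half2 (a b c e : R) : `|a - c| <= e / 2 -> `|c - b| <= e / 2 -> `|a - b| <= e.
Proof.
move=> ac cb; apply: le_trans (ler_distD c a b) _.
by rewrite [leRHS](splitr e); exact: lerD.
Qed.

Lemma norm_delta (k : 'I_n) : `|e_ k| <= 1.
Proof.
by apply: rV_norm_le => // j; rewrite mxE eqxx /=; case: (_ == _); rewrite ?normr1 ?normr0.
Qed.

(** The mean value theorem along k, then along l. Exchanging k and l does not change
    the left side, which gives the symmetry of the second derivatives. *)
Lemma second_difference V f k l x t : Ck 2 V f ->
  (forall v : 'rV[R]_n, `|v| <= t + t -> V (x + v)) -> 0 < t ->
  exists2 v : 'rV[R]_n, `|v| <= t + t &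
    f (x + t *: e_ k + t *: e_ l) - f (x + t *: e_ k) - f (x + t *: e_ l) + f x
    = partial l (partial k f) (x + v) * t * t.
Proof.
move=> [_ df] ball t0; have [dk [_ dkl]] := df k; have [dlk _] := dkl l.
have tt (s : R) : `|s| <= `|t| -> `|s| <= t by rewrite [`|t|]ger0_norm // ltW.
have nle j (s : R) : `|s| <= t -> `|s *: e_ j| <= t.
  move=> st; rewrite normrZ -[leRHS]mulr1; apply: ler_pM => //; exact: norm_delta.
have Vs (s u : R) : `|s| <= t -> `|u| <= t -> V (x + s *: e_ k + u *: e_ l).
  move=> st ut; rewrite -addrA; apply: ball; apply: le_trans (ler_normD _ _) _.
  by apply: lerD; exact: nle.
have V0 (s : R) : `|s| <= t -> V (x + s *: e_ k).
  by move=> st; rewrite -[X in V X]addr0 -(scale0r (e_ l)); apply: Vs; rewrite ?normr0 // ltW.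
pose phi y := f (y + t *: e_ l) - f y.
have tle : `|t| <= t by rewrite ger0_norm // ltW.
have dphi (s : R) : `|s| <= t -> derivable phi (x + s *: e_ k) (e_ k).
  move=> st; apply: derivableB; first by apply/derivable_translate/dk; exact: Vs.
  by apply: dk; exact: V0.
have [s /tt st E] : exists2 s : R, `|s| <= `|t| & phi (x + t *: e_ k) - phi x
    = 'D_(e_ k) phi (x + s *: e_ k) * t.
  by apply: mean_value => s /tt; exact: dphi.
have {}E : phi (x + t *: e_ k) - phi x = (partial k f (x + s *: e_ k + t *: e_ l)
    - partial k f (x + s *: e_ k)) * t.
  rewrite E; congr (_ * _); rewrite deriveB ?derive_translate //.
    by apply/derivable_translate/dk; exact: Vs.
  by apply: dk; exact: V0.
have [u /tt ut E'] : exists2 u : R, `|u| <= `|t| &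
    partial k f (x + s *: e_ k + t *: e_ l) - partial k f (x + s *: e_ k)
    = 'D_(e_ l) (partial k f) (x + s *: e_ k + u *: e_ l) * t.
  by apply: mean_value => u /tt ut; apply: dlk; exact: Vs.
exists (s *: e_ k + u *: e_ l).
  by apply: le_trans (ler_normD _ _) _; apply: lerD; exact: nle.
have -> : f (x + t *: e_ k + t *: e_ l) - f (x + t *: e_ k) - f (x + t *: e_ l) + f x
  = phi (x + t *: e_ k) - phi x by rewrite /phi opprB [f x - _]addrC addrA.
by rewrite E E' addrA.
Qed.

(** Both mixed derivatives are limits of the same second difference. *)
Lemma partialC V f k l x : open V -> Ck 2 V f -> V x ->
  partial l (partial k f) x = partial k (partial l f) x.
Proof.
move=> oV C2 Vx; have [_ df] := C2.
apply/eqP; rewrite -subr_eq0 -normr_le0; apply/ler_addgt0Pr => e e0; rewrite add0r.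
have e2 : 0 < e / 2 by rewrite divr_gt0.
have cont j i : \forall y \near x, `|partial i (partial j f) x - partial i (partial j f) y| <= e / 2.
  have [_ [_ dj]] := df j; have [_ [cj _]] := dj i.
  by have /cvgrPdist_le/(_ _ e2) := cj x Vx.
have : nbhs x (V `&` ([set y | `|partial l (partial k f) x - partial l (partial k f) y| <= e / 2]
   `&` [set y | `|partial k (partial l f) x - partial k (partial l f) y| <= e / 2])).
  by apply: filterI; [exact: open_nbhs_nbhs|apply: filterI; exact: cont].
move=> /nbhs_ballP[d /= d0 dV].
have [t t0 td] : exists2 t : R, 0 < t & t + t < d.
  by exists (d / 4); [rewrite divr_gt0|lra].
have near_x (v : 'rV[R]_n) : `|v| <= t + t -> ball x d (x + v).
  move=> vd; rewrite -ball_normE /= opprD addrA subrr sub0r normrN.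
  exact: le_lt_trans vd td.
have Vv (v : 'rV[R]_n) : `|v| <= t + t -> V (x + v) by move=> /near_x/dV[].
have [v /near_x/dV[_ [/= H1 _]] E1] := second_difference k l C2 Vv t0.
have [w /near_x/dV[_ [_ /= H2]] E2] := second_difference l k C2 Vv t0.
have E : partial l (partial k f) (x + v) = partial k (partial l f) (x + w).
  apply: (mulIf2 t0); apply: etrans (esym E1) _; apply: etrans _ E2.
  by rewrite [x + _ *: e_ l + _]addrAC; congr (_ + _); rewrite [LHS]addrAC.
have {H2} : `|partial l (partial k f) (x + v) - partial k (partial l f) x| <= e / 2.
  by rewrite E distrC.
exact: le_half2 H1.
Qed.
End Schwarz.

Section ExpCoord.
Variables (R : realType) (n : nat).

Section Fixed.
Variables (j : 'I_n) (c : R).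
Local Notation f := (fun x : 'rV[R]_n => expR (c * x ord0 j)).

Lemma differentiable_exp_coord x : differentiable f x.
Proof.
apply: (@differentiable_comp _ _ _ _ (fun y : 'rV[R]_n => c * y ord0 j) expR).
  by apply: differentiableM; [exact: differentiable_cst|exact: differentiable_coord].
by apply/derivable1_diffP/derivable_expR.
Qed.

Lemma partial_exp_coord k : partial k f = (fun=> c * (j == k)%:R) * f.
Proof.
apply/funext => x; have [dj djE] := derive_entry k j x.
have dl : differentiable (fun y : 'rV[R]_n => c * y ord0 j) x.
  by apply: differentiableM; [exact: differentiable_cst|exact: differentiable_coord].
have de (y : R) : differentiable (@expR R) y by apply/derivable1_diffP/derivable_expR.
rewrite /partial deriveE; last exact: differentiable_exp_coord.
rewrite (@diff_comp _ _ _ _ (fun y : 'rV[R]_n => c * y ord0 j) expR) //=.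
rewrite deriv1E ?derive_expR //= -[X in X *: _]deriveE //.
rewrite [X in _ *: X](_ : _ = f x); last first.
  rewrite derive1E.
  exact: (congr1 (fun F => F (c * x ord0 j)) (derive_expR R)).
by rewrite (_ : (fun y : 'rV[R]_n => c * y ord0 j) = c \*o (fun y : 'rV[R]_n => y ord0 j)) // deriveMl // djE.
Qed.

Lemma smooth_exp_coord (V : set 'rV[R]_n) : open V -> smooth_on V f.
Proof.
move=> oV; have df := differentiable_exp_coord.
elim=> [|r IH]; (split; first by move=> x _; exact: differentiable_continuous).
  by [].
move=> k; split=> [x _|]; first exact: diff_derivable.
rewrite partial_exp_coord; apply: Ck_mul => //; exact: Ck_cst.
Qed.
End Fixed.
End ExpCoord.

(** * Change of the ring of coefficients *)
Section CoefMap.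
Variables (C C' : comNzRingType) (m : nat) (f : {rmorphism C -> C'}).

Fact emap_zmod : zmod_morphism (@emap C m C' f).
Proof. by move=> u v; apply/ffunP => S; rewrite !ffunE rmorphB. Qed.
Fact emap_monoid : monoid_morphism (@emap C m C' f).
Proof.
split; first by apply/ffunP => S; rewrite !ffunE; case: ifP; rewrite ?rmorph1 ?rmorph0.
move=> u v; apply/ffunP => S; rewrite !ffunE rmorph_sum; apply: eq_bigr => T _.
by rewrite !rmorphM rmorph_sign !ffunE.
Qed.
HB.instance Definition _ := GRing.isZmodMorphism.Build _ _ (@emap C m C' f) emap_zmod.
HB.instance Definition _ := GRing.isMonoidMorphism.Build _ _ (@emap C m C' f) emap_monoid.
End CoefMap.

Section SfMap.
Variables (C C' : comNzRingType) (n d : nat) (f : {rmorphism C -> C'}).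
Local Notation SF := (mpoly n (exterior C (d + d))).
Local Notation SF' := (mpoly n (exterior C' (d + d))).

Definition sfmap : {rmorphism SF -> SF'} :=
  locked_with lift_key (@map_mpoly n _ _ (@emap C (d + d) C' f) : {rmorphism SF -> SF'}).

Lemma sfmapE F : sfmap F = map_mpoly (@emap C (d + d) C' f) F.
Proof. by rewrite /sfmap unlock. Qed.

Lemma sfmap_coef F w S : mcoeff w (sfmap F) S = f (mcoeff w F S).
Proof. by rewrite sfmapE mcoeff_map_mpoly ffunE. Qed.

Lemma sfmap_gf x : sfmap (gf n d x) = gf n d (f x).
Proof.
apply/mpolyP => w; apply/ffunP => S; rewrite sfmap_coef !mcoeffC.
case: (w == _); rewrite ?mulr1 ?mulr0 !ffunE ?rmorph0 //.
by case: ifP; rewrite ?rmorph0.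
Qed.

Lemma sfmap_go c : sfmap (go C n c) = go C' n c.
Proof.
apply/mpolyP => w; apply/ffunP => S; rewrite sfmap_coef !mcoeffC.
by case: (w == _); rewrite ?mulr1 ?mulr0 !ffunE ?rmorph0 // rmorph_nat.
Qed.

Lemma sfmap_gx k : sfmap (gx C d k) = gx C' d k.
Proof. by rewrite sfmapE map_mpolyX. Qed.

End SfMap.

Section SfMapSubst.
Variables (C1 C2 K : comNzRingType) (n d n' d' : nat).
Variables (f : {rmorphism C1 -> C2}) (g : {rmorphism C2 -> K}) (h : {rmorphism C1 -> K}).
Local Notation SF2 := (mpoly n' (exterior C2 (d' + d'))).
Variables (e : 'I_(d + d) -> SF2) (p : 'I_n -> SF2).
Hypothesis e_odd : forall c, spar true (e c).
Hypothesis e_sq : forall c, e c * e c = 0.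
Hypothesis p_even : forall k, spar false (p k).
Hypothesis gf_h : forall x, g (f x) = h x.

Lemma spar_sfmap (b : bool) (F : SF2) : spar b F -> spar b (sfmap n' d' g F).
Proof.
move=> pF w S; rewrite sfmap_coef.
by have [->|/pF//] := eqVneq (mcoeff w F S) 0; rewrite rmorph0 eqxx.
Qed.

Lemma sfmap_ssub (e' : 'I_(d + d) -> mpoly n' (exterior K (d' + d')))
    (p' : 'I_n -> mpoly n' (exterior K (d' + d'))) F :
  (forall c, sfmap n' d' g (e c) = e' c) -> (forall k, sfmap n' d' g (p k) = p' k) ->
  sfmap n' d' g (ssub f e p F) = ssub (idfun : {rmorphism K -> K}) e' p' (sfmap n d h F).
Proof.
move=> ee pp.
have e'o c : spar true (e' c) by rewrite -ee; exact: spar_sfmap.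
have e's c : e' c * e' c = 0 by rewrite -ee -rmorphM e_sq rmorph0.
have p'e k : spar false (p' k) by rewrite -pp; exact: spar_sfmap.
apply: (@sf_morph_ext C1 n d _ (fun F => sfmap n' d' g (ssub f e p F))
  (fun F => ssub idfun e' p' (sfmap n d h F))) F.
- by move=> F G; rewrite ssubD // rmorphD.
- by move=> F G; rewrite rmorphD ssubD.
- by move=> F G; rewrite ssubM // rmorphM.
- by move=> F G; rewrite rmorphM ssubM.
case=> [x|c|k] /=.
- by rewrite ssub_gf // !sfmap_gf ssub_gf // gf_h.
- by rewrite ssub_go // sfmap_go ssub_go //; exact: ee.
by rewrite ssub_gx // sfmap_gx ssub_gx //; exact: pp.
Qed.
End SfMapSubst.

(** * Rings of smooth functions *)
Section Cinf.
Variables (R : realType) (n : nat).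

(** The domains are nonempty so that one is nonzero in the ring of functions. *)
Record odom := Odom {
  oset :> set 'rV[R]_n ;
  oset_open : open oset ;
  opoint : 'rV[R]_n ;
  opointP : oset opoint }.

Variable V : odom.
Local Notation VV := (oset V).
Local Notation Cf := ('rV[R]_n -> R).

Definition cinf_pred : {pred Cf} :=
  fun f => `[< smooth_on VV f /\ forall x, ~ VV x -> f x = 0 >].

(** Functions which are smooth on V and vanish off V. The canonical extension by zero
    makes equality in the ring that of values on V, so that partial derivatives
    become commuting derivations without any restriction to V. *)
Record cinf := Cinf { cval : Cf ; _ : cval \in cinf_pred }.
HB.instance Definition _ := [isSub for cval].
HB.instance Definition _ := [Choice of cinf by <:].

Lemma cinfP (f : cinf) : smooth_on VV (cval f) /\ forall x, ~ VV x -> cval f x = 0.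
Proof. by case: f => f /= /asboolP. Qed.

Fact cinf_zmod_closed : zmod_closed cinf_pred.
Proof.
split; first by apply/asboolP; split=> // r; exact: (@Ck_cst _ _ _ _ 0).
move=> f g /asboolP[sf f0] /asboolP[sg g0]; apply/asboolP; split=> [r|x Vx].
  apply: Ck_add => //; [exact: oset_open|apply: Ck_opp => //; exact: oset_open].
by rewrite /= /GRing.add /= /GRing.opp /= f0 // g0 // subr0.
Qed.
HB.instance Definition _ := GRing.isZmodClosed.Build Cf cinf_pred cinf_zmod_closed.
HB.instance Definition _ := [SubChoice_isSubZmodule of cinf by <:].

Definition truncate (f : Cf) : Cf := fun x => if `[< VV x >] then f x else 0.

Lemma truncateE f x : VV x -> truncate f x = f x.
Proof. by move=> Vx; rewrite /truncate asboolT. Qed.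

Lemma truncate_cinf f : smooth_on VV f -> truncate f \in cinf_pred.
Proof.
move=> sf; apply/asboolP; split=> [r|x Vx]; last by rewrite /truncate asboolF.
by apply: Ck_eq (sf r) => [|x Vx]; [exact: oset_open|rewrite truncateE].
Qed.

Definition mkcinf f (sf : smooth_on VV f) : cinf := Cinf (truncate_cinf sf).

Lemma mkcinfE f (sf : smooth_on VV f) x : VV x -> cval (mkcinf sf) x = f x.
Proof. exact: truncateE. Qed.

Lemma cinf_eq (f g : cinf) : (forall x, VV x -> cval f x = cval g x) -> f = g.
Proof.
move=> fg; apply: val_inj; apply/funext => x; have [Vx|Vx] := pselect (VV x); first exact: fg.
have [_ f0] := cinfP f; have [_ g0] := cinfP g; exact: etrans (f0 x Vx) (esym (g0 x Vx)).
Qed.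

Lemma smooth_cst (c : R) : smooth_on VV (fun=> c).
Proof. by move=> r; exact: Ck_cst. Qed.

Lemma smooth_mul (f g : Cf) : smooth_on VV f -> smooth_on VV g -> smooth_on VV (f * g).
Proof. by move=> sf sg r; apply: Ck_mul => //; exact: oset_open. Qed.

Definition cone : cinf := mkcinf (smooth_cst 1).
Definition cmul (f g : cinf) : cinf := mkcinf (smooth_mul (cinfP f).1 (cinfP g).1).

Lemma cmulE f g x : VV x -> cval (cmul f g) x = cval f x * cval g x.
Proof. exact: mkcinfE. Qed.
Lemma coneE x : VV x -> cval cone x = 1.
Proof. exact: mkcinfE. Qed.
Lemma caddE (f g : cinf) x : cval (f + g) x = cval f x + cval g x.
Proof. by []. Qed.

Fact cmulA : associative cmul.
Proof. by move=> f g h; apply: cinf_eq => x Vx; rewrite !cmulE // mulrA. Qed.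
Fact cmulC : commutative cmul.
Proof. by move=> f g; apply: cinf_eq => x Vx; rewrite !cmulE // mulrC. Qed.
Fact cmul1 : left_id cone cmul.
Proof. by move=> f; apply: cinf_eq => x Vx; rewrite !cmulE // coneE // mul1r. Qed.
Fact cmulDl : left_distributive cmul +%R.
Proof. by move=> f g h; apply: cinf_eq => x Vx; rewrite caddE !cmulE // mulrDl. Qed.
Fact cone_neq0 : cone != 0.
Proof.
apply/eqP => /(congr1 (fun f => cval f (opoint V))); rewrite coneE; last exact: opointP.
by move/eqP; rewrite oner_eq0.
Qed.
HB.instance Definition _ := GRing.Zmodule_isComNzRing.Build cinf cmulA cmulC cmul1 cmulDl cone_neq0.

Lemma smooth_part k (f : cinf) : smooth_on VV (partial k (cval f)).
Proof. by apply: smooth_partial; exact: (cinfP f).1. Qed.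

Definition cder : 'I_n -> cinf -> cinf :=
  locked_with lift_key (fun k f => mkcinf (smooth_part k f)).

Lemma cderE k f x : VV x -> cval (cder k f) x = partial k (cval f) x.
Proof. by rewrite /cder unlock; exact: mkcinfE. Qed.

Lemma cderD k f g : cder k (f + g) = cder k f + cder k g.
Proof.
apply: cinf_eq => x Vx; rewrite caddE !cderE //.
by rewrite (partial_add k ((cinfP f).1 1%N) ((cinfP g).1 1%N)).
Qed.

Lemma cderM k f g : cder k (f * g) = cder k f * g + f * cder k g.
Proof.
apply: cinf_eq => x Vx; rewrite caddE !cmulE // !cderE // addrC.
rewrite -(partial_mul k ((cinfP f).1 1%N) ((cinfP g).1 1%N)) //.
by apply: (partial_near_eq (V := VV)) => // [|y Vy]; [exact: oset_open|exact: cmulE].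
Qed.

Lemma cderC k l f : cder k (cder l f) = cder l (cder k f).
Proof.
apply: cinf_eq => x Vx.
apply: etrans (cderE k _ Vx) _; apply: etrans _ (esym (cderE l _ Vx)).
have near j g h : partial h (cval (cder j g)) x = partial h (partial j (cval g)) x.
  by apply: (partial_near_eq (V := VV)) => // [|y Vy]; [exact: oset_open|exact: cderE].
apply: etrans (near l f k) _; apply: etrans _ (esym (near k f l)).
by apply: (@partialC _ _ VV (cval f)) => //; [exact: oset_open|exact: (cinfP f).1].
Qed.

Lemma cinf_torsion (f : cinf) : f + f = 0 -> f = 0.
Proof.
move=> ff; apply: cinf_eq => x Vx; have := congr1 (fun g => cval g x) ff.
rewrite caddE /= => /eqP; rewrite -mulr2n mulrn_eq0 /= => /eqP ->; by [].
Qed.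

Definition evr (x : 'rV[R]_n) (f : Cf) : R := f x.
Fact evr_zmod x : zmod_morphism (evr x). Proof. by []. Qed.
Fact evr_monoid x : monoid_morphism (evr x). Proof. by []. Qed.
HB.instance Definition _ x := GRing.isZmodMorphism.Build _ _ (evr x) (evr_zmod x).
HB.instance Definition _ x := GRing.isMonoidMorphism.Build _ _ (evr x) (evr_monoid x).

Definition evc (x : {x | VV x}) (f : cinf) : R := cval f (sval x).
Fact evc_zmod x : zmod_morphism (evc x). Proof. by []. Qed.
Fact evc_monoid x : monoid_morphism (evc x).
Proof. by case: x => x Vx; split=> [|f g]; [exact: coneE|exact: cmulE]. Qed.
HB.instance Definition _ x := GRing.isZmodMorphism.Build _ _ (evc x) (evc_zmod x).
HB.instance Definition _ x := GRing.isMonoidMorphism.Build _ _ (evc x) (evc_monoid x).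

End Cinf.

(** * Superfunctions with smooth coefficients *)
Section SfMapDerivatives.
Variables (C C' : comNzRingType) (n d : nat) (f : {rmorphism C -> C'}).
Local Notation SF := (mpoly n (exterior C (d + d))).
Implicit Types F : SF.

Lemma sfmap_dp k F : sfmap n d f (mderiv k F) = mderiv k (sfmap n d f F).
Proof.
apply/mpolyP => w; apply/ffunP => S.
by rewrite sfmap_coef !mcoeff_deriv !ffunMnE rmorphMn sfmap_coef.
Qed.

Lemma ederl_emap c (u : exterior C (d + d)) : emap f (ederl c u) = ederl c (emap f u).
Proof.
by apply/ffunP => S; rewrite !ffunE; case: ifP; rewrite ?rmorph0 // rmorphM rmorph_sign.
Qed.

Lemma ederr_emap c (u : exterior C (d + d)) : emap f (ederr c u) = ederr c (emap f u).
Proof.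
by apply/ffunP => S; rewrite !ffunE; case: ifP; rewrite ?rmorph0 // rmorphM rmorph_sign.
Qed.

Lemma sfmap_mcoeff w F : mcoeff w (sfmap n d f F) = emap f (mcoeff w F).
Proof. by rewrite sfmapE mcoeff_map_mpoly. Qed.

Lemma sfmap_dl c F : sfmap n d f (map_mpoly (ederl c) F) = map_mpoly (ederl c) (sfmap n d f F).
Proof.
apply/mpolyP => w; apply: etrans (sfmap_mcoeff _ _) _.
apply: etrans _ (esym (mcoeff_map0 _ _ (ederl0 _ _))).
rewrite [X in emap f X]mcoeff_map0 ?ederl0 // [in RHS]sfmap_mcoeff.
exact: ederl_emap.
Qed.

Lemma sfmap_dr c F : sfmap n d f (map_mpoly (ederr c) F) = map_mpoly (ederr c) (sfmap n d f F).
Proof.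
apply/mpolyP => w; apply: etrans (sfmap_mcoeff _ _) _.
apply: etrans _ (esym (mcoeff_map0 _ _ (ederr0 _ _))).
rewrite [X in emap f X]mcoeff_map0 ?ederr0 // [in RHS]sfmap_mcoeff.
exact: ederr_emap.
Qed.
End SfMapDerivatives.

Section Rep.
Variables (R : realType) (n d : nat) (V : odom R n).
Local Notation VV := (oset V).
Local Notation Cf := (('rV[R]_n -> R) : comNzRingType).
Local Notation sf := (superfun R n d).
Local Notation csf := (mpoly n (exterior (cinf V) (d + d))).
Implicit Types (F G : sf) (X Y : csf).

(** X represents on V a superfunction F whose coefficients may be arbitrary off V.
    Comparing values at points makes this compatible with every ring operation. *)
Definition rep F X := forall x : {x | VV x},
  sfmap n d (evr (sval x)) F = sfmap n d (evc x) X.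

Lemma rep_coef F X : rep F X <->
  forall w S x, VV x -> sf_coef w S F x = cval (mcoeff w X S) x.
Proof.
split=> [H w S x Vx|H [x Vx]].
  have := congr1 (fun G : mpoly n (exterior R (d + d)) => mcoeff w G S) (H (exist _ x Vx)).
  by rewrite !sfmap_coef.
apply/mpolyP => w; apply/ffunP => S; rewrite !sfmap_coef; exact: H.
Qed.

Lemma rep_D F G X Y : rep F X -> rep G Y -> rep (F + G) (X + Y).
Proof. by move=> H1 H2 x; rewrite [LHS]rmorphD [RHS]rmorphD H1 H2. Qed.

Lemma rep_N F X : rep F X -> rep (- F) (- X).
Proof. by move=> H1 x; rewrite [LHS]rmorphN [RHS]rmorphN H1. Qed.

Lemma rep_M F G X Y : rep F X -> rep G Y -> rep (F * G) (X * Y).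
Proof. by move=> H1 H2 x; rewrite [LHS]rmorphM [RHS]rmorphM H1 H2. Qed.

Lemma rep_0 : rep 0 0.
Proof. by move=> x; rewrite [LHS]rmorph0 [RHS]rmorph0. Qed.

Lemma rep_1 : rep 1 1.
Proof. by move=> x; rewrite [LHS]rmorph1 [RHS]rmorph1. Qed.

Lemma rep_sum (I : Type) (r : seq I) (P : pred I) (F : I -> sf) (X : I -> csf) :
  (forall i, rep (F i) (X i)) ->
  rep (\sum_(i <- r | P i) F i) (\sum_(i <- r | P i) X i).
Proof. by move=> H; elim/big_rec2: _ => [|i x y _ Hx]; [exact: rep_0|exact: rep_D]. Qed.

Lemma rep_gf f (phi : cinf V) : (forall x, VV x -> f x = cval phi x) ->
  rep (sf_fun d f) (gf n d phi).
Proof.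
move=> H [x Vx]; rewrite [RHS]sfmap_gf [LHS](@sfmap_gf Cf).
by congr (gf _ _ _); exact: H.
Qed.

Lemma rep_go c : rep (go Cf n c) (go (cinf V) n c).
Proof. by move=> x; rewrite !sfmap_go. Qed.

Lemma rep_gx k : rep (gx Cf d k) (gx (cinf V) d k).
Proof. by move=> x; rewrite !sfmap_gx. Qed.

Lemma partial0 k : partial k (0 : 'rV[R]_n -> R) = 0.
Proof. by apply/funext => x; exact: derive_cst. Qed.

(** Partial derivatives at a point of V depend on the values on the open set V only. *)
Lemma rep_dx k F X : rep F X -> rep (sf_dx k F) (sdx (cder (V := V) k) X).
Proof.
move=> /rep_coef H; apply/rep_coef => w S x Vx.
have D0 := der0 (@cderD R n V k).
rewrite (mcoeff_sdx _ _ _ D0) (cderE k _ Vx) /sf_coef.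
rewrite mcoeff_map0; last by apply/ffunP => T; rewrite !ffunE partial0.
rewrite ffunE; apply: (partial_near_eq (V := VV)) => // [|y Vy]; first exact: oset_open.
exact: H.
Qed.

Lemma rep_dp k F X : rep F X -> rep (sf_dp k F) (mderiv k X).
Proof. by move=> H x; rewrite [LHS]sfmap_dp [RHS]sfmap_dp H. Qed.

Lemma rep_dl c F X : rep F X -> rep (sf_dl c F) (sdl c X).
Proof. by move=> H x; rewrite /sdl sliftE [LHS]sfmap_dl [RHS]sfmap_dl H. Qed.

Lemma rep_dr c F X : rep F X -> rep (sf_dr c F) (sdr c X).
Proof. by move=> H x; rewrite /sdr sliftE [LHS]sfmap_dr [RHS]sfmap_dr H. Qed.

Definition cbr : csf -> csf -> csf := gbr (cder (V := V)).

Lemma rep_br F G X Y : rep F X -> rep G Y -> rep (sf_bracket F G) (cbr X Y).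
Proof.
move=> HF HG; rewrite /cbr gbrE; apply: rep_D; apply: rep_sum => k.
  apply: rep_D; first by apply: rep_M; [exact: rep_dp|exact: rep_dx].
  by apply: rep_N; apply: rep_M; [exact: rep_dx|exact: rep_dp].
apply: rep_D; apply: rep_M; by [exact: rep_dr|exact: rep_dl].
Qed.

Lemma rep_uniq F X Y : rep F X -> rep F Y -> X = Y.
Proof.
move=> /rep_coef HX /rep_coef HY; apply/mpolyP => w; apply/ffunP => S.
by apply: cinf_eq => x Vx; rewrite -HX // HY.
Qed.

Lemma rep_eq_on F G X : rep F X -> rep G X -> sf_eq_on VV F G.
Proof. by move=> /rep_coef HX /rep_coef HY w S x Vx; rewrite HX // HY. Qed.

Lemma rep_congr F G X : sf_eq_on VV F G -> rep F X -> rep G X.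
Proof. by move=> FG /rep_coef HX; apply/rep_coef => w S x Vx; rewrite -FG // HX. Qed.

Lemma rep_smooth F X : rep F X -> sf_smooth_on VV F.
Proof.
move=> /rep_coef H w S r; apply: Ck_eq ((cinfP (mcoeff w X S)).1 r); first exact: oset_open.
by move=> x Vx; rewrite -H.
Qed.

Lemma rep_ex F : sf_smooth_on VV F -> exists X, rep F X.
Proof.
move=> sF.
pose rst (f : 'rV[R]_n -> R) : cinf V :=
  match pselect (smooth_on VV f) with left sf => mkcinf sf | right _ => 0 end.
have rstE f x : smooth_on VV f -> VV x -> cval (rst f) x = f x.
  by rewrite /rst; case: pselect => // sf _ Vx; exact: mkcinfE.
have rst0 : rst 0 = 0.
  apply: cinf_eq => x Vx; rewrite rstE //; exact: (smooth_cst V 0).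
exists (map_mpoly (@emap Cf (d + d) (cinf V) rst) F); apply/rep_coef => w S x Vx.
rewrite mcoeff_map0; last by apply/ffunP => T; rewrite !ffunE rst0.
by rewrite ffunE rstE //; exact: sF.
Qed.

Lemma rep_bihom F X k l : rep F X -> sf_bihom_on VV k l F <-> bihom k l X.
Proof.
move=> /rep_coef H; split=> HH w S.
  move=> nz; have [x Vx nx] : exists2 x, VV x & cval (mcoeff w X S) x != 0.
    apply: contrapT => no; case/eqP: nz; apply: cinf_eq => x Vx.
    by apply/eqP; apply: contrapT => /negP nx; apply: no; exists x.
  by apply: (HH w S x Vx); rewrite H.
move=> x Vx; rewrite H // => nz; apply: HH.
by apply/eqP => E; rewrite E /= eqxx in nz.
Qed.

End Rep.

Section ModelPoisson.
Variables (R : realType) (n d : nat) (V : odom R n).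
Local Notation csf := (mpoly n (exterior (cinf V) (d + d))).

Lemma zhom_neg k l (X : csf) : zhom k l X -> (k < 0) || (l < 0) -> X = 0.
Proof.
move=> hX kl; apply/mpolyP => w; apply/ffunP => S; rewrite mcoeff0 [RHS]ffunE.
apply/eqP; apply: contrapT => /negP/hX[kE lE]; move: kl.
by rewrite -kE -lE.
Qed.

Lemma csf_torsion (X : csf) : X + X = 0 -> X = 0.
Proof.
move=> XX; apply/mpolyP => w; apply/ffunP => S; rewrite mcoeff0 [RHS]ffunE.
apply: cinf_torsion.
by have := congr1 (fun Y : csf => mcoeff w Y S) XX; rewrite /= mcoeffD ffunE mcoeff0 => ->; rewrite ffunE.
Qed.

Lemma odd_abs_add (a b : nat) : odd (absz (a%:Z + b%:Z)) = odd (a + b).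
Proof. by rewrite -PoszD. Qed.

Lemma zhom_spar k l (X : csf) : zhom k l X -> spar (odd (absz (k + l))) X.
Proof.
by move=> hX w S nz; have [<- <-] := hX _ _ nz; rewrite odd_abs_add odd_deg.
Qed.

Lemma zhom_gid : zhom 1 1 (gid (cinf V) n d).
Proof.
apply: zhom_sum => a.
have /bihomE h1 := @bihom_xi (cinf V) n d a.
have /bihomE h2 := @bihom_theta (cinf V) n d a.
exact: (zhomM h1 h2).
Qed.

Lemma zhom_euler k l (X : csf) : zhom k l X -> cbr (gid (cinf V) n d) X = (l - k)%:~R * X.
Proof.
move=> hX; have [X0|nz] := eqVneq X 0.
  by rewrite X0 mulr0 /cbr (sp_0r (gbr_super_poisson d (@cderD R n V) (@cderM R n V))).
have [w [S nzS]] : exists w S, mcoeff w X S != 0.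
  apply: contrapT => no; case/eqP: nz; apply/mpolyP => w; apply/ffunP => S.
  rewrite mcoeff0 [RHS]ffunE; apply/eqP; apply: contrapT => /negP nz; apply: no.
  by exists w, S.
have [kE lE] := hX _ _ nzS; rewrite -kE -lE in hX *.
move/bihomE: hX => hX.
rewrite /cbr (gbr_gid (@cderD R n V) (@cderM R n V) hX).
by rewrite mulrzl mulrzBr -!pmulrn.
Qed.

(** The representing algebra satisfies all the axioms, whereas in the algebra of
    arbitrary functions the partial derivatives are not even additive. *)
Lemma csf_poisson :
  bigraded_poisson (@spar (cinf V) n d) (@zhom (cinf V) n d) (@cbr R n d V) (gid (cinf V) n d).
Proof.
split.
- exact: (gbr_super_poisson d (@cderD R n V) (@cderM R n V)).
- by move=> a b c x y z; exact: (gbr_jacobi (@cderD R n V) (@cderM R n V) (@cderC R n V)).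
- exact: csf_torsion.
- exact: zhom_spar.
- exact: zhomD.
- exact: zhomN.
- exact: zhomM.
- move=> k l k' l' x y; apply: zhom_gbr => i; exact: (der0 (@cderD R n V i)).
- exact: zhom_gid.
- exact: zhom_neg.
exact: zhom_euler.
Qed.

End ModelPoisson.

(** * Gluing of the expressions in charts *)
Section Precomp.
Variables (R : realType) (n n' : nat) (g : 'rV[R]_n' -> 'rV[R]_n).
Definition precomp (f : 'rV[R]_n -> R) : 'rV[R]_n' -> R := f \o g.
Fact precomp_zmod : zmod_morphism precomp. Proof. by []. Qed.
Fact precomp_monoid : monoid_morphism precomp. Proof. by []. Qed.
HB.instance Definition _ := GRing.isZmodMorphism.Build _ _ precomp precomp_zmod.
HB.instance Definition _ := GRing.isMonoidMorphism.Build _ _ precomp precomp_monoid.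
End Precomp.

Section PrecompModel.
Variables (R : realType) (n n' : nat) (V : odom R n') (W : odom R n) (g : 'rV[R]_n' -> 'rV[R]_n).

Definition smooth_map := (forall x, oset V x -> oset W (g x)) /\
  (forall f : 'rV[R]_n -> R, smooth_on (oset W) f -> smooth_on (oset V) (f \o g)).

Hypothesis gS : smooth_map.

Definition cpre (f : cinf W) : cinf V := mkcinf (gS.2 _ (cinfP f).1).

Lemma cpreE f x : oset V x -> cval (cpre f) x = cval f (g x).
Proof. exact: mkcinfE. Qed.

Fact cpre_zmod : zmod_morphism cpre.
Proof.
move=> f f'; apply: cinf_eq => x Vx.
by rewrite -[RHS]/(cval (cpre f) x - cval (cpre f') x) !cpreE.
Qed.
Fact cpre_monoid : monoid_morphism cpre.
Proof.
split=> [|f f']; apply: cinf_eq => x Vx.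
  rewrite cpreE // coneE ?coneE //; exact: gS.1.
rewrite cpreE // [LHS]cmulE ?[RHS]cmulE ?cpreE //; exact: gS.1.
Qed.
HB.instance Definition _ := GRing.isZmodMorphism.Build _ _ cpre cpre_zmod.
HB.instance Definition _ := GRing.isMonoidMorphism.Build _ _ cpre cpre_monoid.
End PrecompModel.

(** Substitutions in F and in its representative correspond to each other, as their
    values at a point are substitutions in the same values. *)
Section RepSubst.
Variables (R : realType) (n d n' d' : nat) (V : odom R n') (W : odom R n).
Variables (g : 'rV[R]_n' -> 'rV[R]_n) (th : {rmorphism cinf W -> cinf V}).
Local Notation Cf n := (('rV[R]_n -> R) : comNzRingType).
Local Notation csf := (mpoly n' (exterior (cinf V) (d' + d'))).
Hypothesis gVW : forall x, oset V x -> oset W (g x).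
Hypothesis thE : forall f x, oset V x -> cval (th f) x = cval f (g x).
Variables (e : 'I_(d + d) -> superfun R n' d') (p : 'I_n -> superfun R n' d').
Variables (e' : 'I_(d + d) -> csf) (p' : 'I_n -> csf).
Hypothesis e_odd : forall c, spar true (e c).
Hypothesis p_even : forall k, spar false (p k).
Hypothesis e'_odd : forall c, spar true (e' c).
Hypothesis p'_even : forall k, spar false (p' k).
Hypothesis e_sq : forall c, e c * e c = 0.
Hypothesis e'_sq : forall c, e' c * e' c = 0.
Hypothesis ee' : forall c, rep (e c) (e' c).
Hypothesis pp' : forall k, rep (p k) (p' k).

Lemma rep_ssub (F : superfun R n d) (X : mpoly n (exterior (cinf W) (d + d))) :
  rep F X -> rep (ssub (precomp g : {rmorphism Cf n -> Cf n'}) e p F) (ssub th e' p' X).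
Proof.
move=> HF x; pose y : {y | oset W y} := exist _ _ (gVW (svalP x)).
have E1 := @sfmap_ssub (Cf n) (Cf n') R n d n' d' (precomp g) (evr (sval x)) (evr (sval y))
  e p e_odd e_sq p_even (fun _ => erefl) _ _ F (fun c => ee' c x) (fun k => pp' k x).
have H2 f : evc x (th f) = evc y f by exact: (thE f (svalP x)).
have E2 := @sfmap_ssub (cinf W) (cinf V) R n d n' d' th (evc x) (evc y)
  e' p' e'_odd e'_sq p'_even H2 _ _ X (fun c => erefl) (fun k => erefl).
refine (eq_trans E1 _); rewrite (HF y).
exact: (esym E2).
Qed.
End RepSubst.

Section EqOn.
Variables (R : realType) (n d : nat) (V : set 'rV[R]_n).
Implicit Types (F G : superfun R n d).

Lemma sf_eq_onP F G : sf_eq_on V F G <->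
  forall x, V x -> sfmap n d (evr x) F = sfmap n d (evr x) G.
Proof.
split=> H => [x Vx|w S x Vx].
  by apply/mpolyP => w; apply/ffunP => S; rewrite 2!sfmap_coef; exact: H.
have := congr1 (fun G : mpoly n (exterior R (d + d)) => mcoeff w G S) (H x Vx).
by rewrite /= 2!sfmap_coef.
Qed.

Lemma eq_on_M F F' G G' : sf_eq_on V F F' -> sf_eq_on V G G' -> sf_eq_on V (F * G) (F' * G').
Proof.
move=> /sf_eq_onP H1 /sf_eq_onP H2; apply/sf_eq_onP => x Vx.
by rewrite [LHS]rmorphM [RHS]rmorphM H1 ?H2.
Qed.

Lemma eq_on_D F F' G G' : sf_eq_on V F F' -> sf_eq_on V G G' -> sf_eq_on V (F + G) (F' + G').
Proof.
move=> /sf_eq_onP H1 /sf_eq_onP H2; apply/sf_eq_onP => x Vx.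
by rewrite [LHS]rmorphD [RHS]rmorphD H1 ?H2.
Qed.

Lemma eq_on_N F F' : sf_eq_on V F F' -> sf_eq_on V (- F) (- F').
Proof.
move=> /sf_eq_onP H1; apply/sf_eq_onP => x Vx.
by rewrite [LHS]rmorphN [RHS]rmorphN H1.
Qed.

Lemma eq_on_sym F G : sf_eq_on V F G -> sf_eq_on V G F.
Proof. by move=> H w S x Vx; rewrite H. Qed.
Lemma eq_on_trans G F H : sf_eq_on V F G -> sf_eq_on V G H -> sf_eq_on V F H.
Proof. by move=> H1 H2 w S x Vx; rewrite H1 ?H2. Qed.
End EqOn.

Section Charts.
Variables (R : realType) (n d : nat).
Implicit Types (V : set 'rV[R]_n) (F : superfun R n d).

Definition chart_ok V k l F := sf_smooth_on V F /\ sf_bihom_on V k l F.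

Lemma odom_ex V : open V -> V = set0 \/ exists U : odom R n, oset U = V.
Proof.
move=> oV; have [[x Vx]|no] := pselect (exists x, V x).
  by right; exists (Odom oV Vx).
by left; apply/seteqP; split=> // x Vx; apply: no; exists x.
Qed.

Lemma chart_okP V k l F : open V ->
  chart_ok V k l F <-> forall U : odom R n, oset U = V ->
    exists2 X : mpoly n (exterior (cinf U) (d + d)), rep F X & bihom k l X.
Proof.
move=> oV; split=> [[sF hF] U UV|H].
  rewrite -UV in sF hF; have [X rX] := rep_ex sF; exists X => //.
  by apply/(rep_bihom k l rX).
case: (odom_ex oV) => [->|[U UV]].
  split; last by move=> w S x [].
  move=> w S r; elim: r (sf_coef w S F) => [|r IH] f; (split; first by move=> x []).
    by [].
  by move=> k0; split; [move=> x []|exact: IH].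
have [X rX hX] := H U UV; rewrite -UV; split; first exact: rep_smooth rX.
by apply/(rep_bihom k l rX).
Qed.

Lemma smooth_sub V W F : V `<=` W -> sf_smooth_on W F -> sf_smooth_on V F.
Proof. by move=> VW sF w S r; apply: Ck_sub (sF w S r). Qed.
End Charts.

Section RawTorsion.
Variables (R : realType) (n : nat).
Lemma fun_torsion (f : 'rV[R]_n -> R) : f + f = 0 -> f = 0.
Proof.
move=> ff; apply/funext => x; have := congr1 (fun g : 'rV[R]_n -> R => g x) ff.
by rewrite /= => /eqP; rewrite -[X in X == _]/(f x + f x) -mulr2n mulrn_eq0 /= => /eqP.
Qed.
End RawTorsion.

Section Bundle.
Variables (R : realType) (n d : nat) (A : vbundle R n d).
Implicit Types (i j : vb_idx A) (F G : cofun A).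
Local Notation sf := (superfun R n d).
Local Notation Cf := (('rV[R]_n -> R) : comNzRingType).

Lemma spar_sub_xi i j a : spar true (sub_xi i j a).
Proof.
apply: spar_sum => b; rewrite -[true]addFb; apply: sparM; first exact: spar_gf.
exact: (@spar_go Cf).
Qed.

Lemma spar_sub_theta i j a : spar true (sub_theta i j a).
Proof.
apply: spar_sum => b; rewrite -[true]addFb; apply: sparM; first exact: spar_gf.
exact: (@spar_go Cf).
Qed.

Lemma spar_sub_odd i j c : spar true (sub_odd i j c).
Proof.
by rewrite /sub_odd; case: fintype.split => a; [exact: spar_sub_xi|exact: spar_sub_theta].
Qed.

Lemma spar_sub_p i j k : spar false (sub_p i j k).
Proof.
apply: sparD; apply: spar_sum => l; last apply: spar_sum => b.
  by rewrite -[false]addFb; apply: sparM; [exact: spar_gf|exact: (@spar_gx Cf)].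
rewrite -[false]addFb; apply: sparM; first exact: spar_gf.
by rewrite -(addbb true); apply: sparM; [exact: spar_sub_xi|exact: (@spar_go Cf)].
Qed.

Arguments spar_sub_odd : clear implicits.
Arguments spar_sub_p : clear implicits.

Lemma sub_odd_sq i j c : sub_odd i j c * sub_odd i j c = 0.
Proof. by apply: odd_sq; [exact: fun_torsion|exact: spar_sub_odd]. Qed.

Definition pre i j := precomp (@vb_change R n d A i j) : {rmorphism Cf -> Cf}.

Lemma sf_changeE i j (F : sf) : sf_change i j F = ssub (pre i j) (sub_odd i j) (sub_p i j) F.
Proof. by rewrite ssubE. Qed.

Lemma sf_changeD i j (F G : sf) : sf_change i j (F + G) = sf_change i j F + sf_change i j G.
Proof. by rewrite !sf_changeE ssubD //; [exact: spar_sub_odd|exact: sub_odd_sq]. Qed.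

Lemma sf_changeM i j (F G : sf) : sf_change i j (F * G) = sf_change i j F * sf_change i j G.
Proof.
by rewrite !sf_changeE ssubM //; [exact: spar_sub_odd|exact: sub_odd_sq|exact: spar_sub_p].
Qed.

Lemma sf_changeN i j (F : sf) : sf_change i j (- F) = - sf_change i j F.
Proof. by rewrite !sf_changeE ssubN //; [exact: spar_sub_odd|exact: sub_odd_sq]. Qed.

Lemma sf_change0 i j : sf_change i j 0 = 0.
Proof.
rewrite sf_changeE.
exact: (ssub0 (pre i j) (sub_p i j) (spar_sub_odd i j) (sub_odd_sq i j)).
Qed.

Lemma sf_change_sum i j (I : finType) (F : I -> sf) :
  sf_change i j (\sum_a F a) = \sum_a sf_change i j (F a).
Proof. exact: (big_morph _ (@sf_changeD i j) (sf_change0 i j)). Qed.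

Lemma sf_change_fun i j f : sf_change i j (sf_fun d f) = sf_fun d (f \o vb_change i j).
Proof.
by rewrite sf_changeE [LHS]ssub_gf //; [exact: spar_sub_odd|exact: sub_odd_sq].
Qed.

Lemma sf_change_go i j c : sf_change i j (go Cf n c) = sub_odd i j c.
Proof. by rewrite sf_changeE ssub_go //; [exact: spar_sub_odd|exact: sub_odd_sq]. Qed.

Lemma sf_change_p i j k : sf_change i j (sf_p R d k) = sub_p i j k.
Proof. by rewrite sf_changeE [LHS]ssub_gx //; [exact: spar_sub_odd|exact: sub_odd_sq]. Qed.

Lemma sf_change_xi i j a : sf_change i j (sf_xi R n a) = sub_xi i j a.
Proof. by rewrite sf_change_go /sub_odd (unsplitK (inl _ a : 'I_d + 'I_d)). Qed.

Lemma sf_change_theta i j a : sf_change i j (sf_theta R n a) = sub_theta i j a.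
Proof. by rewrite sf_change_go /sub_odd (unsplitK (inr _ a : 'I_d + 'I_d)). Qed.

Lemma in_FE k l F : in_F k l F <->
  (forall i, chart_ok (vb_image i) k l (F i)) /\
  (forall i j, sf_eq_on (vb_overlap i j) (F i) (sf_change i j (F j))).
Proof.
split=> [[s [h c]]|[ok c]]; first by split=> // i; split.
by split=> [i|]; [exact: (ok i).1|split=> // i; exact: (ok i).2].
Qed.

Lemma overlap_open i j : open (vb_overlap i j : set 'rV[R]_n).
Proof. exact: vb_overlap_open. Qed.
Arguments overlap_open : clear implicits.

Lemma image_open i : open (vb_image i).
Proof. exact: vb_open_im. Qed.

Arguments image_open : clear implicits.

Lemma overlap_sub i j : vb_overlap i j `<=` vb_image i.
Proof. by move=> _ [m [im _] <-]; exists m. Qed.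

Lemma in_F_D k l F G : in_F k l F -> in_F k l G -> in_F k l (F + G).
Proof.
move=> /in_FE[okF cF] /in_FE[okG cG]; apply/in_FE; split=> [i|i j]; last first.
  by rewrite [X in sf_eq_on _ _ X]sf_changeD; exact: eq_on_D.
apply/chart_okP => [|U UV]; first exact: image_open.
have [X rX hX] := (chart_okP k l (F i) (image_open i)).1 (okF i) U UV.
have [Y rY hY] := (chart_okP k l (G i) (image_open i)).1 (okG i) U UV.
by exists (X + Y); [exact: rep_D|exact: bihomD].
Qed.

Lemma in_F_N k l F : in_F k l F -> in_F k l (- F).
Proof.
move=> /in_FE[okF cF]; apply/in_FE; split=> [i|i j]; last first.
  by rewrite [X in sf_eq_on _ _ X]sf_changeN; exact: eq_on_N.
apply/chart_okP => [|U UV]; first exact: image_open.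
have [X rX hX] := (chart_okP k l (F i) (image_open i)).1 (okF i) U UV.
by exists (- X); [exact: rep_N|exact: bihomN].
Qed.

Lemma in_F_M k l k' l' F G : in_F k l F -> in_F k' l' G -> in_F (k + k') (l + l') (F * G).
Proof.
move=> /in_FE[okF cF] /in_FE[okG cG]; apply/in_FE; split=> [i|i j]; last first.
  by rewrite [X in sf_eq_on _ _ X]sf_changeM; exact: eq_on_M.
apply/chart_okP => [|U UV]; first exact: image_open.
have [X rX hX] := (chart_okP k l (F i) (image_open i)).1 (okF i) U UV.
have [Y rY hY] := (chart_okP k' l' (G i) (image_open i)).1 (okG i) U UV.
by exists (X * Y); [exact: rep_M|exact: bihomM].
Qed.

Lemma change_overlap i j x : vb_overlap i j x -> vb_overlap j i (vb_change i j x).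
Proof. by move=> [m [im jm] <-]; exists m => //; rewrite /vb_change vb_chartK. Qed.

Lemma inv_change i j x : vb_overlap i j x -> vb_inv j (vb_change i j x) = vb_inv i x.
Proof. by move=> [m [im jm] <-]; rewrite /vb_change !vb_chartK. Qed.

Lemma change_changeK i j x : vb_overlap i j x -> vb_change j i (vb_change i j x) = x.
Proof. by move=> [m [im jm] <-]; rewrite /vb_change !vb_chartK. Qed.

Lemma inv_dom i j x : vb_overlap i j x -> vb_dom i (vb_inv i x) /\ vb_dom j (vb_inv i x).
Proof. by move=> [m [im jm] <-]; rewrite vb_chartK. Qed.

Lemma cocycle_mul i j a b m : vb_dom i m -> vb_dom j m ->
  \sum_c vb_cocycle i j a c m * vb_cocycle j i c b m = (a == b)%:R.
Proof.
move=> im jm; rewrite /vb_cocycle.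
have bi := basis_free (vb_frame_basis im).
have := coord_free b a bi; rewrite -tnth_nth eq_sym => <-.
rewrite [in RHS](coord_basis (vb_frame_basis jm) (memvf (tnth (vb_frame i m) b))).
rewrite linear_sum; apply: eq_bigr => c _.
by rewrite linearZ /= -tnth_nth [LHS]mulrC.

Qed.

Lemma smooth_cocycle i j a b :
  smooth_on (vb_overlap j i) (fun y => vb_cocycle i j a b (vb_inv j y)).
Proof.
move=> r; apply: (@Ck_eq _ _ _ _ ((fun x => vb_cocycle i j a b (vb_inv i x)) \o vb_change j i)).
- exact: vb_overlap_open.
- by move=> y Wy /=; rewrite (inv_change Wy).
apply: (@Ck_comp R n n r _ (vb_overlap i j)); try exact: vb_overlap_open.
- by move=> l; exact: vb_chart_smooth.
- by move=> y; exact: change_overlap.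
exact: vb_frame_smooth.
Qed.

Section Overlap.
Variables (i j : vb_idx A) (V W : odom R n).
Hypotheses (VE : oset V = vb_overlap i j) (WE : oset W = vb_overlap j i).
Local Notation csfV := (mpoly n (exterior (cinf V) (d + d))).
Local Notation csfW := (mpoly n (exterior (cinf W) (d + d))).

Lemma ov_in x : oset V x -> oset W (vb_change i j x).
Proof. by rewrite VE WE; exact: change_overlap. Qed.

Lemma ov_in' y : oset W y -> oset V (vb_change j i y).
Proof. by rewrite VE WE; exact: change_overlap. Qed.

Lemma smooth_th (f : 'rV[R]_n -> R) :
  smooth_on (oset W) f -> smooth_on (oset V) (f \o vb_change i j).
Proof.
move=> sf r; apply: (@Ck_comp R n n r _ (oset W)); try exact: oset_open.
- by move=> l; rewrite VE; exact: vb_chart_smooth.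
- exact: ov_in.
exact: sf.
Qed.

Definition ov_th : {rmorphism cinf W -> cinf V} := cpre (conj ov_in smooth_th).

Lemma ov_thE f x : oset V x -> cval (ov_th f) x = cval f (vb_change i j x).
Proof. exact: cpreE. Qed.

Lemma smooth_ov_X l : smooth_on (oset W) (fun y => vb_change j i y ord0 l).
Proof. by rewrite WE; exact: vb_chart_smooth. Qed.
Definition ov_X l : cinf W := mkcinf (smooth_ov_X l).

Lemma smooth_ov_h b a : smooth_on (oset W) (fun y => vb_cocycle i j b a (vb_inv j y)).
Proof. by rewrite WE; exact: smooth_cocycle. Qed.
Definition ov_h b a : cinf W := mkcinf (smooth_ov_h b a).

Lemma smooth_ov_q a b : smooth_on (oset V) (fun x => vb_cocycle j i a b (vb_inv i x)).
Proof. by rewrite VE; exact: smooth_cocycle. Qed.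
Definition ov_q a b : cinf V := mkcinf (smooth_ov_q a b).

(** As f is the composite of its image under [ov_th] with the inverse change of
    coordinates, this is the chain rule. *)
Lemma ov_chain k f : ov_th (cder k f) = \sum_l ov_th (cder k (ov_X l)) * cder l (ov_th f).
Proof.
apply: cinf_eq => x Vx; have Wy := ov_in Vx.
have cs (I : finType) (g : I -> cinf V) : cval (\sum_l g l) x = \sum_l cval (g l) x.
  by elim/big_rec2: _ => // l u v _ <-.
rewrite (ov_thE _ Vx) cs.
apply: etrans (cderE k f Wy) _.
have fE y : oset W y -> cval f y = (cval (ov_th f) \o vb_change j i) y.
  move=> Wy'; apply: etrans _ (esym (ov_thE f (ov_in' Wy'))).
  by rewrite change_changeK // -WE.
have PE := partial_near_eq k (@oset_open _ _ W) Wy fE.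
refine (eq_trans PE _).
have [_ CE] := @chain_rule R n n (oset W) (oset V) (vb_change j i) (cval (ov_th f)) k
  (vb_change i j x) (@oset_open _ _ W) (@oset_open _ _ V) (fun l => smooth_ov_X l 1)
  ov_in' ((cinfP (ov_th f)).1 1) Wy.
refine (eq_trans CE _).
apply: eq_bigr => l _; rewrite (cmulE _ _ Vx) mulrC (ov_thE _ Vx); congr (_ * _).
  apply: etrans _ (esym (cderE k _ Wy)).
  apply: (@partial_near_eq R n (oset W) _ _ k _ (@oset_open _ _ W) Wy) => y Wy'.
  by apply/esym; exact: mkcinfE.
by apply: etrans _ (esym (cderE l _ Vx)); rewrite change_changeK // -VE.
Qed.

Lemma ov_hq a b : \sum_c ov_q a c * ov_th (ov_h c b) = (a == b)%:R.
Proof.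
apply: cinf_eq => x Vx; have Wy := ov_in Vx.
have cs (I : finType) (g : I -> cinf V) : cval (\sum_l g l) x = \sum_l cval (g l) x.
  by elim/big_rec2: _ => // l u v _ <-.
have Vx' := Vx; rewrite VE in Vx'; have [im jm] := inv_dom Vx'.
transitivity ((a == b)%:R : R); last by case: (a == b); [rewrite coneE|].
rewrite cs -(cocycle_mul a b jm im); apply: eq_bigr => c _.
rewrite (cmulE _ _ Vx) (ov_thE _ Vx) (mkcinfE _ Vx) (mkcinfE _ Wy).
by rewrite inv_change.
Qed.

Lemma ov_hq' a b : \sum_c ov_th (ov_h a c) * ov_q c b = (a == b)%:R.
Proof.
apply: cinf_eq => x Vx; have Wy := ov_in Vx.
have cs (I : finType) (g : I -> cinf V) : cval (\sum_l g l) x = \sum_l cval (g l) x.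
  by elim/big_rec2: _ => // l u v _ <-.
have Vx' := Vx; rewrite VE in Vx'; have [im jm] := inv_dom Vx'.
transitivity ((a == b)%:R : R); last by case: (a == b); [rewrite coneE|].
rewrite cs -(cocycle_mul a b im jm); apply: eq_bigr => c _.
rewrite (cmulE _ _ Vx) (ov_thE _ Vx) (mkcinfE _ Vx) (mkcinfE _ Wy).
by rewrite inv_change.
Qed.

Definition ov_odd := chg_odd n ov_th ov_h ov_q.
Definition ov_p := chg_p (cder (V := W)) ov_th ov_X ov_h ov_q.
Definition ov_chg : csfW -> csfV := ssub ov_th ov_odd ov_p.

Lemma rep_xi a : rep (sub_xi i j a) (chg_xi n ov_q a).
Proof.
apply: rep_sum => b; apply: rep_M; last exact: rep_go.
by apply: rep_gf => x Vx; rewrite (mkcinfE _ Vx).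
Qed.

Lemma rep_theta a : rep (sub_theta i j a) (chg_theta n ov_th ov_h a).
Proof.
apply: rep_sum => b; apply: rep_M; last exact: rep_go.
apply: rep_gf => x Vx; rewrite (ov_thE _ Vx) (mkcinfE _ (ov_in Vx)) inv_change //.
by rewrite -VE.
Qed.

Lemma rep_odd c : rep (sub_odd i j c) (ov_odd c).
Proof.
by rewrite /sub_odd /ov_odd /chg_odd; case: fintype.split => a; [exact: rep_xi|exact: rep_theta].
Qed.

Lemma rep_p k : rep (sub_p i j k) (ov_p k).
Proof.
apply: rep_D; apply: rep_sum => l; last apply: rep_sum => b; apply: rep_M.
- apply: rep_gf => x Vx; rewrite (ov_thE _ Vx).
  apply: etrans _ (esym (cderE k _ (ov_in Vx))).
  apply: (@partial_near_eq R n (oset W) _ _ k _ (@oset_open _ _ W) (ov_in Vx)) => y Wy.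
  by apply/esym; exact: mkcinfE.
- exact: rep_gx.
- apply: rep_gf => x Vx; rewrite (ov_thE _ Vx).
  apply: etrans _ (esym (cderE k _ (ov_in Vx))).
  apply: (@partial_near_eq R n (oset W) _ _ k _ (@oset_open _ _ W) (ov_in Vx)) => y Wy.
  by apply/esym; exact: mkcinfE.
by apply: rep_M; [exact: rep_xi|exact: rep_go].
Qed.

Lemma spar_ov_odd c : spar true (ov_odd c).
Proof. exact: spar_chg_odd. Qed.
Arguments spar_ov_odd : clear implicits.

Lemma ov_odd_sq c : ov_odd c * ov_odd c = 0.
Proof. by apply: odd_sq; [exact: cinf_torsion|exact: spar_ov_odd]. Qed.
Lemma spar_ov_p k : spar false (ov_p k).
Proof. exact: spar_chg_p. Qed.
Arguments spar_ov_p : clear implicits.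

Lemma rep_change (F : sf) (X : csfW) : rep F X -> rep (sf_change i j F) (ov_chg X).
Proof.
move=> HF; rewrite sf_changeE.
exact: (@rep_ssub R n d n d V W (vb_change i j) ov_th ov_in ov_thE _ _ _ _
  (spar_sub_odd i j) (spar_sub_p i j) spar_ov_odd spar_ov_p (sub_odd_sq i j) ov_odd_sq
  rep_odd rep_p F X HF).
Qed.

Lemma ov_chg_br (b : bool) k (X Y : csfW) : spar b X -> bihom k 0%N Y ->
  ov_chg (cbr X Y) = cbr (ov_chg X) (ov_chg Y).
Proof.
apply: chg_br; try exact: cderD; try exact: cderM.
- exact: ov_chain.
- exact: ov_hq.
exact: cinf_torsion.
Qed.

End Overlap.

(** On the overlap the change of coordinates preserves the bracket because the second
    argument involves no xi and no momenta. *)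
Lemma in_F_bb k l k' F G : in_F k l.+1 F -> in_F k'.+1 0 G -> in_F (k + k') l (bb F G).
Proof.
move=> /in_FE[okF cF] /in_FE[okG cG]; apply/in_FE; split=> [i|i j].
  apply/chart_okP => [|U UV]; first exact: image_open.
  have [X rX hX] := (chart_okP _ _ (F i) (image_open i)).1 (okF i) U UV.
  have [Y rY hY] := (chart_okP _ _ (G i) (image_open i)).1 (okG i) U UV.
  exists (cbr X Y); first exact: rep_br.
  apply: (bihom_gbr _ hX hY); rewrite ?addnS ?addn0 // => m.
  exact: (der0 (@cderD R n U m)).
case: (odom_ex (overlap_open i j)) => [->|[V VE]]; first by move=> w S x [].
case: (odom_ex (overlap_open j i)) => [E0|[W WE]].
  have := opointP V; rewrite VE => /change_overlap; rewrite E0 => -[].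
have rp (H : cofun A) k0 l0 : chart_ok (vb_image j) k0 l0 (H j) ->
    exists2 X : mpoly n (exterior (cinf W) (d + d)), rep (H j) X & bihom k0 l0 X.
  move=> [sH hH]; have sH' : sf_smooth_on (oset W) (H j).
    by apply: smooth_sub sH; rewrite WE; exact: overlap_sub.
  have [X rX] := rep_ex sH'; exists X => //; apply/(rep_bihom k0 l0 rX) => w S x Wx.
  by apply: hH; apply: (@overlap_sub j i); rewrite -WE.
have [X rX hX] := rp _ _ _ (okF j); have [Y rY hY] := rp _ _ _ (okG j).
have rcX : rep (F i) (ov_chg VE WE X).
  by apply: rep_congr (rep_change VE WE rX); rewrite VE; apply: eq_on_sym; exact: cF.
have rcY : rep (G i) (ov_chg VE WE Y).
  by apply: rep_congr (rep_change VE WE rY); rewrite VE; apply: eq_on_sym; exact: cG.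
rewrite -VE; apply: (rep_eq_on (rep_br rcX rcY)).
rewrite -(ov_chg_br VE WE (bihom_spar hX) hY).
exact: (rep_change VE WE (rep_br rX rY)).
Qed.

Lemma in_F_id : in_F 1 1 (cf_id A).
Proof.
apply/in_FE; split=> [i|i j].
  apply/chart_okP => [|U UV]; first exact: image_open.
  exists (gid (cinf U) n d); last by apply/bihomE; exact: zhom_gid.
  by apply: rep_sum => a; apply: rep_M; exact: rep_go.
case: (odom_ex (overlap_open i j)) => [->|[V VE]]; first by move=> w S x [].
case: (odom_ex (overlap_open j i)) => [E0|[W WE]].
  have := opointP V; rewrite VE => /change_overlap; rewrite E0 => -[].
have r1 : rep (cf_id A i) (gid (cinf V) n d).
  by apply: rep_sum => a; apply: rep_M; exact: rep_go.
rewrite -VE; apply: (rep_eq_on r1).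
have -> : sf_change i j (cf_id A j) = \sum_a sub_xi i j a * sub_theta i j a.
  apply: etrans (sf_change_sum _ _ _) _; apply: eq_bigr => a _.
  by rewrite sf_changeM sf_change_xi sf_change_theta.
have -> := chg_gid n (ov_hq' VE WE).
by apply: rep_sum => a; apply: rep_M; [exact: rep_xi|exact: rep_theta].
Qed.

End Bundle.

(** * Gluing along inclusions of bundles *)
Section RawIncl.
Variables (R : realType) (n d n' d' : nat) (g : 'rV[R]_n' -> 'rV[R]_n).
Variables (r : 'I_d -> 'I_d') (s : 'I_n -> 'I_n').
Local Notation Cf n := (('rV[R]_n -> R) : comNzRingType).

Definition rincl : superfun R n d -> superfun R n' d' :=
  gincl (precomp g : {rmorphism Cf n -> Cf n'}) r s.

Lemma rep_rincl (V : odom R n') (W : odom R n) (gS : smooth_map V W g)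
    (F : superfun R n d) (X : mpoly n (exterior (cinf W) (d + d))) :
  rep F X -> rep (rincl F) (gincl (cpre gS) r s X : mpoly n' (exterior (cinf V) (d' + d'))).
Proof.
apply: (rep_ssub gS.1 (cpreE gS)) => [c|k|c|k|c|c|c|k].
- exact: (@spar_go (Cf n')).
- exact: (@spar_gx (Cf n')).
- exact: spar_go.
- exact: spar_gx.
- exact: (@go_sq (Cf n')).
- exact: go_sq.
- exact: rep_go.
exact: rep_gx.
Qed.

Lemma sfmap_rincl x (F : superfun R n d) :
  sfmap n' d' (evr x) (rincl F) = gincl (idfun : {rmorphism R -> R}) r s (sfmap n d (evr (g x)) F).
Proof.
apply: (@sfmap_ssub (Cf n) (Cf n') R n d n' d' (precomp g) (evr x) (evr (g x))).
- by move=> c; exact: (@spar_go (Cf n')).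
- by move=> c; exact: (@go_sq (Cf n')).
- by move=> k; exact: (@spar_gx (Cf n')).
- by [].
- by move=> c; rewrite sfmap_go.
by move=> k; rewrite sfmap_gx.
Qed.

Lemma rincl_eq_on V V' (F G : superfun R n d) : (forall x, V' x -> V (g x)) ->
  sf_eq_on V F G -> sf_eq_on V' (rincl F) (rincl G).
Proof.
move=> gV /sf_eq_onP H; apply/sf_eq_onP => x V'x.
by rewrite !sfmap_rincl H //; exact: gV.
Qed.

End RawIncl.

(** A sum over the coordinates of the larger bundle reduces to the smaller one when
    the terms of the extra coordinates vanish. *)
Lemma sum_inj (V : nmodType) (I J : finType) (r : I -> J) (F : J -> V) : injective r ->
  (forall j, (forall i, j != r i) -> F j = 0) -> \sum_j F j = \sum_i F (r i).
Proof.
move=> ri F0; rewrite (bigID (mem (codom r))) /= addrC big1 ?add0r => [|j /negP nj].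
  rewrite -[RHS](big_map r xpredT F) [RHS](perm_big (enum (codom r))) ?big_enum //=.
  apply: uniq_perm; rewrite ?enum_uniq ?map_inj_uniq ?index_enum_uniq //.
  move=> j; rewrite mem_enum.
  by apply/mapP/codomP => [[i _ ->]|[i ->]]; exists i; rewrite ?mem_index_enum.
by apply: F0 => i; apply/eqP => ji; apply: nj; rewrite ji codom_f.
Qed.

Section ChangeValues.
Variables (R : realType) (n d : nat) (A : vbundle R n d).
Implicit Types (i j : vb_idx A).
Local Notation sf := (superfun R n d).
Local Notation gf := (gf n d).
Local Notation go := (go R n).
Local Notation gx := (gx R d).

(** The expressions of the new coordinates frozen at a point x: a change of
    coordinates followed by the evaluation at x is the substitution of these in
    the values at the image of x ([ev_change]). *)
Definition xi_val i j x a : mpoly n (exterior R (d + d)) :=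
  \sum_b gf (vb_cocycle j i a b (vb_inv i x)) * go (lshift d b).
Definition theta_val i j x a : mpoly n (exterior R (d + d)) :=
  \sum_b gf (vb_cocycle i j b a (vb_inv i x)) * go (rshift d b).
Definition p_val i j x k : mpoly n (exterior R (d + d)) :=
  \sum_l gf (partial k (fun y => vb_change j i y ord0 l) (vb_change i j x)) * gx l +
  \sum_a \sum_b gf (partial k (fun y => vb_cocycle i j b a (vb_inv j y)) (vb_change i j x))
    * (xi_val i j x a * go (rshift d b)).
Definition odd_val i j x c := 
  match fintype.split c with inl a => xi_val i j x a | inr a => theta_val i j x a end.

Lemma ev_sum x (I : finType) (F : I -> sf) :
  sfmap n d (evr x) (\sum_a F a) = \sum_a sfmap n d (evr x) (F a).
Proof. exact: raddf_sum. Qed.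

Lemma ev_fun_mul x f (F : sf) :
  sfmap n d (evr x) (sf_fun d f * F) = gf (f x) * sfmap n d (evr x) F.
Proof. by rewrite rmorphM; congr (_ * _); exact: sfmap_gf. Qed.

Lemma ev_go x c : sfmap n d (evr x) (mpolyC n (egen _ c) : sf) = go c.
Proof. exact: sfmap_go. Qed.

Lemma ev_gx x k : sfmap n d (evr x) (sf_p R d k) = gx k.
Proof. exact: sfmap_gx. Qed.

Lemma ev_xi i j x a : sfmap n d (evr x) (sub_xi i j a) = xi_val i j x a.
Proof.
apply: etrans (ev_sum _ _) _; apply: eq_bigr => b _.
by rewrite ev_fun_mul ev_go.
Qed.

Lemma ev_theta i j x a : sfmap n d (evr x) (sub_theta i j a) = theta_val i j x a.
Proof.
apply: etrans (ev_sum _ _) _; apply: eq_bigr => b _.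
by rewrite ev_fun_mul ev_go.
Qed.

Lemma ev_odd i j x c : sfmap n d (evr x) (sub_odd i j c) = odd_val i j x c.
Proof.
by rewrite /sub_odd /odd_val; case: fintype.split => a; [exact: ev_xi|exact: ev_theta].
Qed.

Lemma ev_p i j x k : sfmap n d (evr x) (sub_p i j k) = p_val i j x k.
Proof.
apply: etrans (raddfD _ _ _) _; congr (_ + _).
  by apply: etrans (ev_sum _ _) _; apply: eq_bigr => l _; rewrite ev_fun_mul ev_gx.
apply: etrans (ev_sum _ _) _; apply: eq_bigr => a _.
apply: etrans (ev_sum _ _) _; apply: eq_bigr => b _; rewrite ev_fun_mul.
by congr (_ * _); apply: etrans (rmorphM _ _ _) _; congr (_ * _); [exact: ev_xi|exact: ev_go].
Qed.

Lemma ev_change i j x (F : sf) : sfmap n d (evr x) (sf_change i j F) =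
  ssub (idfun : {rmorphism R -> R}) (odd_val i j x) (p_val i j x)
    (sfmap n d (evr (vb_change i j x)) F).
Proof.
rewrite sf_changeE.
apply: (@sfmap_ssub (('rV[R]_n -> R) : comNzRingType) (('rV[R]_n -> R) : comNzRingType)
  R n d n d (pre i j) (evr x) (evr (vb_change i j x))).
- exact: spar_sub_odd.
- exact: sub_odd_sq.
- exact: spar_sub_p.
- by [].
- exact: ev_odd.
exact: ev_p.
Qed.

Lemma change_eq_on i j (F G : sf) :
  sf_eq_on (vb_image j) F G -> sf_eq_on (vb_overlap i j) (sf_change i j F) (sf_change i j G).
Proof.
move=> /sf_eq_onP H.
apply/sf_eq_onP => x Vx.
have Wy : vb_image j (vb_change i j x).
  by apply: (@overlap_sub _ _ _ _ j i); exact: change_overlap.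
have E1 := ev_change i j x F.
have E2 := ev_change i j x G.
have E3 := congr1 (ssub (idfun : {rmorphism R -> R}) (odd_val i j x) (p_val i j x)) (H _ Wy).
exact: (eq_trans E1 (eq_trans E3 (esym E2))).
Qed.

Lemma in_F_congr k l (F G : cofun A) : cf_eq F G -> in_F k l F -> in_F k l G.
Proof.
move=> FG [sF [hF cF]]; split; last split.
- move=> i w S r; apply: Ck_eq (sF i w S r); first exact: image_open.
  by move=> x Vx; exact: FG.
- by move=> i w S x Vx; rewrite -FG //; exact: hF.
move=> i j; apply: (eq_on_trans (G := F i)); last apply: (eq_on_trans (G := sf_change i j (F j))).
- apply: eq_on_sym => w S x Vx; apply: FG; exact: (@overlap_sub _ _ _ _ i j).
- exact: cF.
by apply: change_eq_on; exact: FG.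
Qed.
End ChangeValues.

Section ValueParity.
Variables (R : realType) (n d : nat) (A : vbundle R n d) (i j : vb_idx A) (x : 'rV[R]_n).

Lemma spar_xi_val a : spar true (xi_val i j x a).
Proof. by apply: spar_sum => b; rewrite -[true]addFb; apply: sparM; [exact: spar_gf|exact: spar_go]. Qed.

Lemma spar_theta_val a : spar true (theta_val i j x a).
Proof. by apply: spar_sum => b; rewrite -[true]addFb; apply: sparM; [exact: spar_gf|exact: spar_go]. Qed.

Lemma spar_odd_val c : spar true (odd_val i j x c).
Proof.
by rewrite /odd_val; case: fintype.split => a; [exact: spar_xi_val|exact: spar_theta_val].
Qed.

Lemma odd_val_sq c : odd_val i j x c * odd_val i j x c = 0.
Proof.
apply: odd_sq (@spar_odd_val c) => y /eqP.
by rewrite -mulr2n mulrn_eq0 => /eqP.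
Qed.

Lemma spar_p_val k : spar false (p_val i j x k).
Proof.
apply: sparD; apply: spar_sum => l; last apply: spar_sum => b.
  by rewrite -[false]addFb; apply: sparM; [exact: spar_gf|exact: spar_gx].
rewrite -[false]addFb; apply: sparM; first exact: spar_gf.
by rewrite -(addbb true); apply: sparM; [exact: spar_xi_val|exact: spar_go].
Qed.
End ValueParity.
Arguments spar_odd_val {R n d A} i j x c.
Arguments spar_p_val {R n d A} i j x k.

(** An inclusion of generators is compatible with changes of charts when the new
    coordinates of the larger bundle that come from the smaller one have the same
    expression there: the cocycles agree on the common generators and have no
    component along the extra ones, and their first derivatives do likewise. *)
Section Glue.
Variables (R : realType) (n d n' d' : nat) (A : vbundle R n d) (A' : vbundle R n' d').
Variables (g : 'rV[R]_n' -> 'rV[R]_n) (r : 'I_d -> 'I_d') (s : 'I_n -> 'I_n').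
Variable ix : vb_idx A' -> vb_idx A.
Implicit Types (i j : vb_idx A').
Hypotheses (r_inj : injective r) (s_inj : injective s).
Hypothesis g_image : forall i x, vb_image i x -> vb_image (ix i) (g x).
Hypothesis g_smooth : forall V f, smooth_on V f -> smooth_on (g @^-1` V) (f \o g).
Hypothesis g_overlap : forall i j x, vb_overlap i j x -> vb_overlap (ix i) (ix j) (g x).
Hypothesis g_change : forall i j x, vb_overlap i j x ->
  g (vb_change i j x) = vb_change (ix i) (ix j) (g x).
Hypothesis g_theta : forall i j x a b, vb_overlap i j x ->
  vb_cocycle i j (r b) (r a) (vb_inv i x) =
  vb_cocycle (ix i) (ix j) b a (vb_inv (ix i) (g x)).
Hypothesis g_theta0 : forall i j x a b', vb_overlap i j x -> (forall b, b' != r b) ->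
  vb_cocycle i j b' (r a) (vb_inv i x) = 0.
Hypothesis g_xi : forall i j x a b, vb_overlap i j x ->
  vb_cocycle j i (r a) (r b) (vb_inv i x) =
  vb_cocycle (ix j) (ix i) a b (vb_inv (ix i) (g x)).
Hypothesis g_xi0 : forall i j x a b', vb_overlap i j x -> (forall b, b' != r b) ->
  vb_cocycle j i (r a) b' (vb_inv i x) = 0.
Hypothesis g_X : forall i j x k l, vb_overlap i j x ->
  partial (s k) (fun y => vb_change j i y ord0 (s l)) (vb_change i j x) =
  partial k (fun y => vb_change (ix j) (ix i) y ord0 l) (vb_change (ix i) (ix j) (g x)).
Hypothesis g_X0 : forall i j x k l', vb_overlap i j x -> (forall l, l' != s l) ->
  partial (s k) (fun y => vb_change j i y ord0 l') (vb_change i j x) = 0.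
Hypothesis g_H : forall i j x k a b, vb_overlap i j x ->
  partial (s k) (fun y => vb_cocycle i j (r b) (r a) (vb_inv j y)) (vb_change i j x) =
  partial k (fun y => vb_cocycle (ix i) (ix j) b a (vb_inv (ix j) y))
    (vb_change (ix i) (ix j) (g x)).
Hypothesis g_H0 : forall i j x k a' b', vb_overlap i j x ->
  (forall b, b' != r b) \/ (forall a, a' != r a) ->
  partial (s k) (fun y => vb_cocycle i j b' a' (vb_inv j y)) (vb_change i j x) = 0.

Local Notation inc := (gincl (idfun : {rmorphism R -> R}) r s).

Lemma inc_sum (I : finType) (F : I -> mpoly n (exterior R (d + d))) :
  inc (\sum_a F a) = \sum_a inc (F a).
Proof. exact: (big_morph _ (ginclD _ r s) (gincl0 _ r s)). Qed.

Lemma inc_gf x : inc (gf n d x) = gf n' d' x.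
Proof. exact: (gincl_gval _ r s (Gf n d x)). Qed.

Lemma inc_go c : inc (go R n c) = go R n' (odd_ix r c).
Proof. exact: (gincl_gval _ r s (Go R n c)). Qed.

Lemma inc_gx k : inc (gx R d k) = gx R d' (s k).
Proof. exact: (gincl_gval _ r s (Gx R d k)). Qed.

Lemma inc_xi i j x a : vb_overlap i j x ->
  inc (xi_val (ix i) (ix j) (g x) a) = xi_val i j x (r a).
Proof.
move=> Wx; apply: etrans (inc_sum _) _; apply: esym.
apply: etrans (sum_inj r_inj _) _ => [b' b'r|]; first by rewrite g_xi0 // gf0 mul0r.
by apply: eq_bigr => b _; rewrite ginclM inc_gf inc_go odd_ix_l g_xi.
Qed.

Lemma inc_theta i j x a : vb_overlap i j x ->
  inc (theta_val (ix i) (ix j) (g x) a) = theta_val i j x (r a).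
Proof.
move=> Wx; apply: etrans (inc_sum _) _; apply: esym.
apply: etrans (sum_inj r_inj _) _ => [b' b'r|]; first by rewrite g_theta0 // gf0 mul0r.
by apply: eq_bigr => b _; rewrite ginclM inc_gf inc_go odd_ix_r g_theta.
Qed.

Lemma inc_odd i j x c : vb_overlap i j x ->
  inc (odd_val (ix i) (ix j) (g x) c) = odd_val i j x (odd_ix r c).
Proof.
move=> Wx; rewrite /odd_val; case: (split_ordP c) => a ->.
  by rewrite odd_ix_l (unsplitK (inl _ (r a))); exact: inc_xi.
by rewrite odd_ix_r (unsplitK (inr _ (r a))); exact: inc_theta.
Qed.

Lemma inc_p i j x k : vb_overlap i j x ->
  inc (p_val (ix i) (ix j) (g x) k) = p_val i j x (s k).
Proof.
move=> Wx; apply: etrans (ginclD _ _ _ _ _) _; congr (_ + _).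
  apply: etrans (inc_sum _) _; apply: esym.
  apply: etrans (sum_inj s_inj _) _ => [l' l's|]; first by rewrite g_X0 // gf0 mul0r.
  by apply: eq_bigr => l _; rewrite ginclM inc_gf inc_gx g_X.
apply: etrans (inc_sum _) _; apply: esym.
apply: etrans (sum_inj r_inj _) _ => [a' a'r|].
  by apply: big1 => b' _; rewrite g_H0 ?gf0 ?mul0r //; right.
apply: eq_bigr => a _; apply: esym; apply: etrans (inc_sum _) _; apply: esym.
apply: etrans (sum_inj r_inj _) _ => [b' b'r|].
  by rewrite g_H0 ?gf0 ?mul0r //; left.
by apply: eq_bigr => b _; rewrite 2!ginclM inc_gf inc_go odd_ix_r g_H // inc_xi.
Qed.

Lemma inc_change i j x (F : mpoly n (exterior R (d + d))) : vb_overlap i j x ->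
  inc (ssub (idfun : {rmorphism R -> R}) (odd_val (ix i) (ix j) (g x)) (p_val (ix i) (ix j) (g x)) F)
  = ssub (idfun : {rmorphism R -> R}) (odd_val i j x) (p_val i j x) (inc F).
Proof.
move=> Wx; set L := ssub _ _ _; set L' := ssub _ _ _.
have So := spar_odd_val (ix i) (ix j) (g x); have Sp := spar_p_val (ix i) (ix j) (g x).
have Sq := @odd_val_sq _ _ _ _ (ix i) (ix j) (g x).
have So' := spar_odd_val i j x; have Sp' := spar_p_val i j x; have Sq' := @odd_val_sq _ _ _ _ i j x.
apply: (@sf_morph_ext R n d _ (fun F => inc (L F)) (fun F => L' (inc F))) => [G H|G H|G H|G H|c].
- by rewrite /L ssubD // ginclD.
- by rewrite ginclD /L' ssubD.
- by rewrite /L ssubM // ginclM.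
- by rewrite ginclM /L' ssubM.
rewrite gincl_gval; case: c => [f|c|k] /=.
- by rewrite /L /L' ssub_gf // ssub_gf // inc_gf.
- by rewrite /L /L' ssub_go // ssub_go //; exact: inc_odd.
by rewrite /L /L' ssub_gx // ssub_gx //; exact: inc_p.
Qed.

Lemma rincl_change i j (F : superfun R n d) :
  sf_eq_on (vb_overlap i j) (rincl g r s (sf_change (ix i) (ix j) F))
    (sf_change i j (rincl g r s F)).
Proof.
apply/sf_eq_onP => x Wx.
apply: etrans (sfmap_rincl _ _ _ _ _) _; apply: esym; apply: etrans (ev_change _ _ _ _) _.
apply: esym; apply: etrans (congr1 inc (ev_change (ix i) (ix j) (g x) F)) _.
apply: etrans (inc_change _ Wx) _; congr ssub.
by apply: esym; apply: etrans (sfmap_rincl _ _ _ _ _) _; rewrite g_change.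
Qed.

Lemma in_F_incl k l (F : cofun A) (F' : cofun A') :
  (forall i, F' i = rincl g r s (F (ix i))) -> in_F k l F -> in_F k l F'.
Proof.
move=> FE /in_FE[okF cF]; apply/in_FE; split=> [i|i j]; last first.
  rewrite 2!FE; apply: (eq_on_trans (G := rincl g r s (sf_change (ix i) (ix j) (F (ix j))))).
    exact: (rincl_eq_on _ _ (@g_overlap i j) (cF (ix i) (ix j))).
  exact: rincl_change.
apply/chart_okP => [|V VE]; first exact: image_open.
have gV x : oset V x -> vb_image (ix i) (g x) by rewrite VE; exact: g_image.
case: (odom_ex (@image_open _ _ _ _ (ix i))) => [E0|[W WE]].
  by have := gV _ (opointP V); rewrite E0.
have gS : smooth_map V W g.
  split=> [x /gV|f sf q]; first by rewrite WE.
  by apply: Ck_sub (g_smooth sf q) => x /gV; rewrite -WE.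
have [X rX hX] := (chart_okP _ _ _ (@image_open _ _ _ _ (ix i))).1 (okF (ix i)) W WE.
exists (gincl (cpre gS) r s X); last exact: bihom_gincl.
by rewrite FE; exact: rep_rincl.
Qed.
End Glue.

(** * The sum with a line bundle and the pull-back *)
Section LineGlue.
Variables (R : realType) (n d : nat) (B : vbundle R n d).
Local Notation A := (add_line B).
Implicit Types (i j : vb_idx B) (k : 'I_(d + 1)).
Local Notation Cf := (('rV[R]_n -> R) : comNzRingType).

(** The transition matrices of the sum are block diagonal, with last block 1. *)
Lemma line_cocycle i j k k' m : vb_dom i m -> vb_cocycle (A := A) i j k k' m =
  match fintype.split k, fintype.split k' with
  | inl a, inl b => vb_cocycle (A := B) i j a b m
  | inr _, inr _ => 1
  | _, _ => 0
  end.
Proof.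
move=> im; rewrite /vb_cocycle /=.
case: (split_ordP k') => b ->; rewrite ?tnth_line_l ?tnth_line_r coord_line //.
by case: (fintype.split k) => a //; rewrite linear0.
Qed.

Lemma line_off (b' : 'I_(d + 1)) : (forall b, b' != lshift 1 b) -> exists c, b' = rshift d c.
Proof.
by case: (split_ordP b') => b -> H; [have := H b; rewrite eqxx|exists b].
Qed.

Lemma line_inclE (F : superfun R n d) :
  map_mpoly (eincl (@line_gen d)) F = rincl id (lshift 1) id F.
Proof.
refine (eq_trans _ (esym (@ginclE Cf Cf n d n (d + 1) (precomp id) (lshift 1) id F (fun _ _ => id)))).
rewrite /map_mpoly /mmap.
apply: eq_bigr => w _.
congr (_ * _).
congr (mpolyC _ _).
by apply/ffunP => S; rewrite [RHS]ffunE.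
Qed.

Lemma in_F_line (k l : nat) (F : cofun B) : in_F k l F -> in_F k l (line_incl F).
Proof.
apply: (@in_F_incl R n d n (d + 1) B A id (lshift 1) id (fun i : vb_idx A => i : vb_idx B)) => //.
- exact: lshift_inj.
- move=> i j x a b /inv_dom[im _].
  by rewrite line_cocycle // (unsplitK (inl _ a)) (unsplitK (inl _ b)).
- move=> i j x a b' /inv_dom[im _] /line_off[c ->].
  by rewrite line_cocycle // (unsplitK (inl _ a)) (unsplitK (inr _ c)).
- move=> i j x a b /inv_dom[_ jm].
  by rewrite line_cocycle // (unsplitK (inl _ a)) (unsplitK (inl _ b)).
- move=> i j x a b' /inv_dom[_ jm] /line_off[c ->].
  by rewrite line_cocycle // (unsplitK (inl _ a)) (unsplitK (inr _ c)).
- by move=> i j x k0 l' _ /(_ l'); rewrite eqxx.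
- move=> i j x k0 a b /change_overlap Wy.
  apply: (@partial_near_eq R n (vb_overlap (A := B) j i) _ _ k0 _ (@overlap_open _ _ _ B j i) Wy).
  move=> y /inv_dom[_ im].
  by rewrite line_cocycle // (unsplitK (inl _ a)) (unsplitK (inl _ b)).
- move=> i j x k0 a' b' /change_overlap Wy off.
  pose c0 : R := match fintype.split b', fintype.split a' with inr _, inr _ => 1 | _, _ => 0 end.
  apply: (@etrans _ _ (partial k0 (fun=> c0) (vb_change (A := B) i j x))); last exact: derive_cst.
  apply: (@partial_near_eq R n (vb_overlap (A := B) j i) _ _ k0 _ (@overlap_open _ _ _ B j i) Wy).
  move=> y /inv_dom[_ im]; rewrite line_cocycle // /c0.
  case: off => /line_off[c ->]; rewrite (unsplitK (inr _ c)).
    by case: (fintype.split a').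
  by case: (fintype.split b').
by move=> i; exact: line_inclE.
Qed.
End LineGlue.

Section PullGlue.
Variables (R : realType) (n d : nat) (A : vbundle R n d).
Local Notation pA := (pullback A).
Implicit Types (i j : vb_idx A).
Local Notation Cf n := (('rV[R]_n -> R) : comNzRingType).

Lemma eincl_id (C : comNzRingType) m (h : 'I_m -> 'I_m) (u : exterior C m) :
  (forall c, h c = c) -> eincl h u = u.
Proof.
move=> hc; apply/ffunP => S; rewrite ffunE.
have -> : h @^-1: S = S by apply/setP => c; rewrite inE hc.
case: ifP => // /negP SN; case: SN; apply/fintype.subsetP => c _.
by apply/imsetP; exists c; rewrite ?hc ?inE.
Qed.

Lemma odd_ix_id c : odd_ix (id : 'I_d -> 'I_d) c = c.
Proof. by case: (split_ordP c) => a ->; rewrite ?odd_ix_l ?odd_ix_r. Qed.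

Lemma pull_inclE (F : cofun A) i :
  pull_incl F i = rincl (lsubmx : 'rV[R]_(n + 1) -> _) id (lshift 1) (F i).
Proof.
refine (eq_trans _ (esym (@ginclE (Cf n) (Cf (n + 1)) n d (n + 1) d (precomp lsubmx) id (lshift 1)
  (F i) (fun _ _ => id)))).
rewrite /pull_incl /mmap; apply: eq_bigr => w _; congr (_ * _); congr (mpolyC _ _).
by rewrite (eincl_id _ odd_ix_id).
Qed.

Lemma pull_overlap i j x : vb_overlap (A := pA) i j x = vb_overlap (A := A) i j (lsubmx x).
Proof.
have := @pull_image R n d A i (vb_dom i `&` vb_dom j).
by move/(congr1 (fun S => S x)).
Qed.

Lemma pull_image_dom i x : vb_image (A := pA) i x = vb_image (A := A) i (lsubmx x).
Proof.
have := @pull_image R n d A i (vb_dom i).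
by move/(congr1 (fun S => S x)).
Qed.

Lemma pull_change i j x :
  lsubmx (vb_change (A := pA) i j x) = vb_change (A := A) i j (lsubmx x).
Proof. by rewrite /vb_change /= /pull_chart row_mxKl. Qed.

Lemma pull_change_t i j x :
  vb_change (A := pA) i j x ord0 (rshift n ord0) = x ord0 (rshift n ord0).
Proof. by rewrite /vb_change /= /pull_chart row_mxEr mxE eqxx mulr1n. Qed.

Lemma partial_lsubmx_l k (f : 'rV[R]_n -> R) x :
  partial (lshift 1 k) (f \o lsubmx) x = partial k f (lsubmx x).
Proof. by rewrite /partial derive_lsubmx lsubmx_delta_l. Qed.

Lemma partial_lsubmx_r (k : 'I_1) (f : 'rV[R]_n -> R) x : partial (rshift n k) (f \o lsubmx) x = 0.
Proof. by rewrite /partial derive_lsubmx lsubmx_delta_r derive0. Qed.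

Lemma partial_change_l i j k l x :
  partial k (fun y : 'rV[R]_(n + 1) => vb_change (A := pA) i j y ord0 (lshift 1 l)) x =
  partial k ((fun y => vb_change (A := A) i j y ord0 l) \o lsubmx) x.
Proof.
congr (partial k _ x); apply/funext => y.
by rewrite /vb_change /= /pull_chart row_mxEl.
Qed.

Lemma partial_change_t i j k x :
  partial k (fun y : 'rV[R]_(n + 1) => vb_change (A := pA) i j y ord0 (rshift n (ord0 : 'I_1))) x = (rshift n (ord0 : 'I_1) == k)%:R.
Proof.
have -> : (fun y : 'rV[R]_(n + 1) => vb_change (A := pA) i j y ord0 (rshift n (ord0 : 'I_1))) = (fun y : 'rV[R]_(n + 1) => y ord0 (rshift n ord0)).
  by apply/funext => y; exact: pull_change_t.
by have [_] := @derive_entry R (n + 1) k (rshift n ord0) x.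
Qed.

Lemma in_F_pull k l (F : cofun A) : in_F k l F -> in_F k l (pull_incl F).
Proof.
apply: (@in_F_incl R n d (n + 1) d A pA lsubmx id (lshift 1) (fun i : vb_idx pA => i : vb_idx A)).
- by [].
- exact: lshift_inj.
- by move=> i x; rewrite pull_image_dom.
- by move=> V f sf q; exact: Ck_lsubmx.
- by move=> i j x; rewrite pull_overlap.
- by move=> i j x _; exact: pull_change.
- by [].
- by move=> i j x a b' _ /(_ b'); rewrite eqxx.
- by [].
- by move=> i j x a b' _ /(_ b'); rewrite eqxx.
- move=> i j x k0 l0 _; rewrite partial_change_l partial_lsubmx_l.
  by rewrite pull_change.
- move=> i j x k0 l' _; case: (split_ordP l') => c -> H; first by have := H c; rewrite eqxx.
  by rewrite (ord1 c) partial_change_t eq_rlshift.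
- move=> i j x k0 a b _.
  refine (eq_trans (partial_lsubmx_l k0 (fun y => vb_cocycle (A := A) i j b a (@vb_inv R n d A j y)) _) _).
  by rewrite pull_change.
- by move=> i j x k0 a' b' _ [/(_ b')|/(_ a')]; rewrite eqxx.
exact: pull_inclE.
Qed.

(** The cocycles and the coordinates of the base do not depend on t, and t is
    unchanged: the new momentum of t is the old one. *)
Lemma in_F_partial_t : in_F 1 1 (partial_t A).
Proof.
apply/in_FE; split=> [i|i j].
  apply/chart_okP => [|U UV]; first exact: image_open.
  by exists (gx (cinf U) d (rshift n ord0)); [exact: rep_gx|exact: bihom_gx].
apply/sf_eq_onP => x Wx; rewrite ev_gx sf_change_p ev_p; apply: esym.
rewrite /p_val [X in _ + X]big1 ?addr0 => [|a _].
  rewrite (bigD1 (rshift n (ord0 : 'I_1))) //= big1 => [|l].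
    by rewrite addr0 partial_change_t eqxx gf1 mul1r.
  case: (split_ordP l) => l' -> nl; last by rewrite (ord1 l') eqxx in nl.
  by rewrite partial_change_l partial_lsubmx_r gf0 mul0r.
apply: big1 => b _.
have E := partial_lsubmx_r ord0 (fun y => vb_cocycle (A := A) i j b a (@vb_inv R n d A j y)) (vb_change (A := pA) i j x).
rewrite (_ : partial _ _ _ = 0) ?gf0 ?mul0r //; exact: E.
Qed.

Lemma in_F_exp_opp_t : in_F 0 0 (exp_opp_t A).
Proof.
apply/in_FE; split=> [i|i j].
  apply/chart_okP => [|U UV]; first exact: image_open.
  have oU := @oset_open _ _ U.
  pose e := mkcinf (smooth_exp_coord (rshift n ord0) (-1) oU).
  exists (gf (n + 1) d e); last exact: bihom_gf.
  by apply: rep_gf => x Ux; rewrite mkcinfE // mulN1r.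
apply/sf_eq_onP => x Wx; rewrite /exp_opp_t /cf_fun sf_change_fun.
congr (sfmap _ _ _ _); congr (sf_fun _ _); apply/funext => y /=.
by rewrite pull_change_t.
Qed.
End PullGlue.

Section LineSections.
Variables (R : realType) (n d : nat) (B : vbundle R n d).
Local Notation A := (add_line B).
Implicit Types (i j : vb_idx B).
Local Notation last := (rshift d (ord0 : 'I_1)).

Lemma line_coord_last i m a : vb_dom i m ->
  coord (line_frame i m) a ((0, 1) : line_fib m) = (a == last)%:R.
Proof.
move=> im; rewrite coord_line //; case: (split_ordP a) => b ->.
  by rewrite linear0 eq_lrshift.
by rewrite (ord1 b) eqxx.
Qed.

Lemma line_epsE : cf_eq (line_eps B) (fun i => sf_theta R n last).
Proof.
move=> i; apply/sf_eq_onP => x [m im <-]; rewrite ev_go.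
apply: etrans (ev_sum _ _) _; rewrite (bigD1 last) //= big1 => [|a al]; rewrite ev_fun_mul ev_go.
  by rewrite line_coord_last ?vb_chartK // eqxx gf1 mul1r addr0.
by rewrite line_coord_last ?vb_chartK // (negPf al) gf0 mul0r.
Qed.

Lemma line_phiE : cf_eq (line_phi B) (fun i => sf_xi R n last).
Proof.
move=> i; apply/sf_eq_onP => x _; rewrite ev_go.
apply: etrans (ev_sum _ _) _; rewrite big_split_ord big_ord1 big1 => [|a _]; rewrite ev_fun_mul ev_go /=.
  by rewrite tnth_line_r gf1 mul1r add0r.
by rewrite tnth_line_l gf0 mul0r.
Qed.

Lemma in_F_eps : in_F 1 0 (line_eps B).
Proof.
apply: (@in_F_congr _ _ _ A 1 0 (fun i => sf_theta R n last)).
  by move=> i; apply: eq_on_sym; exact: line_epsE.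
apply/in_FE; split=> [i|i j].
  apply/chart_okP => [|U UV]; first exact: image_open.
  by exists (go (cinf U) n (rshift (d + 1) last)); [exact: rep_go|exact: bihom_theta].
apply/sf_eq_onP => x /inv_dom[im _]; rewrite ev_go sf_change_theta ev_theta; apply: esym.
rewrite /theta_val (bigD1 last) //= big1 => [|a al].
  by rewrite line_cocycle // (unsplitK (inr _ ord0)) gf1 mul1r addr0.
rewrite line_cocycle // (unsplitK (inr _ ord0)).
case: (split_ordP a) al => b -> bl; first by rewrite gf0 mul0r.
by rewrite (ord1 b) eqxx in bl.
Qed.

Lemma in_F_phi : in_F 0 1 (line_phi B).
Proof.
apply: (@in_F_congr _ _ _ A 0 1 (fun i => sf_xi R n last)).
  by move=> i; apply: eq_on_sym; exact: line_phiE.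
apply/in_FE; split=> [i|i j].
  apply/chart_okP => [|U UV]; first exact: image_open.
  by exists (go (cinf U) n (lshift (d + 1) last)); [exact: rep_go|exact: bihom_xi].
apply/sf_eq_onP => x /inv_dom[_ jm]; rewrite ev_go sf_change_xi ev_xi; apply: esym.
rewrite /xi_val (bigD1 last) //= big1 => [|a al].
  by rewrite line_cocycle // (unsplitK (inr _ ord0)) gf1 mul1r addr0.
rewrite line_cocycle // (unsplitK (inr _ ord0)).
case: (split_ordP a) al => b -> bl; first by rewrite gf0 mul0r.
by rewrite (ord1 b) eqxx in bl.
Qed.
End LineSections.

(** * The Poissonization in a chart *)
Section ModelInclusions.
Variables (R : realType) (n d : nat) (W : odom R n) (V : odom R (n + 1)).
Hypothesis VW : oset V = (lsubmx : 'rV[R]_(n + 1) -> 'rV[R]_n) @^-1` oset W.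
Local Notation last d := (rshift d (ord0 : 'I_1)).
Local Notation csf n d V := (mpoly n (exterior (cinf V) (d + d))).

Lemma smooth_map_id : smooth_map W W id.
Proof. by split. Qed.

Lemma smooth_map_pull : smooth_map V W lsubmx.
Proof.
split=> [x|f sf r]; rewrite VW //.
exact: Ck_lsubmx.
Qed.

Definition line_model : csf n d W -> csf n (d + 1) W := gincl (cpre smooth_map_id) (lshift 1) id.
Definition pull_model e : csf n e W -> csf (n + 1) e V := gincl (cpre smooth_map_pull) id (lshift 1).
Arguments pull_model {e}.

Lemma cder_id k f : cder k (cpre smooth_map_id f) = cpre smooth_map_id (cder k f).
Proof.
apply: cinf_eq => x Wx; rewrite (cderE k _ Wx) (cpreE _ _ Wx) (cderE k _ Wx).
apply: (@partial_near_eq R n (oset W) _ _ k _ (@oset_open _ _ W) Wx) => y Wy.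
exact: cpreE.
Qed.

Lemma cder_pull_l k f :
  cder (lshift 1 k) (cpre smooth_map_pull f) = cpre smooth_map_pull (cder k f).
Proof.
apply: cinf_eq => x Vx; rewrite (cderE _ _ Vx) (cpreE _ _ Vx).
rewrite (cderE k _ (smooth_map_pull.1 _ Vx)) -partial_lsubmx_l.
apply: (@partial_near_eq R (n + 1) (oset V) _ _ _ _ (@oset_open _ _ V) Vx) => y Vy.
exact: cpreE.
Qed.

Lemma cder_pull_t f : cder (last n) (cpre smooth_map_pull f) = 0.
Proof.
apply: cinf_eq => x Vx; rewrite (cderE _ _ Vx).
apply: etrans (partial_lsubmx_r (n := n) ord0 (cval f) x).
apply: (@partial_near_eq R (n + 1) (oset V) _ _ _ _ (@oset_open _ _ V) Vx) => y Vy.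
exact: cpreE.
Qed.

Lemma line_model_br F G : line_model (cbr F G) = cbr (line_model F) (line_model G).
Proof.
apply: gincl_br; [exact: cderD|exact: cderM|exact: cderD|exact: cderM|exact: cder_id|].
exact: lshift_inj.
Qed.

Lemma pull_model_br e (F G : csf n e W) :
  pull_model (cbr F G) = cbr (pull_model F) (pull_model G).
Proof.
apply: gincl_br; [exact: cderD|exact: cderM|exact: cderD|exact: cderM|exact: cder_pull_l|].
by [].
Qed.

Lemma conj_ix_l e (a : 'I_e) : conj_ix (lshift e a) = rshift e a.
Proof. by rewrite /conj_ix (unsplitK (inl _ a)). Qed.

Lemma conj_ix_r e (a : 'I_e) : conj_ix (rshift e a) = lshift e a.
Proof. by rewrite /conj_ix (unsplitK (inr _ a)). Qed.

Lemma phi_line_model F : cbr (go (cinf W) n (lshift (d + 1) (last d))) (line_model F) = 0.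
Proof.
apply: (gincl_br0 (@cderD R n W) (@cderM R n W) (g' := Go _ _ (lshift (d + 1) (last d)))).
case=> [f|c|k] //=; rewrite conj_ix_l.
by case: (split_ordP c) => a ->; rewrite ?odd_ix_l ?odd_ix_r ?eq_lrshift // (inj_eq (@rshift_inj _ _)) eq_lrshift.
Qed.

Lemma eps_line_model F : cbr (go (cinf W) n (rshift (d + 1) (last d))) (line_model F) = 0.
Proof.
apply: (gincl_br0 (@cderD R n W) (@cderM R n W) (g' := Go _ _ (rshift (d + 1) (last d)))).
case=> [f|c|k] //=; rewrite conj_ix_r.
by case: (split_ordP c) => a ->; rewrite ?odd_ix_l ?odd_ix_r ?eq_rlshift // (inj_eq (@lshift_inj _ _)) eq_lrshift.
Qed.

(** The pull-backs do not depend on t. *)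
Lemma pt_pull_model e (F : csf n e W) : cbr (gx (cinf V) e (last n)) (pull_model F) = 0.
Proof.
apply: (gincl_br0 (@cderD R _ V) (@cderM R _ V) (g' := Gx _ _ (last n))).
by case=> [f|c|k] //=; exact: cder_pull_t.
Qed.

Definition exp_t (c : R) : cinf V := mkcinf (smooth_exp_coord (last n) c (@oset_open _ _ V)).

Lemma cder_exp_t_l (c : R) k : cder (lshift 1 k) (exp_t c) = 0.
Proof.
apply: cinf_eq => x Vx; rewrite (cderE _ _ Vx).
apply: (@etrans _ _ (partial (lshift 1 k) (fun x => expR (c * x ord0 (last n))) x)).
  apply: (@partial_near_eq R (n + 1) (oset V) _ _ _ _ (@oset_open _ _ V) Vx) => y Vy.
  exact: mkcinfE.
by rewrite partial_exp_coord eq_rlshift mulr0 mul0r.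
Qed.

Lemma cder_exp_t : cder (last n) (exp_t (- 1)) = - exp_t (- 1).
Proof.
apply: cinf_eq => x Vx; rewrite (cderE _ _ Vx).
apply: (@etrans _ _ (partial (last n) (fun x => expR (- 1 * x ord0 (last n))) x)).
  apply: (@partial_near_eq R (n + 1) (oset V) _ _ _ _ (@oset_open _ _ V) Vx) => y Vy.
  exact: mkcinfE.
rewrite partial_exp_coord eqxx mulr1; apply: etrans (mulN1r _) _.
exact: (congr1 -%R (esym (@mkcinfE R (n + 1) V _ (smooth_exp_coord (last n) (- 1) (@oset_open _ _ V)) x Vx))). 
Qed.

Lemma exp_t_mul : exp_t 1 * exp_t (- 1) = 1.
Proof.
apply: cinf_eq => x Vx; rewrite (cmulE _ _ Vx) (coneE Vx) /exp_t !(mkcinfE _ Vx).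
by rewrite -expRD mul1r mulN1r addrN expR0.
Qed.

(** The pull-backs do not involve the momentum of t. *)
Lemma s_pull_model e (c : R) (F : csf n e W) : cbr (gf (n + 1) e (exp_t c)) (pull_model F) = 0.
Proof.
apply: (gincl_br0 (@cderD R _ V) (@cderM R _ V) (g' := Gf _ _ (exp_t c))).
by case=> [f|c'|k] //=; rewrite cder_exp_t_l oppr0.
Qed.
End ModelInclusions.

Section JacobiModel.
Variables (R : realType) (n d : nat) (W : odom R n) (V : odom R (n + 1)).
Hypothesis VW : oset V = (lsubmx : 'rV[R]_(n + 1) -> 'rV[R]_n) @^-1` oset W.
Local Notation last d := (rshift d (ord0 : 'I_1)).
Local Notation csf n d V := (mpoly n (exterior (cinf V) (d + d))).
Local Notation KW := (csf n (d + 1) W).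
Local Notation KV := (csf (n + 1) (d + 1) V).
Variables (XM XP XE : csf n d W).
Hypotheses (hM : bihom 1 2 XM) (hP : bihom 2 0 XP) (hE : bihom 1 0 XE).
Hypothesis MM : cbr XM XM = 0.
Hypothesis PMP : cbr (cbr XP XM) XP = - (XE * XP *+ 2).
Hypothesis EMP : cbr (cbr XE XM) XP = 0.

Local Notation i1 := (@line_model R n d W).
Local Notation i2 := (@pull_model R n W V VW (d + 1)).
Definition m_phi : KW := go (cinf W) n (lshift (d + 1) (last d)).
Definition m_eps : KW := go (cinf W) n (rshift (d + 1) (last d)).
Definition m_pt : KV := gx (cinf V) (d + 1) (last n).
Definition m_exp (c : R) : KV := gf (n + 1) (d + 1) (exp_t V c).

Lemma i1_0 : i1 0 = 0. Proof. exact: gincl0. Qed.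
Lemma i1_D F G : i1 (F + G) = i1 F + i1 G. Proof. exact: ginclD. Qed.
Lemma i1_N F : i1 (- F) = - i1 F. Proof. exact: ginclN. Qed.
Lemma i1_M F G : i1 (F * G) = i1 F * i1 G. Proof. exact: ginclM. Qed.
Lemma i2_0 : i2 0 = 0. Proof. exact: gincl0. Qed.
Lemma i2_D F G : i2 (F + G) = i2 F + i2 G. Proof. exact: ginclD. Qed.
Lemma i2_N F : i2 (- F) = - i2 F. Proof. exact: ginclN. Qed.
Lemma i2_M F G : i2 (F * G) = i2 F * i2 G. Proof. exact: ginclM. Qed.

Lemma hom_i1 k l (F : csf n d W) : bihom k l F -> bihom k l (i1 F).
Proof. exact: bihom_gincl. Qed.

Lemma hom_i2 k l (F : KW) : bihom k l F -> zhom k%:Z l%:Z (i2 F).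
Proof. by move=> hF; apply/bihomE; exact: bihom_gincl. Qed.

Lemma m_phi_eps : cbr m_phi m_eps = 1.
Proof.
apply: etrans (gbr_gval (@cderD R n W) (@cderM R n W) (Go _ _ (lshift (d + 1) (last d)))
  (Go _ _ (rshift (d + 1) (last d)))) _.
by rewrite /gtab conj_ix_l eqxx gf1.
Qed.

Lemma m_id_split : gid (cinf W) n (d + 1) = i1 (gid (cinf W) n d) + m_phi * m_eps.
Proof.
rewrite /line_model gincl_gid {1}/gid big_split_ord.
by congr (_ + _); rewrite big_ord1.
Qed.

Lemma m_id_pull : gid (cinf V) (n + 1) (d + 1) = i2 (gid (cinf W) n (d + 1)).
Proof. by rewrite /pull_model gincl_gid. Qed.

Lemma i2_1 : i2 1 = 1.
Proof.
rewrite -(gf1 (cinf W) n (d + 1)).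
apply: etrans (gincl_gval _ _ _ (Gf _ _ 1)) _.
by rewrite /= rmorph1 gf1.
Qed.

(** The relations between B, phi and eps are transported along the inclusions, which
    preserve brackets. *)
Lemma m_jacobi_data : jacobi_data (@zhom (cinf V) (n + 1) (d + 1)) (@cbr R (n + 1) (d + 1) V)
  (gid (cinf V) (n + 1) (d + 1)) (i2 (i1 XM)) (i2 m_phi) (i2 m_eps) (i2 (i1 XP)) (i2 (i1 XE))
  m_pt (m_exp (- 1)) (m_exp 1) (i2 (i1 (gid (cinf W) n d))).
Proof.
have i2B := @pull_model_br R n W V VW (d + 1).
have i1B := @line_model_br R n d W.
have hs c : zhom 0 0 (m_exp c) by have /bihomE := @bihom_gf (cinf V) (n + 1) (d + 1) (exp_t V c).
split.
- exact: (hom_i2 (hom_i1 hM)).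
- exact: (hom_i2 (@bihom_xi (cinf W) n (d + 1) (last d))).
- exact: (hom_i2 (@bihom_theta (cinf W) n (d + 1) (last d))).
- exact: (hom_i2 (hom_i1 hP)).
- exact: (hom_i2 (hom_i1 hE)).
- by have /bihomE := @bihom_gx (cinf V) (n + 1) (d + 1) (last n).
- exact: hs.
- exact: hs.
- by rewrite -i2B -i1B MM i1_0 i2_0.
- rewrite -!i2B -!i1B PMP i1_N i2_N; congr (- _).
  by rewrite mulr2n i1_D i2_D i1_M i2_M -mulr2n.
- by rewrite -!i2B -!i1B EMP i1_0 i2_0.
- by rewrite -i2B m_phi_eps i2_1.
- by rewrite -i2B phi_line_model i2_0.
- by rewrite -i2B phi_line_model i2_0.
- by rewrite -i2B phi_line_model i2_0.
- by rewrite -i2B eps_line_model i2_0.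
- apply: etrans (gbr_gval (@cderD R _ V) (@cderM R _ V) (Gx _ _ (last n)) (Gf _ _ (exp_t V (- 1)))) _.
  by rewrite /gtab cder_exp_t gfN.
- exact: s_pull_model.
- exact: s_pull_model.
- exact: pt_pull_model.
- exact: pt_pull_model.
- exact: pt_pull_model.
- exact: pt_pull_model.
- exact: pt_pull_model.
- by rewrite /m_exp -gfM exp_t_mul gf1.
by rewrite m_id_pull m_id_split i2_D i2_M.
Qed.
End JacobiModel.

(** Setting the extra momentum to zero is a left inverse. *)
Lemma gincl_add_coord_inj (C : comNzRingType) n d :
  injective (gincl (idfun : {rmorphism C -> C}) (id : 'I_d -> 'I_d) (lshift 1 : 'I_n -> 'I_(n + 1))).
Proof.
pose p (k : 'I_(n + 1)) : mpoly n (exterior C (d + d)) :=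
  match fintype.split k with inl k' => gx C d k' | inr _ => 0 end.
have p_even k : spar false (p k).
  by rewrite /p; case: fintype.split => k'; [exact: spar_gx|exact: spar0].
have e_odd c : spar true (go C n c : mpoly n (exterior C (d + d))) by exact: spar_go.
have e_sq (c : 'I_(d + d)) := go_sq C n c.
pose ret : mpoly (n + 1) (exterior C (d + d)) -> mpoly n (exterior C (d + d)) :=
  ssub (idfun : {rmorphism C -> C}) (go C n (d := d)) p.
apply: (@can_inj _ _ _ ret); apply: (@sf_morph_ext C n d _ (fun F => ret (gincl _ _ _ F)) id) => //.
- by move=> F G; rewrite ginclD /ret ssubD.
- by move=> F G; rewrite ginclM /ret ssubM.
case=> [f|c|k]; rewrite gincl_gval /= /ret.
- by rewrite ssub_gf.
- by rewrite ssub_go // odd_ix_id.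
by rewrite ssub_gx // /p (unsplitK (inl _ k)).
Qed.

Section PullInjective.
Variables (R : realType) (n d : nat) (W : odom R n) (V : odom R (n + 1)).
Hypothesis VW : oset V = (lsubmx : 'rV[R]_(n + 1) -> 'rV[R]_n) @^-1` oset W.

(** An identity on A may be checked after pulling back: the values at (x, 0) determine
    those at x. *)
Lemma pull_model_eq_on (F G : superfun R n d) X Y : rep (V := W) F X -> rep (V := W) G Y ->
  pull_model VW X = pull_model VW Y -> sf_eq_on (oset W) F G.
Proof.
move=> rX rY XY; apply/sf_eq_onP => x Wx.
pose z : 'rV[R]_(n + 1) := row_mx x 0.
have zx : lsubmx z = x by exact: row_mxKl.
have Vz : oset V z by rewrite VW /preimage /= zx.
have H := rep_rincl id (lshift 1) (smooth_map_pull VW).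
have E1 := H _ _ _ rX (exist _ z Vz); have E2 := H _ _ _ rY (exist _ z Vz).
have E : sfmap (n + 1) d (evr z) (rincl lsubmx id (lshift 1) F) =
    sfmap (n + 1) d (evr z) (rincl lsubmx id (lshift 1) G).
  exact: (eq_trans E1 (eq_trans (congr1 (sfmap (n + 1) d (evc (exist _ z Vz))) XY) (esym E2))).
have EF := @sfmap_rincl R n d (n + 1) d lsubmx id (lshift 1) z F.
have EG := @sfmap_rincl R n d (n + 1) d lsubmx id (lshift 1) z G.
rewrite zx in EF EG.
apply: (@gincl_add_coord_inj R n d).
exact: (eq_trans (esym EF) (eq_trans E EG)).
Qed.
End PullInjective.

(** The conditions on A follow from their pull-backs, where s is available. The
    multivectors are sums of homogeneous ones, and the conditions are additive. *)
Section OnA.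
Variables (R : realType) (n d : nat) (W : odom R n) (V : odom R (n + 1)).
Hypothesis VW : oset V = (lsubmx : 'rV[R]_(n + 1) -> 'rV[R]_n) @^-1` oset W.
Local Notation csf n d V := (mpoly n (exterior (cinf V) (d + d))).
Local Notation KW := (csf n (d + 1) W).
Variables (XM XP XE : csf n d W).
Hypotheses (hM : bihom 1 2 XM) (hP : bihom 2 0 XP) (hE : bihom 1 0 XE).
Hypothesis MM : cbr XM XM = 0.
Hypothesis PMP : cbr (cbr XP XM) XP = - (XE * XP *+ 2).
Hypothesis EMP : cbr (cbr XE XM) XP = 0.
Local Notation i1 := (@line_model R n d W).
Local Notation i2 := (@pull_model R n W V VW (d + 1)).
Let JD := m_jacobi_data VW hM hP hE MM PMP EMP.
Let BP := csf_poisson (d + 1) V.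

Definition m_jd : KW -> KW :=
  jd (@cbr R n (d + 1) W) (i1 XM) (m_phi d W) (m_eps d W) (i1 XP) (i1 XE) (i1 (gid (cinf W) n d)).
Definition m_jbr : KW -> KW -> KW :=
  jbr (@cbr R n (d + 1) W) (gid (cinf W) n (d + 1)) (i1 XM) (m_phi d W).

Local Notation jd2 := (jd (@cbr R (n + 1) (d + 1) V) (i2 (i1 XM)) (i2 (m_phi d W)) (i2 (m_eps d W))
  (i2 (i1 XP)) (i2 (i1 XE)) (i2 (i1 (gid (cinf W) n d)))).
Local Notation jbr2 := (jbr (@cbr R (n + 1) (d + 1) V) (gid (cinf V) (n + 1) (d + 1))
  (i2 (i1 XM)) (i2 (m_phi d W))).

Lemma i2_jd c : i2 (m_jd c) = jd2 (i2 c).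
Proof.
exact: (morph_jd (i2_D VW) (i2_N VW) (i2_M VW) (@pull_model_br R n W V VW (d + 1))).
Qed.

Lemma i2_jbr a b : i2 (m_jbr a b) = jbr2 (i2 a) (i2 b).
Proof.
rewrite (m_id_pull d VW).
exact: (morph_jbr (i2_D VW) (i2_N VW) (i2_M VW) (@pull_model_br R n W V VW (d + 1))).
Qed.

Lemma tfree_i2 k (c : KW) : bihom k 0 c ->
  tfree (@spar (cinf V) (n + 1) (d + 1)) (@cbr R (n + 1) (d + 1) V) (m_pt d V) (m_exp d V (- 1))
    (odd k) (i2 c).
Proof.
move=> hc; split; last by exact: pt_pull_model.
  by apply: spar_gincl; have := bihom_spar hc; rewrite addn0.
exact: s_pull_model.
Qed.

Lemma m_jd_jd k c : bihom k 0 c -> i2 (m_jd (m_jd c)) = 0.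
Proof.
move=> hc; rewrite 2!i2_jd.
exact: (jd_jd BP JD (hom_i2 hc) (tfree_i2 hc)).
Qed.

Lemma m_jd_jbr k l a b : bihom k 0 a -> bihom l 0 b ->
  i2 (m_jd (m_jbr a b)) = i2 (m_jbr (m_jd a) b + (-1) ^+ k.+1 * m_jbr a (m_jd b)).
Proof.
move=> ha hb.
have EX : i2 (m_jbr (m_jd a) b) = jbr2 (jd2 (i2 a)) (i2 b).
  exact: (eq_trans (i2_jbr (m_jd a) b) (congr1 (jbr2^~ (i2 b)) (i2_jd a))).
have EY : i2 (m_jbr a (m_jd b)) = jbr2 (i2 a) (jd2 (i2 b)).
  exact: (eq_trans (i2_jbr a (m_jd b)) (congr1 (jbr2 (i2 a)) (i2_jd b))).
have EL : i2 (m_jd (m_jbr a b)) = jd2 (jbr2 (i2 a) (i2 b)).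
  exact: (eq_trans (i2_jd (m_jbr a b)) (congr1 jd2 (i2_jbr a b))).
have E := jd_jbr BP JD (hom_i2 ha) (hom_i2 hb) (tfree_i2 ha) (tfree_i2 hb).
apply: (eq_trans EL); apply: (eq_trans E); rewrite -EX -EY.
move: (m_jbr (m_jd a) b) (m_jbr a (m_jd b)) => X Y; rewrite -signr_odd /=.
rewrite (i2_D VW X); congr (_ + _); case: (odd k); rewrite /sg /= ?expr0 ?expr1.
  by rewrite mul1r.
by rewrite mulN1r i2_N.
Qed.

Lemma m_jdD c c' : m_jd (c + c') = m_jd c + m_jd c'.
Proof. exact: (jd_add (gbr_addr (@cderD R n W))). Qed.

Lemma m_jd0 : m_jd 0 = 0.
Proof. by apply: (addrI (m_jd 0)); rewrite -m_jdD !addr0. Qed.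

Lemma m_jbrD a b b' : m_jbr a (b + b') = m_jbr a b + m_jbr a b'.
Proof. exact: (jbr_add (gbr_addr (@cderD R n W))). Qed.

Lemma m_jbr0 a : m_jbr a 0 = 0.
Proof. by apply: (addrI (m_jbr a 0)); rewrite -m_jbrD !addr0. Qed.

Lemma m_jd_jd_sum N (Q : nat -> KW) : (forall k, bihom k 0 (Q k)) ->
  i2 (m_jd (m_jd (\sum_(k < N) Q k))) = 0.
Proof.
move=> hQ; elim/big_ind: _ => [|x y ex ey|k _]; last exact: (m_jd_jd (hQ k)).
  by rewrite !m_jd0 i2_0.
have E : m_jd (m_jd (x + y)) = m_jd (m_jd x) + m_jd (m_jd y).
  exact: (eq_trans (congr1 m_jd (m_jdD x y)) (m_jdD _ _)).
apply: (eq_trans (congr1 i2 E)); apply: (eq_trans (i2_D VW _ _)).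
exact: (eq_trans (congr2 +%R ex ey) (addr0 0)).
Qed.

Lemma m_jd_jbr_sum N (Q : nat -> KW) k a : bihom k 0 a -> (forall k, bihom k 0 (Q k)) ->
  let b := \sum_(k < N) Q k in
  i2 (m_jd (m_jbr a b)) = i2 (m_jbr (m_jd a) b + (-1) ^+ k.+1 * m_jbr a (m_jd b)).
Proof.
move=> ha hQ /=; elim/big_ind: _ => [|x y ex ey|l _]; last exact: (m_jd_jbr ha (hQ l)).
  by rewrite !(m_jbr0, m_jd0) mulr0 addr0.
pose r z := m_jbr (m_jd a) z + (-1) ^+ k.+1 * m_jbr a (m_jd z).
have rD : r (x + y) = r x + r y.
  rewrite /r; have -> := m_jbrD (m_jd a) x y; have -> := m_jdD x y.
  by have -> := m_jbrD a (m_jd x) (m_jd y); rewrite mulrDr addrACA.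
have lD : m_jd (m_jbr a (x + y)) = m_jd (m_jbr a x) + m_jd (m_jbr a y).
  exact: (eq_trans (congr1 m_jd (m_jbrD a x y)) (m_jdD _ _)).
apply: (eq_trans (congr1 i2 lD)); apply: (eq_trans (i2_D VW _ _)).
apply: (eq_trans (congr2 +%R ex ey)); apply: (eq_trans (esym (i2_D VW _ _))).
exact: (congr1 i2 (esym rD)).
Qed.
End OnA.

(** * The structures on A and on its pull-back *)
Section ChartModel.
Variables (R : realType) (n d : nat) (B : vbundle R n d) (muB piB EB : cofun B).
Hypotheses (LB : lie_algebroid muB) (JB : jacobi_structure muB piB EB).
Local Notation A := (add_line B).
Local Notation pA := (pullback A).
Local Notation mu := (line_incl muB).
Local Notation pi := (line_incl piB).
Local Notation E := (line_incl EB).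
Local Notation idB := (line_incl (cf_id B)).
Local Notation eps := (line_eps B).
Local Notation phi := (line_phi B).
Local Notation nuA := (bb pi mu + phi * pi + eps * bb mu E - E * idB : cofun A).
Variables (i : vb_idx B) (W : odom R n) (V : odom R (n + 1)).
Hypothesis WE : oset W = vb_image (A := B) i.
Hypothesis VW : oset V = (lsubmx : 'rV[R]_(n + 1) -> 'rV[R]_n) @^-1` oset W.
Local Notation csf n d V := (mpoly n (exterior (cinf V) (d + d))).
Local Notation KW := (csf n (d + 1) W).
Variables (XM XP XE : csf n d W).
Hypotheses (hM : bihom 1 2 XM) (hP : bihom 2 0 XP) (hE : bihom 1 0 XE).
Hypotheses (rM : rep (muB i) XM) (rP : rep (piB i) XP) (rE : rep (EB i) XE).
Local Notation i1 := (@line_model R n d W).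
Local Notation i2 := (@pull_model R n W V VW (d + 1)).

Lemma lie_model : cbr XM XM = 0.
Proof.
apply: (rep_uniq (rep_br rM rM)); apply: rep_congr (@rep_0 R n d W).
by rewrite WE; apply: eq_on_sym; exact: (LB.2 i).
Qed.

Lemma jacobi_pi_model : cbr (cbr XP XM) XP = - (XE * XP *+ 2).
Proof.
apply: (rep_uniq (rep_br (rep_br rP rM) rP)).
have [_ _ H _] := JB; apply: (@rep_congr _ _ _ _ (- (EB i * piB i *+ 2))).
  by rewrite WE; apply: eq_on_sym; exact: (H i).
by apply: rep_N; rewrite 2!mulr2n; apply: rep_D; apply: rep_M.
Qed.

Lemma jacobi_E_model : cbr (cbr XE XM) XP = 0.
Proof.
apply: (rep_uniq (rep_br (rep_br rE rM) rP)); apply: rep_congr (@rep_0 R n d W).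
by have [_ _ _ H] := JB; rewrite WE; apply: eq_on_sym; exact: (H i).
Qed.

Lemma rep_line (F : cofun B) X : rep (F i) X -> rep (line_incl F i) (i1 X).
Proof.
move=> rF; have := rep_rincl (lshift 1) id (smooth_map_id W) rF.
by rewrite -line_inclE.
Qed.

Lemma rep_pull (F : cofun A) X : rep (V := W) (F i) X -> rep (pull_incl F i) (i2 X).
Proof.
move=> rF; have -> := pull_inclE (A := A) F i.
exact: (rep_rincl id (lshift 1) (smooth_map_pull VW) rF).
Qed.

Lemma rep_phi : rep (V := W) (phi i) (m_phi d W).
Proof.
apply: rep_congr (@rep_go R n (d + 1) W _); rewrite WE; apply: eq_on_sym; exact: (line_phiE (B := B)).
Qed.

Lemma rep_eps : rep (V := W) (eps i) (m_eps d W).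
Proof.
apply: rep_congr (@rep_go R n (d + 1) W _); rewrite WE; apply: eq_on_sym; exact: (line_epsE (B := B)).
Qed.

Lemma rep_id e (A' : vbundle R n e) (j : vb_idx A') :
  rep (cf_id A' j) (gid (cinf W) n e).
Proof. by apply: rep_sum => a; apply: rep_M; exact: rep_go. Qed.

Lemma rep_id_dual e (A' : vbundle R n e) (j : vb_idx A') :
  rep (cf_id_dual A' j) (- gid (cinf W) n e).
Proof.
rewrite /gid -sumrN; apply: rep_sum => a.
have -> : - (go (cinf W) n (lshift e a) * go (cinf W) n (rshift e a)) =
    go (cinf W) n (rshift e a) * go (cinf W) n (lshift e a) by rewrite [RHS]go_anti.
by apply: rep_M; exact: rep_go.
Qed.

Lemma rep_jd (P : cofun A) X : rep (V := W) (P i) X ->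
  rep (jdiff nuA (- E) P i) (m_jd XM XP XE X).
Proof.
move=> rX; have rm := rep_line rM; have rp := rep_line rP; have re := rep_line rE.
have rf := rep_phi; have rs := rep_eps.
have ri : rep (idB i) (i1 (gid (cinf W) n d)) := rep_line (@rep_id d B i).
have rnu := rep_D (rep_D (rep_D (rep_br rp rm) (rep_M rf rp)) (rep_M rs (rep_br rm re)))
  (rep_N (rep_M re ri)).
exact: (rep_D (rep_br rnu rX) (rep_M (rep_N re) rX)).
Qed.

Lemma rep_jbr (P Q : cofun A) X Y : rep (V := W) (P i) X -> rep (V := W) (Q i) Y ->
  rep (jbracket mu phi P Q i) (m_jbr XM X Y).
Proof.
move=> rX rY; have rm := rep_line rM; have rf := rep_phi.
have rI := @rep_id (d + 1) A i.
have r1 := rep_br (rep_br rX (rep_D rm (rep_M rI rf))) rY.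
exact: (rep_D (rep_D r1 (rep_N (rep_M rX (rep_br rf rY)))) (rep_M (rep_br rX rf) rY)).
Qed.

Lemma rep_nu : rep (V := W) (nuA i) (nu (@cbr R n (d + 1) W) (i1 XM) (m_phi d W) (m_eps d W)
  (i1 XP) (i1 XE) (i1 (gid (cinf W) n d))).
Proof.
have rm := rep_line rM; have rp := rep_line rP; have re := rep_line rE.
have rf := rep_phi; have rs := rep_eps.
have ri : rep (idB i) (i1 (gid (cinf W) n d)) := rep_line (@rep_id d B i).
exact: (rep_D (rep_D (rep_D (rep_br rp rm) (rep_M rf rp)) (rep_M rs (rep_br rm re)))
  (rep_N (rep_M re ri))).
Qed.

Lemma rep_in_F k l (F : cofun A) : in_F k l F ->
  exists2 X : KW, rep (F i) X & bihom k l X.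
Proof.
move=> /in_FE[okF _].
exact: ((chart_okP _ _ _ (@image_open _ _ _ A i)).1 (okF i) W WE).
Qed.

Lemma rep_wedge (P : cofun A) : in_wedge P -> exists N (Q : nat -> KW),
  (forall k, bihom k 0 (Q k)) /\ rep (P i) (\sum_(k < N) Q k).
Proof.
move=> [N [Q [inQ PQ]]].
have /choice[X HX] : forall k, exists X : KW, rep (Q k i) X /\ bihom k 0 X.
  by move=> k; have [X rX hX] := rep_in_F (inQ k); exists X.
exists N, X; split=> [k|]; first exact: (HX k).2.
have sE : (\sum_(k < N) Q k) i = \sum_(k < N) Q k i.
  by elim: N {PQ} => [|N IH]; rewrite ?big_ord0 // !big_ord_recr /= -IH.
apply: (@rep_congr _ _ _ _ ((\sum_(k < N) Q k) i)).
  by rewrite WE; apply: eq_on_sym; exact: (PQ i).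
by rewrite sE; apply: rep_sum => k; exact: (HX k).1.
Qed.

Lemma rep_sign k : rep (V := W) (((-1) ^+ k : cofun A) i) ((-1) ^+ k).
Proof.
elim: k => [|k IH]; first exact: rep_1.
rewrite !exprS; exact: (rep_M (rep_N (@rep_1 R n (d + 1) W)) IH).
Qed.

Lemma chart_jacobi_algebroid : sf_eq_on (oset W) (bb (mu + phi) (mu + phi) i) 0.
Proof.
have rmf := rep_D (rep_line rM) rep_phi.
apply: (rep_eq_on (rep_br rmf rmf)).
have H : cbr (i1 XM + m_phi d W) (i1 XM + m_phi d W) = 0.
  have BP := csf_poisson (d + 1) W; have p1 : spar true (i1 XM) by apply: spar_gincl; exact: (bihom_spar hM).
  have p2 : spar true (m_phi d W) by exact: spar_go.
  apply: (br_bialgebroid BP p1 p2).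
  - by rewrite -line_model_br lie_model i1_0.
  - by rewrite (anti_o BP p1 p2) phi_line_model.
  apply: etrans (gbr_gval (@cderD R n W) (@cderM R n W) (Go _ _ _) (Go _ _ _)) _.
  by rewrite /gtab conj_ix_l eq_lrshift gf0.
by rewrite H; exact: rep_0.
Qed.

Lemma chart_jd_jd P : in_wedge P -> sf_eq_on (oset W) (jdiff nuA (- E) (jdiff nuA (- E) P) i) 0.
Proof.
move=> /rep_wedge[N [Q [hQ rQ]]].
have H := m_jd_jd_sum VW hM hP hE lie_model jacobi_pi_model jacobi_E_model N hQ.
apply: (@pull_model_eq_on _ _ _ _ _ VW _ _ _ _ (rep_jd (rep_jd rQ)) (@rep_0 R n (d + 1) W)).
exact: (eq_trans H (esym (i2_0 d VW))).
Qed.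

Lemma chart_jd_jbr k a b : in_F k 0 a -> in_wedge b ->
  sf_eq_on (oset W) (jdiff nuA (- E) (jbracket mu phi a b) i)
    ((jbracket mu phi (jdiff nuA (- E) a) b
      + (-1) ^+ k.+1 * jbracket mu phi a (jdiff nuA (- E) b) : cofun A) i).
Proof.
move=> /rep_in_F[Y rY hY] /rep_wedge[N [Q [hQ rQ]]].
apply: (@pull_model_eq_on _ _ _ _ _ VW _ _ _ _ (rep_jd (rep_jbr rY rQ))
  (rep_D (rep_jbr (rep_jd rY) rQ) (rep_M (rep_sign k.+1) (rep_jbr rY (rep_jd rQ))))).
exact: (m_jd_jbr_sum VW hM hP hE lie_model jacobi_pi_model jacobi_E_model N hY hQ).
Qed.

Lemma chart_anti : sf_eq_on (oset W) (bb pi mu i) ((- bb mu pi : cofun A) i).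
Proof.
have rm := rep_line rM; have rp := rep_line rP.
apply: (rep_eq_on (rep_br rp rm)).
have p1 : spar true (i1 XM) by apply: spar_gincl; exact: (bihom_spar hM).
have p2 : spar false (i1 XP) by apply: spar_gincl; exact: (bihom_spar hP).
rewrite (anti_e (csf_poisson (d + 1) W) p2 p1).
exact: (rep_N (rep_br rm rp)).
Qed.

Local Notation mu0A := (poisson0 mu phi).
Local Notation PA := (poissonization_jacobi piB EB).
Local Notation nu1A := (poisson1 nuA (- E)).
Local Notation k_mu0 := (mu0 (i2 (i1 XM)) (i2 (m_phi d W)) (m_pt d V)).
Local Notation k_P := (m_exp d V (- 1) * biv (i2 (m_eps d W)) (i2 (i1 XP)) (i2 (i1 XE))).
Local Notation k_nu1 := (beta (@cbr R (n + 1) (d + 1) V) (gid (cinf V) (n + 1) (d + 1))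
  (i2 (i1 XM)) (i2 (m_phi d W)) (i2 (m_eps d W)) (i2 (i1 XP)) (i2 (i1 XE)) (m_pt d V)
  (m_exp d V (- 1)) (i2 (i1 (gid (cinf W) n d)))).
Let BP := csf_poisson (d + 1) V.
Let JD := m_jacobi_data VW hM hP hE lie_model jacobi_pi_model jacobi_E_model.

Lemma rep_exp : rep (V := V) (exp_opp_t A i) (m_exp d V (- 1)).
Proof. by apply: rep_gf => x Vx; rewrite (mkcinfE _ Vx) mulN1r. Qed.

Lemma rep_mu0 : rep (V := V) (mu0A i) k_mu0.
Proof.
exact: (rep_D (rep_pull (rep_line rM)) (rep_M (rep_pull rep_phi) (@rep_gx R (n + 1) (d + 1) V _))).
Qed.

Lemma rep_P : rep (V := V) (PA i) k_P.
Proof.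
have r := rep_M rep_exp (@rep_pull (line_incl piB + line_eps B * line_incl EB) _
  (rep_D (rep_line rP) (rep_M rep_eps (rep_line rE)))).
by rewrite /biv -(i2_M VW) -(i2_D VW).
Qed.

Lemma rep_nu1 : rep (V := V) (nu1A i) k_nu1.
Proof.
have rd := rep_pull (@rep_id_dual (d + 1) A i).
have rt := @rep_gx R (n + 1) (d + 1) V (rshift n ord0).
have r := rep_M rep_exp (rep_D (@rep_pull nuA _ rep_nu)
  (rep_M (@rep_pull (- E) _ (rep_N (rep_line rE))) (rep_D rt rd))).
have E1 := morph_nu (i2_D VW) (i2_N VW) (i2_M VW) (@pull_model_br R n W V VW (d + 1))
  (i1 XM) (m_phi d W) (m_eps d W) (i1 XP) (i1 XE) (i1 (gid (cinf W) n d)).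
have E2 := i2_N VW (i1 XE).
have E3 : i2 (- gid (cinf W) n (d + 1)) = - gid (cinf V) (n + 1) (d + 1).
  exact: (eq_trans (i2_N VW _) (congr1 -%R (esym (m_id_pull d VW)))).
by rewrite E1 E2 E3 in r.
Qed.

Lemma chart_mu0 : sf_eq_on (oset V) (bb mu0A mu0A i) 0.
Proof.
apply: (rep_eq_on (rep_br rep_mu0 rep_mu0)); rewrite (mu0_mu0 BP JD); exact: rep_0.
Qed.

Lemma chart_poisson : sf_eq_on (oset V) (lie_bracket mu0A PA PA i) 0.
Proof.
apply: (rep_eq_on (rep_br (rep_br rep_P rep_mu0) rep_P)).
rewrite (poissonization_eq BP JD) (poisson_eq BP JD); exact: rep_0.
Qed.

Lemma chart_bialgebroid : sf_eq_on (oset V) (bb (mu0A + nu1A) (mu0A + nu1A) i) 0.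
Proof.
have r := rep_D rep_mu0 rep_nu1; apply: (rep_eq_on (rep_br r r)).
have [mb bb0] := mu0_beta BP JD.
rewrite (br_bialgebroid BP (bp_par BP (h_mu0 BP JD)) (bp_par BP (h_beta BP JD)) (mu0_mu0 BP JD) mb bb0).
exact: rep_0.
Qed.

Lemma chart_poissonization : sf_eq_on (oset V) (nu1A i) (bb PA mu0A i).
Proof.
apply: (rep_eq_on rep_nu1); rewrite -(poissonization_eq BP JD).
exact: (rep_br rep_P rep_mu0).
Qed.
End ChartModel.

Lemma cf_id_dualE (R : realType) n d (A : vbundle R n d) i : cf_id_dual A i = - cf_id A i.
Proof. by rewrite /cf_id_dual /cf_id -sumrN; apply: eq_bigr => a _; exact: go_anti. Qed.

Section ChartCases.
Variables (R : realType) (n d : nat) (B : vbundle R n d) (muB piB EB : cofun B).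
Hypotheses (LB : lie_algebroid muB) (JB : jacobi_structure muB piB EB).
Local Notation A := (add_line B).
Local Notation pA := (pullback A).

(** A chart with empty image imposes no condition; otherwise the given structures
    have representatives over its image. *)
Lemma chart_cases i (G : set 'rV[R]_n -> set 'rV[R]_(n + 1) -> Prop) :
  G set0 set0 ->
  (forall (W : odom R n) (V : odom R (n + 1)), oset W = vb_image (A := B) i ->
    forall VW : oset V = (lsubmx : 'rV[R]_(n + 1) -> 'rV[R]_n) @^-1` oset W,
    forall XM XP XE : mpoly n (exterior (cinf W) (d + d)),
    bihom 1 2 XM -> bihom 2 0 XP -> bihom 1 0 XE ->
    rep (muB i) XM -> rep (piB i) XP -> rep (EB i) XE -> G (oset W) (oset V)) ->
  G (vb_image (A := A) i) (vb_image (A := pA) i).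
Proof.
move=> G0 GWV.
have pE : vb_image (A := pA) i = (lsubmx : 'rV[R]_(n + 1) -> 'rV[R]_n) @^-1` vb_image (A := B) i.
  by apply/funext => x; rewrite (pull_image_dom (A := A)).
have -> : vb_image (A := A) i = vb_image (A := B) i by [].
case: (odom_ex (@image_open _ _ _ B i)) => [E0|[W WE]].
  by rewrite pE E0 preimage_set0.
have oV : open (vb_image (A := pA) i) := @image_open _ _ _ pA i.
have Vx : vb_image (A := pA) i (row_mx (opoint W) 0).
  by rewrite pE /preimage /= row_mxKl -WE; exact: opointP.
pose V := Odom oV Vx.
have VW : oset V = (lsubmx : 'rV[R]_(n + 1) -> 'rV[R]_n) @^-1` oset W by rewrite WE.
have rF k l (F : cofun B) : in_F k l F ->
    exists2 X : mpoly n (exterior (cinf W) (d + d)), rep (F i) X & bihom k l X.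
  by move=> /in_FE[okF _]; exact: ((chart_okP _ _ _ (@image_open _ _ _ B i)).1 (okF i) W WE).
have [XM rM hM] := rF _ _ _ LB.1; have [inP inE _ _] := JB.
have [XP rP hP] := rF _ _ _ inP; have [XE rE hE] := rF _ _ _ inE.
have H := GWV W V WE VW XM XP XE hM hP hE rM rP rE.
by rewrite -WE.
Qed.
Lemma chart_cases_line i (F G : superfun R n (d + 1)) :
  (forall (W : odom R n) (V : odom R (n + 1)), oset W = vb_image (A := B) i ->
    forall VW : oset V = (lsubmx : 'rV[R]_(n + 1) -> 'rV[R]_n) @^-1` oset W,
    forall XM XP XE : mpoly n (exterior (cinf W) (d + d)),
    bihom 1 2 XM -> bihom 2 0 XP -> bihom 1 0 XE ->
    rep (muB i) XM -> rep (piB i) XP -> rep (EB i) XE -> sf_eq_on (oset W) F G) ->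
  sf_eq_on (vb_image (A := A) i) F G.
Proof. by move=> H; apply: (@chart_cases i (fun S _ => sf_eq_on S F G)) => // w S x []. Qed.

Lemma chart_cases_pull i (F G : superfun R (n + 1) (d + 1)) :
  (forall (W : odom R n) (V : odom R (n + 1)), oset W = vb_image (A := B) i ->
    forall VW : oset V = (lsubmx : 'rV[R]_(n + 1) -> 'rV[R]_n) @^-1` oset W,
    forall XM XP XE : mpoly n (exterior (cinf W) (d + d)),
    bihom 1 2 XM -> bihom 2 0 XP -> bihom 1 0 XE ->
    rep (muB i) XM -> rep (piB i) XP -> rep (EB i) XE -> sf_eq_on (oset V) F G) ->
  sf_eq_on (vb_image (A := pA) i) F G.
Proof. by move=> H; apply: (@chart_cases i (fun _ S => sf_eq_on S F G)) => // w S x []. Qed.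
End ChartCases.

Theorem proposition4p5 (R : realType) (n d : nat) (B : vbundle R n d)
    (muB piB EB : cofun B) :
  lie_algebroid muB ->
  jacobi_structure muB piB EB ->
  let A := add_line B in
  let mu : cofun A := line_incl muB in
  let pi : cofun A := line_incl piB in
  let E : cofun A := line_incl EB in
  let idB : cofun A := line_incl (cf_id B) in
  let eps : cofun A := line_eps B in
  let phi : cofun A := line_phi B in
  let nu : cofun A := bb pi mu + phi * pi + eps * bb mu E - E * idB in
  jacobi_bialgebroid mu phi nu (- E) /\
  (let mu0 := poisson0 mu phi in
   let P := poissonization_jacobi piB EB in
   [/\ lie_algebroid mu0,
       poisson_structure mu0 P,
       lie_bialgebroid (poissonization mu phi nu (- E)) &
       cf_eq2 (poissonization mu phi nu (- E)) (lie_bialgebroid_of mu0 P)]).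
Proof.
move=> LB JB A mu pi E idB eps phi nu.
have [inP inE _ _] := JB.
have in_mu : in_F 1 2 mu := in_F_line LB.1.
have in_pi : in_F 2 0 pi := in_F_line inP.
have in_E : in_F 1 0 E := in_F_line inE.
have in_phi : in_F 0 1 phi := in_F_phi B.
have in_eps : in_F 1 0 eps := in_F_eps B.
have in_id : in_F 1 1 idB := in_F_line (in_F_id B).
have in_NE : in_F 1 0 (- E) := in_F_N in_E.
(* The bracket glues when the multivector is its second argument. *)
have in_pimu : in_F 2 1 (bb pi mu).
  apply: in_F_congr (in_F_N (in_F_bb (k' := 1) in_mu in_pi)) => i.
  apply: eq_on_sym; apply: (chart_cases_line LB JB).
  by move=> W V WE VW XM XP XE hM hP hE rM rP rE; exact: (chart_anti hM hP rM rP).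
have in_nu : in_F 2 1 nu.
  apply: in_F_D (in_F_N (in_F_M in_E in_id)).
  apply: in_F_D (in_F_M in_eps (in_F_bb (k' := 0) in_mu in_E)).
  exact: in_F_D in_pimu (in_F_M in_phi in_pi).
have in_mu0 : in_F 1 2 (poisson0 mu phi).
  exact: in_F_D (in_F_pull in_mu) (in_F_M (in_F_pull in_phi) (in_F_partial_t A)).
have in_nu1 : in_F 2 1 (poisson1 nu (- E)).
  apply: (in_F_M (k := 0) (l := 0) (in_F_exp_opp_t A)).
  apply: in_F_D (in_F_pull in_nu) (in_F_M (in_F_pull in_NE) _).
  apply: in_F_D (in_F_partial_t A) (in_F_pull _).
  apply: in_F_congr (in_F_N (in_F_id A)) => i w S x _.
  by have -> := @cf_id_dualE R n (d + 1) A i.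
have in_P : in_F 2 0 (poissonization_jacobi piB EB).
  apply: (in_F_M (k := 0) (l := 0) (in_F_exp_opp_t A)); apply: in_F_pull.
  exact: in_F_D in_pi (in_F_M in_eps in_E).
split; first split.
- split; first by split.
  move=> i; apply: (chart_cases_line LB JB).
  by move=> W V WE VW XM XP XE hM hP hE rM rP rE; exact: (chart_jacobi_algebroid LB WE hM rM).
- by split.
- move=> P wP i; apply: (chart_cases_line LB JB).
  move=> W V WE VW XM XP XE hM hP hE rM rP rE.
  exact: (chart_jd_jd LB JB WE VW hM hP hE rM rP rE wP).
- move=> k a b ina wb i; apply: (chart_cases_line LB JB).
  move=> W V WE VW XM XP XE hM hP hE rM rP rE.
  exact: (chart_jd_jbr LB JB WE VW hM hP hE rM rP rE ina wb).
move=> mu0 P; split.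
- split; first exact: in_mu0.
  move=> i; apply: (chart_cases_pull LB JB).
  move=> W V WE VW XM XP XE hM hP hE rM rP rE.
  exact: (chart_mu0 LB JB WE VW hM hP hE rM rP rE).
- split; first exact: in_P.
  move=> i; apply: (chart_cases_pull LB JB).
  move=> W V WE VW XM XP XE hM hP hE rM rP rE.
  exact: (chart_poisson LB JB WE VW hM hP hE rM rP rE).
- split; [exact: in_mu0|exact: in_nu1|].
  move=> i; apply: (chart_cases_pull LB JB).
  move=> W V WE VW XM XP XE hM hP hE rM rP rE.
  exact: (chart_bialgebroid LB JB WE VW hM hP hE rM rP rE).
split=> i; first by move=> w S x _.
apply: (chart_cases_pull LB JB).
move=> W V WE VW XM XP XE hM hP hE rM rP rE.
exact: (chart_poissonization LB JB WE VW hM hP hE rM rP rE).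
Qed.
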